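(* Let $n,m_+,m_-$ be nonnegative integers and let $D$ be a linear operator on $L^{2}(n,m_{+},m_{-})$ with $\mathring{\partial}_{x}\subseteq D\subseteq\partial_{x}$. For $u=(u_{1/2},u_{\infty},u_{-\infty})\in H^{1}(n,m_{+},m_{-})$ write $$u^{r}:=\begin{pmatrix}u_{1/2}(\tfrac12-)\\ u_{-\infty}(\tfrac12-)\end{pmatrix}\in\mathbb{R}^{n+m_-},\qquad u^{l}:=\begin{pmatrix}u_{1/2}(-\tfrac12+)\\ u_{\infty}(-\tfrac12+)\end{pmatrix}\in\mathbb{R}^{n+m_+}.$$ (a) The following statements are equivalent: (i) $D$ is accretive, that is, $\operatorname{Re}\langle Du,u\rangle\geq 0$ for all $u\in\operatorname{dom}(D)$. (ii) There exists $M\in\mathbb{R}^{(n+m_{+})\times(n+m_{-})}$ with $M^{*}M\leq 1$ such that $\operatorname{dom}(D)\subseteq\{u\in H^{1}(n,m_{+},m_{-}) : Mu^{r}+u^{l}=0\}$. (b) Let $M\in\mathbb{R}^{(n+m_{+})\times(n+m_{-})}$ be such that $\operatorname{dom}(D)=\{u\in H^{1}(n,m_{+},m_{-}) : Mu^{r}+u^{l}=0\}$. Then $\mathring{\partial}_{x}\subseteq -D^{*}\subseteq\partial_{x}$ and $$\operatorname{dom}(D^{*})=\{v\in H^{1}(n,m_{+},m_{-}) : v^{r}+M^{*}v^{l}=0\}.$$ (c) $D$ is maximal accretive (that is, $D$ is accretive and there exists no accretive relation properly extending $D$; equivalently, $D$ and $D^{*}$ are accretive) if and only if there exists $M\in\mathbb{R}^{(n+m_{+})\times(n+m_{-})}$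 with $M^{*}M\leq 1$ such that $$\operatorname{dom}(D)=\{u\in H^{1}(n,m_{+},m_{-}) : Mu^{r}+u^{l}=0\}.$$
   Context: All function spaces consist of real-valued functions. Define $$L^{2}(n,m_{+},m_{-}):=L^{2}(]-\tfrac12,\tfrac12[)^{n}\oplus L^{2}(]-\tfrac12,\infty[)^{m_{+}}\oplus L^{2}(]-\infty,\tfrac12[)^{m_{-}},$$ $$H^{1}(n,m_{+},m_{-}):=H^{1}(]-\tfrac12,\tfrac12[)^{n}\oplus H^{1}(]-\tfrac12,\infty[)^{m_{+}}\oplus H^{1}(]-\infty,\tfrac12[)^{m_{-}},$$ and $H^1_0(n,m_+,m_-)$ in the same way with $H^1_0$ (the closure of the smooth compactly supported functions in $H^1$) in place of $H^1$. Elements are written $u=(u_{1/2},u_{\infty},u_{-\infty})$ according to this decomposition. Point evaluations at boundary points, such as $u_{1/2}(\tfrac12-)$ (limit from the left) and $u_{1/2}(-\tfrac12+)$ (limit from the right), are those of the continuous representatives (Sobolev embedding). $\partial_x$ is the operator on $L^2(n,m_+,m_-)$ with domain $H^1(n,m_+,m_-)$ acting as componentwise weak derivative, and $\mathring{\partial}_x$ is its restriction to $H^1_0(n,m_+,m_-)$. For operators, $S\subseteq T$ means that $T$ extends $S$. Adjoints are computed in $L^2(n,m_+,m_-)$. $M^*M\le 1$ means that $1-M^*M$ is positive semidefinite. A linear relation (linear subspace) $R\subseteq L^2(n,m_+,m_-)\times L^2(n,m_+,m_-)$ is accretive if $\operatorname{Re}\langle g,f\rangle\ge0$ for all $(f,g)\in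 R$; operators are identified with their graphs. *)

(* Defs.v *)
From HB Require Import structures.
From mathcomp Require Import all_boot all_order all_algebra.
From mathcomp Require Import all_classical all_reals all_analysis.

Set Implicit Arguments.
Unset Strict Implicit.
Unset Printing Implicit Defensive.

Import Order.TTheory GRing.Theory Num.Theory.
Import numFieldNormedType.Exports.

Local Open Scope classical_set_scope.
Local Open Scope ring_scope.

(* L^p(mu) as a vector space.  The library's [LspaceType] carries no algebraic
   structure, so the vector space [LfunType] of p-integrable functions is
   divided here by almost everywhere equality. *)
Section Lquot.
Context d (T : measurableType d) (R : realType).
Variables (mu : {measure set T -> \bar R}) (p : \bar R) (p1 : (1 <= p)%E).
Local Notation Lfn := (LfunType mu p1).
Local Open Scope quotient_scope.

Definition Lae (f g : Lfn) : bool := `[< (f : T -> R) = g %[ae mu] >].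

Lemma Lae_refl : reflexive Lae.
Proof. by move=> f; apply/asboolP; apply: nearW. Qed.

Lemma Lae_sym : symmetric Lae.
Proof.
by move=> f g; apply/asboolP/asboolP; apply: filterS => x /[swap] _ ->.
Qed.

Lemma Lae_trans : transitive Lae.
Proof.
move=> g f h /asboolP fg /asboolP gh; apply/asboolP.
by apply: filterS2 fg gh => x h1 h2 xT; rewrite h1// h2.
Qed.

Canonical Lae_equiv := EquivRel Lae Lae_refl Lae_sym Lae_trans.

Definition Lquot : Type := {eq_quot Lae}.
HB.instance Definition _ := Choice.on Lquot.
HB.instance Definition _ := EqQuotient.on Lquot.

Definition Lquot_fun (u : Lquot) : T -> R := (repr u : Lfn).
Definition Lquot_of (f : Lfn) : Lquot := \pi f.

Lemma Lquot_ofP (f g : Lfn) :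
  Lquot_of f = Lquot_of g <-> (f : T -> R) = g %[ae mu].
Proof. by split=> [/eqmodP/asboolP//|fg]; apply/eqmodP/asboolP. Qed.

Lemma Lquot_ofK (u : Lquot) : Lquot_of (repr u) = u.
Proof. exact: reprK. Qed.

Lemma Lquot_funE (f : Lfn) : Lquot_fun (Lquot_of f) = f %[ae mu].
Proof. by apply/Lquot_ofP; exact: Lquot_ofK. Qed.

Definition Lquot_zero : Lquot := Lquot_of 0.
Definition Lquot_opp (u : Lquot) : Lquot := Lquot_of (- repr u).
Definition Lquot_add (u v : Lquot) : Lquot := Lquot_of (repr u + repr v).
Definition Lquot_scale (a : R) (u : Lquot) : Lquot := Lquot_of (a *: repr u).

Lemma Lquot_oppE f : Lquot_opp (Lquot_of f) = Lquot_of (- f).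
Proof.
apply/Lquot_ofP; apply: filterS (Lquot_funE f) => x /= h _.
by congr (- _); exact: h.
Qed.

Lemma Lquot_addE f g : Lquot_add (Lquot_of f) (Lquot_of g) = Lquot_of (f + g).
Proof.
apply/Lquot_ofP; apply: filterS2 (Lquot_funE f) (Lquot_funE g) => x /= h k _.
by congr (_ + _); [exact: h|exact: k].
Qed.

Lemma Lquot_scaleE a f : Lquot_scale a (Lquot_of f) = Lquot_of (a *: f).
Proof.
apply/Lquot_ofP; apply: filterS (Lquot_funE f) => x /= h _.
by congr (a *: _); exact: h.
Qed.

Lemma Lquot_addA : associative Lquot_add.
Proof.
move=> u v w; rewrite -(Lquot_ofK u) -(Lquot_ofK v) -(Lquot_ofK w).
by rewrite !Lquot_addE addrA.
Qed.

Lemma Lquot_addC : commutative Lquot_add.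
Proof. by move=> u v; rewrite /Lquot_add addrC. Qed.

Lemma Lquot_add0 : left_id Lquot_zero Lquot_add.
Proof. by move=> u; rewrite -(Lquot_ofK u) Lquot_addE add0r. Qed.

Lemma Lquot_addN : left_inverse Lquot_zero Lquot_opp Lquot_add.
Proof. by move=> u; rewrite -(Lquot_ofK u) Lquot_oppE Lquot_addE addNr. Qed.

HB.instance Definition _ := GRing.isZmodule.Build Lquot
  Lquot_addA Lquot_addC Lquot_add0 Lquot_addN.

Lemma Lquot_scaleA a b u :
  Lquot_scale a (Lquot_scale b u) = Lquot_scale (a * b) u.
Proof. by rewrite -(Lquot_ofK u) !Lquot_scaleE scalerA. Qed.

Lemma Lquot_scale1 : left_id 1 Lquot_scale.
Proof. by move=> u; rewrite -(Lquot_ofK u) Lquot_scaleE scale1r. Qed.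

Lemma Lquot_scaleDr : right_distributive Lquot_scale +%R.
Proof.
move=> a u v; rewrite -(Lquot_ofK u) -(Lquot_ofK v).
rewrite -[LHS]/(Lquot_scale a (Lquot_add _ _)) -[RHS]/(Lquot_add _ _).
by rewrite Lquot_addE !Lquot_scaleE Lquot_addE scalerDr.
Qed.

Lemma Lquot_scaleDl u : {morph Lquot_scale^~ u : a b / a + b}.
Proof.
move=> a b; rewrite -(Lquot_ofK u) -[RHS]/(Lquot_add _ _).
by rewrite !Lquot_scaleE Lquot_addE scalerDl.
Qed.

HB.instance Definition _ := GRing.Zmodule_isLmodule.Build R Lquot
  Lquot_scaleA Lquot_scale1 Lquot_scaleDr Lquot_scaleDl.

End Lquot.

Definition lebesgue_on (R : realType) (i : interval R) :
    {measure set (measurableTypeR R) -> \bar R} :=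
  mrestr lebesgue_measure (measurable_itv i).

(* Elements are classes of functions on the whole line modulo equality almost
   everywhere on [i]; their values outside [i] are irrelevant. *)
Definition L2 (R : realType) (i : interval R) : Type :=
  Lquot (lebesgue_on i) (lee1n 2 : (1 <= (2%:R : R)%:E)%E).

HB.instance Definition _ (R : realType) (i : interval R) :=
  GRing.Lmodule.on (L2 i).

Definition L2_fun (R : realType) (i : interval R) (u : L2 i) : R -> R :=
  Lquot_fun u.
Coercion L2_fun : L2 >-> Funclass.

Section Sobolev.
Context {R : realType}.
Implicit Types (i : interval R) (phi : R -> R).

Definition dotL2 i (u v : L2 i) : R := \int[lebesgue_on i]_x (u x * v x).

Definition test_fun i phi : Prop :=
  [/\ forall k x, derivable (derive1n k phi) x 1,
      compact (closure [set x | phi x != 0]) &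
      closure [set x | phi x != 0] `<=` [set` i]].

Definition weak_deriv i (u v : L2 i) : Prop :=
  forall phi, test_fun i phi ->
    \int[lebesgue_on i]_x (u x * derive1 phi x) =
    - \int[lebesgue_on i]_x (v x * phi x).

Definition H1 i : set (L2 i) := [set u | exists v, weak_deriv u v].

(* The closure of the test functions in the H^1-norm; the integral is
   the square of the H^1-norm of [u - phi]. *)
Definition H10 i : set (L2 i) :=
  [set u | exists2 v, weak_deriv u v &
    forall e : R, 0 < e -> exists2 phi, test_fun i phi &
    (\int[lebesgue_on i]_x
       (((u x - phi x) ^+ 2 + (v x - derive1 phi x) ^+ 2)%:E) < e%:E)%E].

(* The continuous representative on [i], unique on [i] when it exists. *)
Definition cont_repr i (u : L2 i) : R -> R :=
  get [set f : R -> R | {within [set` i], continuous f} /\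
                        {ae lebesgue_on i, forall x, f x = u x}].

Definition eval_right i (u : L2 i) (a : R) : R :=
  lim (cont_repr u x @[x --> a^'+]).

Definition eval_left i (u : L2 i) (a : R) : R :=
  lim (cont_repr u x @[x --> a^'-]).

End Sobolev.

(* Linear relations are linear subspaces of [V * V], and operators are
   identified with their graphs. *)
Section LinearRelations.
Context {R : realType} {V : lmodType R}.
Variable dot : V -> V -> R.
Implicit Types S : set (V * V).

Definition linear_relation S : Prop :=
  S 0 /\ forall (a : R) x y, S x -> S y -> S (a *: x + y).

Definition linear_operator S : Prop :=
  linear_relation S /\ forall u f g, S (u, f) -> S (u, g) -> f = g.

Definition dom S : set V := [set u | exists f, S (u, f)].

Definition opp_rel S : set (V * V) := [set x | S (x.1, - x.2)].

Definition adjoint S : set (V * V) :=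
  [set x | forall u f, S (u, f) -> dot f x.1 = dot u x.2].

(* The scalars are real, so [dot g f] is its own real part. *)
Definition accretive S : Prop := forall f g, S (f, g) -> 0 <= dot g f.

Definition maximal_accretive S : Prop :=
  accretive S /\
  forall S', linear_relation S' -> accretive S' -> S `<=` S' -> S' = S.

End LinearRelations.

Definition psd {R : realType} (k : nat) (A : 'M[R]_k) : Prop :=
  forall x : 'cV[R]_k, 0 <= (x^T *m A *m x) 0 0.

Section DerivativeOnDirectSum.
Context (R : realType) (n mp mm : nat).

Definition itv_half : interval R := `]- 2^-1, 2^-1[.
Definition itv_pos : interval R := `]- 2^-1, +oo[.
Definition itv_neg : interval R := `]-oo, 2^-1[.

Definition L2sum : Type :=
  ({ffun 'I_n -> L2 itv_half} * {ffun 'I_mp -> L2 itv_pos}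
   * {ffun 'I_mm -> L2 itv_neg})%type.
HB.instance Definition _ := GRing.Lmodule.on L2sum.

(* The components (u_{1/2}, u_oo, u_{-oo}) of [u]. *)
Definition u_half (u : L2sum) : {ffun 'I_n -> L2 itv_half} := u.1.1.
Definition u_pos (u : L2sum) : {ffun 'I_mp -> L2 itv_pos} := u.1.2.
Definition u_neg (u : L2sum) : {ffun 'I_mm -> L2 itv_neg} := u.2.

Definition dotL2sum (u v : L2sum) : R :=
  \sum_j dotL2 (u_half u j) (u_half v j)
  + \sum_j dotL2 (u_pos u j) (u_pos v j)
  + \sum_j dotL2 (u_neg u j) (u_neg v j).

Definition H1sum : set L2sum :=
  [set u | [/\ forall j, H1 (u_half u j), forall j, H1 (u_pos u j) &
               forall j, H1 (u_neg u j)]].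

Definition H10sum : set L2sum :=
  [set u | [/\ forall j, H10 (u_half u j), forall j, H10 (u_pos u j) &
               forall j, H10 (u_neg u j)]].

Definition deriv_op : set (L2sum * L2sum) :=
  [set x | [/\ forall j, weak_deriv (u_half x.1 j) (u_half x.2 j),
               forall j, weak_deriv (u_pos x.1 j) (u_pos x.2 j) &
               forall j, weak_deriv (u_neg x.1 j) (u_neg x.2 j)]].

Definition deriv0_op : set (L2sum * L2sum) :=
  [set x | deriv_op x /\ H10sum x.1].

Definition ur (u : L2sum) : 'cV[R]_(n + mm) :=
  col_mx (\col_j eval_left (u_half u j) 2^-1)
         (\col_j eval_left (u_neg u j) 2^-1).

Definition ul (u : L2sum) : 'cV[R]_(n + mp) :=
  col_mx (\col_j eval_right (u_half u j) (- 2^-1))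
         (\col_j eval_right (u_pos u j) (- 2^-1)).

Definition bc_space (M : 'M[R]_(n + mp, n + mm)) : set L2sum :=
  [set u | H1sum u /\ M *m ur u + ul u = 0].

Definition gram_le1 (M : 'M[R]_(n + mp, n + mm)) : Prop :=
  psd (1%:M - M^T *m M).

End DerivativeOnDirectSum.

Arguments dotL2sum {R n mp mm}.
Arguments H1sum {R n mp mm}.
Arguments H10sum {R n mp mm}.
Arguments deriv_op : clear implicits.
Arguments deriv0_op : clear implicits.

(* Main.v *)
From HB Require Import structures.
From mathcomp Require Import all_boot all_order all_algebra.
From mathcomp Require Import all_classical all_reals all_analysis.
From mathcomp Require Import measurable_realfun ring lra.
Require Import Defs.

(** Integrating by parts on each interval gives Green's formula
    [2 <f', f> = |f^r|^2 - |f^l|^2], so accretivity of [D] says that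
    [|u^l| <= |u^r|] on [dom D]; a linear relation with this property is part of
    the graph of a contraction [- M].  As [D] contains the derivative on [H^1_0],
    it is determined by its boundary values.  Any accretive relation [S]
    extending [D] lies in the maximal derivative: perturbing [(f, g)] in [S] by
    multiples of [(phi, phi')] for test functions [phi] forces
    [<g, phi> + <f, phi'> = 0].  So maximality is again a statement about
    boundary values.

    The analytic input is that a function with a weak derivative in [L^2] is a
    primitive of it (testing with plateaus at Lebesgue points), and that
    [H^1_0] consists of the functions with zero boundary values.  For the latter,
    the remainder [w] of the [H^1]-projection of such a function [u] onto the
    test functions satisfies [w'' = w] weakly, and Green's formula for [u] and
    [w'] shows that [w] is orthogonal to [u], hence zero. *)

Set Implicit Arguments.
Unset Strict Implicit.
Unset Printing Implicit Defensive.

Import Order.TTheory GRing.Theory Num.Theory.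
Import numFieldNormedType.Exports.

Local Open Scope classical_set_scope.
Local Open Scope ring_scope.

(** * Smooth functions *)

Section Smooth.
Context {R : realType}.
Implicit Types f g : R -> R.

(** The linear algebra is done for an abstract boundary triple: operators [T0] and [T], each minus
    the adjoint of the other, two trace maps that are jointly onto, and a quadratic Green identity.
    Only these facts about the derivative enter the statements on [M]. The traces take values in
    finite-dimensional spaces, and this alone turns an arbitrary [dom D] between the two extremes
    into a matrix condition. Two obstacles shape the analysis. A primitive of an L^2 function is
    differentiable only almost everywhere, so the formula for the increment of [F ^ 2] is derived
    from increments of [F] and an additivity argument rather than from a pointwise product rule. And
    [H10] is a closure, so vanishing traces must produce approximating test functions; an orthogonal
    projection in [L2 i * L2 i] takes the place of cut-offs and mollifiers, at the price of proving
    that L^2 is complete. *)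

Definition smooth f := forall k x, derivable (derive1n k f) x 1.

(** [smooth] iterates the derivative from the outside. Peeling it off at the inside lets products,
    inverses and affine substitutions be handled by induction on [k] from the first-order rules. *)
Fixpoint diff_upto k f : Prop :=
  if k is k'.+1 then (forall x, derivable f x 1) /\ diff_upto k' (derive1 f)
  else True.

Lemma derive1nSr k f : derive1n k.+1 f = derive1n k (derive1 f).
Proof. by rewrite /derive1n iterSr. Qed.

Lemma smoothP f : smooth f <-> forall k, diff_upto k f.
Proof.
split=> [sf k|sf k].
  elim: k f sf => //= k IH f sf; split; first exact: (sf 0).
  by apply: IH => j x; rewrite -derive1nSr; exact: sf.
elim: k f sf => [|k IH] f sf x; first by have [] := sf 1.
by rewrite derive1nSr; apply: IH => j; have [] := sf j.+1.
Qed.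

Lemma diff_uptoS k f f' :
  (forall x, is_derive (x : R) (1 : R) f (f' x)) ->
  diff_upto k f' -> diff_upto k.+1 f.
Proof.
move=> df kf'; split => [x|]; first exact: (@ex_derive _ _ _ _ _ _ _ (df x)).
suff -> : derive1 f = f' by [].
by apply/funext => x; rewrite derive1E; exact: derive_val.
Qed.

Lemma diff_upto_weaken k f : diff_upto k.+1 f -> diff_upto k f.
Proof. by elim: k f => // k IH f [df kf]; split => //; exact: IH. Qed.

Lemma diff_upto_is_derive k f :
  diff_upto k.+1 f -> forall x, is_derive (x : R) (1 : R) f (derive1 f x).
Proof. by move=> [df _] x; rewrite derive1E; exact: derivableP. Qed.

Lemma diff_uptoD k f g :
  diff_upto k f -> diff_upto k g -> diff_upto k (f \+ g).
Proof.
elim: k f g => // k IH f g kf kg.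
have df := diff_upto_is_derive kf; have dg := diff_upto_is_derive kg.
apply: (@diff_uptoS _ _ (derive1 f \+ derive1 g)).
by case: kf => _ kf; case: kg => _ kg; exact: IH.
Qed.

Lemma diff_uptoM k f g :
  diff_upto k f -> diff_upto k g -> diff_upto k (f \* g).
Proof.
elim: k f g => // k IH f g kf kg.
have df := diff_upto_is_derive kf; have dg := diff_upto_is_derive kg.
apply: (@diff_uptoS _ _ ((f \* derive1 g) \+ (g \* derive1 f))).
have kf' := diff_upto_weaken kf; have kg' := diff_upto_weaken kg.
by case: kf => _ kf; case: kg => _ kg; apply: diff_uptoD; exact: IH.
Qed.

Lemma diff_upto_cst k (c : R) : diff_upto k (cst c).
Proof.
by elim: k c => // k IH c; apply: (@diff_uptoS _ _ (cst 0)).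
Qed.

(** The derivative [- g' / g^2] contains [1/g] itself, needed to one order less; hence the induction
    on [k] with [g] fixed. *)
Lemma diff_upto_inv k g : (forall x, g x != 0) ->
  diff_upto k g -> diff_upto k (fun x => (g x)^-1).
Proof.
move=> g0; elim: k => // k IH kg.
have dg := diff_upto_is_derive kg.
have dV x : is_derive (x : R) (1 : R) (fun x => (g x)^-1)
    ((cst (- 1) \* (derive1 g \* ((fun x => (g x)^-1) \* (fun x => (g x)^-1)))) x).
  apply: (is_derive_eq (is_deriveV (g0 x) (dg x))).
  by rewrite /= -exprVn /GRing.scale/=; ring.
apply: (diff_uptoS dV).
have kv := IH (diff_upto_weaken kg).
apply: diff_uptoM; first exact: diff_upto_cst.
by case: kg => _ kg; apply: diff_uptoM => //; exact: diff_uptoM.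
Qed.

Lemma diff_upto_affine k g (a b : R) :
  diff_upto k g -> diff_upto k (fun x => g (a * x + b)).
Proof.
elim: k g => // k IH g kg.
have dg := diff_upto_is_derive kg.
apply: (@diff_uptoS _ _ (cst a \* (fun x => derive1 g (a * x + b)))).
  move=> x.
  have dl : is_derive (x : R) (1 : R) (fun x => a * x + b) a.
    have h1 : is_derive (x : R) (1 : R) (cst a \* id) (a *: 1 + x *: 0).
      exact: is_deriveM.
    have h2 := is_deriveD h1 (is_derive_cst b x 1).
    by apply: (is_derive_eq h2); rewrite /GRing.scale/=; ring.
  have h3 := @is_derive1_comp _ g (fun x => a * x + b) x _ _ (dg (a * x + b)) dl.
  apply: (is_derive_eq h3).
  by rewrite /= mulrC.
by case: kg => _ kg; apply: diff_uptoM; [exact: diff_upto_cst|exact: IH].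
Qed.

Lemma smooth_cst c : smooth (cst c).
Proof. by apply/smoothP => k; exact: diff_upto_cst. Qed.

Lemma smoothD f g : smooth f -> smooth g -> smooth (f \+ g).
Proof.
by move=> /smoothP sf /smoothP sg; apply/smoothP => k; exact: diff_uptoD.
Qed.

Lemma smoothM f g : smooth f -> smooth g -> smooth (f \* g).
Proof.
by move=> /smoothP sf /smoothP sg; apply/smoothP => k; exact: diff_uptoM.
Qed.

Lemma smoothV g : (forall x, g x != 0) ->
  smooth g -> smooth (fun x => (g x)^-1).
Proof.
by move=> g0 /smoothP sg; apply/smoothP => k; exact: diff_upto_inv.
Qed.

Lemma smooth_affine g (a b : R) :
  smooth g -> smooth (fun x => g (a * x + b)).
Proof.
by move=> /smoothP sg; apply/smoothP => k; exact: diff_upto_affine.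
Qed.

Lemma smooth_derive f : smooth f -> smooth (derive1 f).
Proof. by move=> sf k x; rewrite -derive1nSr; exact: sf. Qed.

Lemma smooth_is_derive f x : smooth f -> is_derive (x : R) (1 : R) f (derive1 f x).
Proof. by move=> sf; rewrite derive1E; apply: derivableP; exact: (sf 0). Qed.

Lemma smooth_continuous f : smooth f -> continuous f.
Proof.
by move=> sf x; apply/differentiable_continuous/derivable1_diffP; exact: (sf 0).
Qed.

Lemma smooth_measurable f : smooth f -> measurable_fun setT f.
Proof. by move=> /smooth_continuous; exact: continuous_measurable_fun. Qed.

End Smooth.

(** * The flat exponential functions *)

Section FlatExp.
Context {R : realType}.

Definition flat_exp n (x : R) : R :=
  if 0 < x then x^-1 ^+ n * expR (- x^-1) else 0.

Lemma flat_exp_ge0 n x : 0 <= flat_exp n x.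
Proof.
rewrite /flat_exp; case: ifP => // x0.
by rewrite mulr_ge0 ?expR_ge0// exprn_ge0// invr_ge0 ltW.
Qed.

(** From [exp y >= y^(n+1) / (n+1)!] at [y = 1/x]. *)
Lemma flat_exp_le n x : flat_exp n x <= n.+1`!%:R * `|x|.
Proof.
rewrite /flat_exp; case: ifPn => [x0|_]; last by rewrite mulr_ge0.
rewrite (gtr0_norm x0) expRN -(ler_pM2r (expR_gt0 x^-1)).
rewrite mulfVK ?gt_eqF ?expR_gt0//.
have y0 : 0 < x^-1 by rewrite invr_gt0.
have h : x^-1 ^+ n.+1 <= n.+1`!%:R * expR x^-1.
  rewrite -ler_pdivrMl ?ltr0n ?fact_gt0//.
  by apply: le_trans (expR_ge1Dxn n (ltW y0)); rewrite [leLHS]mulrC lerDr.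
have -> : x^-1 ^+ n = x * x^-1 ^+ n.+1 by rewrite exprS mulVKf ?gt_eqF.
by rewrite mulrAC mulrC ler_wpM2r// ltW.
Qed.

(* The functions [flat_exp n] are closed under differentiation up to linear
   combination, hence smooth. *)
Lemma flat_exp_is_derive n x :
  is_derive (x : R) (1 : R) (flat_exp n)
    (flat_exp n.+2 x - n%:R * flat_exp n.+1 x).
Proof.
have [x0|x0|<-] := ltgtP 0 x.
- have near_x : \near x, x^-1 ^+ n * expR (- x^-1) = flat_exp n x.
    near=> y; rewrite /flat_exp ifT//; near: y; exact: lt_nbhsr.
  apply: (near_eq_is_derive near_x).
  have xn0 : x != 0 by rewrite gt_eqF.
  have dV : is_derive (x : R) (1 : R) (fun y : R => y^-1) (- x ^- 2).
    apply: (is_derive_eq (@is_deriveV _ id x 1 1 xn0 (is_derive_id x 1))).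
    by rewrite /GRing.scale/= mulr1.
  have dN := is_deriveN dV.
  have dE := @is_derive1_comp _ expR (fun y => - y^-1) x _ _ (is_derive_expR (- x^-1)) dN.
  have := is_deriveX n dV; rewrite exprfctE => dX.
  apply: (is_derive_eq (is_deriveM dX dE)).
  rewrite /flat_exp x0 /GRing.scale/= -exprVn !opprK.
  case: n {near_x dX} => [|n] /=; first by rewrite !expr0; ring.
  by rewrite -mulr_natl !exprS; ring.
- have near_x : \near x, cst 0 x = flat_exp n x.
    near=> y; rewrite /flat_exp ifF//; apply/negbTE; rewrite -leNgt; apply: ltW.
    by near: y; exact: lt_nbhsl.
  apply: (near_eq_is_derive near_x).
  apply: (is_derive_eq (is_derive_cst _ _ _)).
  by rewrite /flat_exp ltNge (ltW x0)/=; ring.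
- have -> : flat_exp n.+2 0 - n%:R * flat_exp n.+1 0 = 0 :> R.
    by rewrite /flat_exp ltxx; ring.
  have lim0 : (h^-1 *: (flat_exp n (h *: 1 + 0) - flat_exp n 0))
      @[h --> (0:R)^'] --> (0:R).
    apply/cvgrPdist_le => e e0; near=> h.
    have h0 : h != 0 by near: h; exact: nbhs_dnbhs_neq.
    rewrite sub0r normrN addr0 /GRing.scale/= mulr1 {2}/flat_exp ltxx subr0.
    (* The difference quotient at 0 is again a member of the family, and the linear bound sends it
       to 0. *)
    have -> : h^-1 * flat_exp n h = flat_exp n.+1 h.
      by rewrite /flat_exp; case: ifP => _; rewrite ?mulr0// exprS mulrA.
    rewrite ger0_norm ?flat_exp_ge0//; apply: le_trans (flat_exp_le _ _) _.
    rewrite -ler_pdivlMl ?ltr0n ?fact_gt0//.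
    near: h; apply: dnbhs0_le.
    by rewrite mulr_gt0 ?invr_gt0 ?ltr0n ?fact_gt0.
  apply: DeriveDef; first by apply/cvg_ex; exists 0; exact: lim0.
  by apply/cvg_lim => //; exact: lim0.
Unshelve. all: by end_near. Qed.

Lemma smooth_flat_exp n : smooth (flat_exp n).
Proof.
apply/smoothP => k; elim: k n => // k IH n.
apply: (@diff_uptoS _ _ _ (flat_exp n.+2 \+ (cst (- n%:R) \* flat_exp n.+1))).
  by move=> x; apply: (is_derive_eq (flat_exp_is_derive n x)); rewrite /= mulNr.
by apply: diff_uptoD => //; apply: diff_uptoM => //; exact: diff_upto_cst.
Qed.

End FlatExp.

(** * Smooth steps, ramps, plateaus and test functions *)

Section TestFunctions.
Context {R : realType}.
Implicit Types (f phi : R -> R) (a b e x : R) (i : interval R).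

(** The classical smooth transition from 0 on the left of 0 to 1 on the right of 1. The term
    [- 1 * x + 1] is [1 - x] in the shape that [smooth_affine] expects. *)
Definition smooth_step x : R :=
  flat_exp 0 x / (flat_exp 0 x + flat_exp 0 (- 1 * x + 1)).

Lemma smooth_step_den_gt0 x : 0 < flat_exp 0 x + flat_exp 0 (- 1 * x + 1).
Proof.
have pos y : 0 < y -> 0 < flat_exp 0 y :> R.
  by move=> y0; rewrite /flat_exp y0 expr0 mul1r expR_gt0.
have [x0|x0] := ltP 0 x.
  by apply: ltr_wpDr; [exact: flat_exp_ge0|exact: pos].
by apply: ltr_wpDl; [exact: flat_exp_ge0|apply: pos; lra].
Qed.

Lemma smooth_smooth_step : smooth smooth_step.
Proof.
have s0 := @smooth_flat_exp R 0.
have den0 x : flat_exp 0 x + flat_exp 0 (- 1 * x + 1) != 0 :> R.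
  by rewrite gt_eqF ?smooth_step_den_gt0.
exact: (smoothM s0 (smoothV den0 (smoothD s0 (smooth_affine s0)))).
Qed.

Lemma smooth_step_le0 x : x <= 0 -> smooth_step x = 0.
Proof. by move=> x0; rewrite /smooth_step {1}/flat_exp ltNge x0/= mul0r. Qed.

Lemma smooth_step_ge1 x : 1 <= x -> smooth_step x = 1.
Proof.
move=> x1; have := smooth_step_den_gt0 x; rewrite /smooth_step.
have -> : flat_exp 0 (- 1 * x + 1) = 0.
  by rewrite /flat_exp ifF//; apply/negbTE; rewrite -leNgt; lra.
by rewrite addr0 => h; rewrite divff ?gt_eqF.
Qed.

Lemma smooth_step_ge0 x : 0 <= smooth_step x.
Proof. by rewrite divr_ge0 ?flat_exp_ge0// ltW ?smooth_step_den_gt0. Qed.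

Lemma smooth_step_le1 x : smooth_step x <= 1.
Proof.
by rewrite ler_pdivrMr ?smooth_step_den_gt0// mul1r lerDl flat_exp_ge0.
Qed.

Lemma derive1_near_cst f x (c : R) : (\near x, f x = c) -> derive1 f x = 0.
Proof.
move=> fc; rewrite derive1E -(derive_cst c x (1 : R)).
by apply: near_eq_derive.
Qed.

Lemma derive_smooth_step_bounded :
  exists2 C : R, 0 <= C & forall x, `|derive1 smooth_step x| <= C.
Proof.
have cd : continuous (derive1 smooth_step).
  by apply: smooth_continuous; apply: smooth_derive; exact: smooth_smooth_step.
have cn : {within `[0, 1 : R], continuous (fun x => `|derive1 smooth_step x|)}.
  apply: continuous_subspaceT => x; apply: continuous_comp; first exact: cd.
  exact: norm_continuous.
have [c _ cmax] := EVT_max ler01 cn.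
exists `|derive1 smooth_step c|; first exact: normr_ge0.
move=> x.
have [x0|x0] := ltP x 0.
  rewrite (@derive1_near_cst _ _ 0) ?normr0//.
  near=> y; apply: smooth_step_le0; apply: ltW; near: y; exact: lt_nbhsl.
have [x1|x1] := ltP 1 x.
  rewrite (@derive1_near_cst _ _ 1) ?normr0//.
  near=> y; apply: smooth_step_ge1; apply: ltW; near: y; exact: lt_nbhsr.
by apply: cmax; rewrite in_itv/= x0.
Unshelve. all: by end_near. Qed.

(** [smooth_step ((x - a) / e)] in affine form. For [e > 0] its derivative lives on [[a, a + e]],
    has integral 1 and is of size [1/e]: an approximate point mass to the right of [a]. *)
Definition ramp a e x : R := smooth_step (e^-1 * x + - (e^-1 * a)).

Lemma smooth_ramp a e : smooth (ramp a e).
Proof. exact: smooth_affine smooth_smooth_step. Qed.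

Lemma ramp_le a e x : 0 < e -> x <= a -> ramp a e x = 0.
Proof.
move=> e0 xa; apply: smooth_step_le0.
by rewrite -mulrBr pmulr_rle0 ?invr_gt0// subr_le0.
Qed.

Lemma ramp_ge a e x : 0 < e -> a + e <= x -> ramp a e x = 1.
Proof.
move=> e0 xa; apply: smooth_step_ge1.
by rewrite -mulrBr mulrC ler_pdivlMr// mul1r lerBrDl.
Qed.

Lemma ramp_ge0 a e x : 0 <= ramp a e x. Proof. exact: smooth_step_ge0. Qed.

Lemma ramp_le1 a e x : ramp a e x <= 1. Proof. exact: smooth_step_le1. Qed.

Lemma derive_rampE a e x :
  derive1 (ramp a e) x =
  e^-1 * derive1 smooth_step (e^-1 * x + - (e^-1 * a)).
Proof.
have [ds _] := smooth_is_derive (e^-1 * x + - (e^-1 * a)) smooth_smooth_step.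
rewrite /ramp; have -> : (fun x => smooth_step (e^-1 * x + - (e^-1 * a))) =
    smooth_step \o ((fun x => e^-1 * x + - (e^-1 * a))) by [].
have h1 : is_derive (x : R) (1 : R) (cst e^-1 \* id) (e^-1 *: 1 + x *: 0).
  exact: is_deriveM.
have [dl dlE] : is_derive (x : R) (1 : R) (fun x => e^-1 * x + - (e^-1 * a)) e^-1.
  have h2 := is_deriveD h1 (is_derive_cst (- (e^-1 * a)) x 1).
  by apply: (is_derive_eq h2); rewrite /GRing.scale/=; ring.
by rewrite (derive1_comp dl ds) mulrC; congr (_ * _); rewrite derive1E.
Qed.

Lemma derive_ramp_bounded :
  exists2 C : R, 0 <= C & forall a e x, 0 < e ->
    `|derive1 (ramp a e) x| <= C / e.
Proof.
have [C C0 hC] := derive_smooth_step_bounded; exists C => // a e x e0.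
rewrite derive_rampE normrM gtr0_norm ?invr_gt0// mulrC.
by rewrite ler_wpM2r// invr_ge0 ltW.
Qed.

Lemma derive_ramp_out a e x : 0 < e -> x \notin `[a, a + e] ->
  derive1 (ramp a e) x = 0.
Proof.
move=> e0; rewrite in_itv/= negb_and -!ltNge => /orP[xa|xa].
  apply: (@derive1_near_cst _ _ 0).
  near=> y; apply: ramp_le => //; apply: ltW; near: y; exact: lt_nbhsl.
apply: (@derive1_near_cst _ _ 1).
near=> y; apply: ramp_ge => //; apply: ltW; near: y; exact: lt_nbhsr.
Unshelve. all: by end_near. Qed.

(** Both flanks have width [e] and lie to the right of their base points, so the derivative is the
    difference of approximate point masses at [a] and [b]. *)
Definition plateau a b e x : R := ramp a e x - ramp b e x.

Lemma smooth_plateau a b e : smooth (plateau a b e).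
Proof.
have -> : plateau a b e = ramp a e \+ (cst (- 1) \* ramp b e).
  by apply/funext => x; rewrite /plateau/= mulN1r.
apply: smoothD; first exact: smooth_ramp.
by apply: smoothM; [exact: smooth_cst|exact: smooth_ramp].
Qed.

Lemma plateau_out a b e x : 0 < e -> a <= b -> x \notin `[a, b + e] ->
  plateau a b e x = 0.
Proof.
move=> e0 ab; rewrite in_itv/= negb_and -!ltNge /plateau => /orP[xa|xb].
  by rewrite !ramp_le ?subrr//; lra.
by rewrite !ramp_ge ?subrr//; lra.
Qed.

Lemma plateau_eq1 a b e x : 0 < e -> a + e <= x -> x <= b ->
  plateau a b e x = 1.
Proof. by move=> e0 ax xb; rewrite /plateau ramp_ge// ramp_le// subr0. Qed.

Lemma plateau_norm_le1 a b e x : `|plateau a b e x| <= 1.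
Proof.
have := ramp_ge0 a e x; have := ramp_le1 a e x.
have := ramp_ge0 b e x; have := ramp_le1 b e x.
by rewrite ler_norml /plateau; lra.
Qed.

Lemma derive_plateau a b e x :
  derive1 (plateau a b e) x = derive1 (ramp a e) x - derive1 (ramp b e) x.
Proof.
have da := smooth_is_derive x (@smooth_ramp a e).
have db := smooth_is_derive x (@smooth_ramp b e).
by rewrite derive1E; exact: (@derive_val _ _ _ _ _ _ _ (is_deriveB da db)).
Qed.

Lemma test_fun_smooth i phi : test_fun i phi -> smooth phi.
Proof. by case. Qed.

Lemma smooth_test_fun i phi a b : smooth phi ->
  (forall x, x \notin `[a, b] -> phi x = 0) ->
  (forall x, x \in `[a, b] -> x \in i) -> test_fun i phi.
Proof.
move=> sphi phi0 abi.
have cl : closure [set x | phi x != 0] `<=` [set` `[a, b]].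
  rewrite closureE => x; apply; split; first exact: itv_closed.
  move=> {}x /= px; apply/negPn/negP => xab.
  by move: px; rewrite phi0 ?eqxx.
split=> //.
  apply: subclosed_compact cl => //; first exact: closed_closure.
  exact: segment_compact.
by move=> x /cl/= /abi.
Qed.

(** The closed support lies in [i], so a point outside [i] has a neighbourhood on which [phi]
    vanishes. This allows a function to be altered off [i] when it is paired with [phi] or
    [phi']. *)
Lemma test_fun_out i phi x : test_fun i phi -> x \notin i ->
  phi x = 0 /\ derive1 phi x = 0.
Proof.
move=> [_ _ sub] xi.
have nx : \near x, phi x = 0.
  have ncl : ~ closure [set x | phi x != 0] x.
    by move=> /sub/=; rewrite (negbTE xi).
  apply: contrapT => nn; apply: ncl => B nB; apply: contrapT => /set0P/negP/negPn/eqP h.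
  apply: nn; apply: filterS nB => y By; apply/eqP; apply/negPn/negP => py.
  by have : set0 y by rewrite -h; split.
split; first exact: nbhs_singleton nx.
exact: derive1_near_cst nx.
Qed.

Lemma test_fun_bounded i phi : test_fun i phi ->
  exists2 M : R, 0 < M & forall x, x \notin `](- M), M[ ->
    phi x = 0 /\ derive1 phi x = 0.
Proof.
move=> tphi; have [_ cphi _] := tphi.
have [M0 [M0r bM]] := compact_bounded cphi.
pose M := Num.max (M0 + 1) 1.
have M1 : 1 <= M by rewrite le_max lexx orbT.
have MM0 : M0 < M by rewrite lt_max; apply/orP; left; lra.
have {}bM : forall y, closure [set x | phi x != 0] y -> `|y| < M + 1.
  by move=> y /(bM _ MM0) h; apply: le_lt_trans h _; rewrite ltrDl.
exists (M + 1) => [|x xM]; first lra.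
have tphi' : test_fun `](- (M + 1)), M + 1[ phi.
  case: tphi => s c _; split=> // y cy /=.
  by rewrite in_itv/= -ltr_norml; exact: bM.
exact: test_fun_out tphi' xM.
Qed.

End TestFunctions.

(** * Square integrable functions and their primitives *)

Section SquareIntegrable.
Context {R : realType}.
Local Notation mu := (@lebesgue_measure R).
Implicit Types (f g F : R -> R) (x y s t : R) (D : set (measurableTypeR R)).

Lemma measurable_itvR (i : interval R) :
  measurable ([set` i] : set (measurableTypeR R)).
Proof. exact: measurable_itv. Qed.

Lemma integrable_le D f g : measurable D -> measurable_fun D f ->
  mu.-integrable D (EFin \o g) -> (forall x, D x -> `|f x| <= g x) ->
  mu.-integrable D (EFin \o f).
Proof.
move=> mD mf ig fg; apply: (le_integrable mD _ _ ig) => [|x Dx] /=.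
  exact/measurable_EFinP.
rewrite lee_fin; apply: le_trans (fg x Dx) _; exact: ler_norm.
Qed.

(** Over the whole line: elements of [L2 i] enter through their extension by zero, so that one
    measure serves all intervals. *)
Definition sq_integrable f :=
  measurable_fun setT f /\ mu.-integrable setT (EFin \o (fun x => f x ^+ 2)).

Lemma sq_integrableM f g : sq_integrable f -> sq_integrable g ->
  mu.-integrable setT (EFin \o (f \* g)).
Proof.
move=> [mf sf] [mg sg].
apply: (@integrable_le _ _ (fun x => f x ^+ 2 + g x ^+ 2)) => //.
- exact: measurable_funM.
- by have := integrableD measurableT sf sg; apply: eq_integrable.
- move=> x _ /=; rewrite ler_norml.
  have := sqr_ge0 (f x - g x); have := sqr_ge0 (f x + g x); rewrite !expr2.
  by move=> h1 h2; have := sqr_ge0 (f x); have := sqr_ge0 (g x); nra.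
Qed.

Lemma sq_integrableZ (c : R) f :
  sq_integrable f -> sq_integrable (fun x => c * f x).
Proof.
move=> [mf sf]; split; first exact: measurable_funM.
have := integrableZl measurableT (c ^+ 2) sf; apply: eq_integrable => // x _ /=.
by rewrite exprMn.
Qed.

Lemma sq_integrableD f g :
  sq_integrable f -> sq_integrable g -> sq_integrable (fun x => f x + g x).
Proof.
move=> ff gg; have [mf sf] := ff; have [mg sg] := gg.
split; first exact: measurable_funD.
have fg := integrableZl measurableT 2 (sq_integrableM ff gg).
have := integrableD measurableT (integrableD measurableT sf sg) fg.
apply: eq_integrable => // x _ /=.
by rewrite -!EFinD; congr EFin; ring.
Qed.

Lemma sq_integrable_cst_itv (a b c : R) :
  mu.-integrable `[a, b] (EFin \o (fun=> c)).
Proof.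
apply: measurable_bounded_integrable => //; last first.
  by exists `|c|; split => // M cM x _ /=; exact: ltW.
rewrite [X in (X < _)%E](lebesgue_measure_itv `[a, b])/=.
by case: ifP => // _; rewrite -EFinD ltry.
Qed.

Lemma sq_integrable_sq_itv f x y : sq_integrable f ->
  mu.-integrable `[x, y] (EFin \o (fun t => f t ^+ 2)).
Proof. by move=> [_]; apply: integrableS. Qed.

Lemma sq_integrable_itv f x y : sq_integrable f ->
  mu.-integrable `[x, y] (EFin \o f).
Proof.
move=> sf; have := integrableD (measurable_itvR _)
  (sq_integrable_cst_itv x y 1) (sq_integrable_sq_itv x y sf).
move=> ig; apply: (@integrable_le _ _ (fun t => 1 + f t ^+ 2)) => //.
  by apply: measurable_funTS; case: sf.
move=> t _ /=; rewrite ler_norml.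
by have := sqr_ge0 (f t - 1); have := sqr_ge0 (f t + 1); rewrite !expr2; nra.
Qed.

Lemma sq_integrable_norm_itv f x y : sq_integrable f ->
  mu.-integrable `[x, y] (EFin \o (fun t => `|f t|)).
Proof. by move=> sf; apply: integrable_norm; exact: sq_integrable_itv. Qed.

Lemma sq_integrable_bounded f (C a b : R) : measurable_fun setT f ->
  (forall x, `|f x| <= C) -> (forall x, x \notin `[a, b] -> f x = 0) ->
  sq_integrable f.
Proof.
move=> mf fC f0; split=> //.
have -> : EFin \o (fun x => f x ^+ 2) = (EFin \o (fun x => f x ^+ 2)) \_ `[a, b].
  apply/funext => x; rewrite patchE; case: ifPn => // xab /=.
  by rewrite f0 ?expr0n//; apply/negP => xab'; move/negP: xab; apply; rewrite inE.
apply/(integrable_mkcond _ _).1 => //.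
apply: (@integrable_le _ _ (fun=> C ^+ 2)) => //.
- by apply: measurable_funTS; exact: measurable_funX.
- exact: sq_integrable_cst_itv.
- move=> x _; rewrite normrX; have := fC x; have := normr_ge0 (f x).
  by rewrite !expr2; nra.
Qed.

Lemma Rintegral_itv_cat f x y t : x <= y -> y <= t ->
  mu.-integrable `[x, t] (EFin \o f) ->
  \int[mu]_(r in `[x, t]) f r =
  \int[mu]_(r in `[x, y]) f r + \int[mu]_(r in `[y, t]) f r.
Proof.
move=> xy yt itf.
have := @Rintegral_itvB _ f (BLeft x) (BRight t) y itf.
rewrite !bnd_simp => /(_ xy yt).
rewrite Rintegral_itv_obnd_cbnd => [<-|]; first by rewrite addrC subrK.
apply: integrableS itf => // r /=; rewrite !in_itv/= => /andP[yr ->].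
by rewrite (le_trans xy (ltW yr)).
Qed.

Lemma Rintegral_itv_degenerate f x y : y <= x ->
  \int[mu]_(r in `[x, y]) f r = 0.
Proof.
rewrite le_eqVlt => /predU1P[->|yx]; first by rewrite set_itv1 Rintegral_set1.
by rewrite set_itv_ge ?Rintegral_set0// bnd_simp -ltNge.
Qed.

(** Absolute continuity with derivative [f], expressed through increments only; the additive
    constant stays free. *)
Definition primitive_of f F :=
  forall x y, x <= y -> F y - F x = \int[mu]_(t in `[x, y]) f t.

(** The signed integral from 0 to [x]: one of the two intervals is always degenerate. *)
Definition primitive f x :=
  \int[mu]_(t in `[0, x]) f t - \int[mu]_(t in `[x, 0]) f t.

Lemma primitive_ofP f : sq_integrable f -> primitive_of f (primitive f).
Proof.
move=> sf x y xy; rewrite /primitive.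
have itf a b := @sq_integrable_itv f a b sf.
have [x0|x0] := leP x 0; have [y0|y0] := leP y 0.
- rewrite !(@Rintegral_itv_degenerate f 0)//.
  by rewrite (@Rintegral_itv_cat f x y 0)//; ring.
- rewrite (@Rintegral_itv_degenerate f 0 x)//.
  rewrite (@Rintegral_itv_degenerate f y 0 (ltW y0))//.
  by rewrite (@Rintegral_itv_cat f x 0 y)// ?ltW//; ring.
- by have := lt_le_trans x0 xy; rewrite ltNge y0.
- rewrite (@Rintegral_itv_degenerate f x 0 (ltW x0))//.
  rewrite (@Rintegral_itv_degenerate f y 0 (ltW y0))//.
  by rewrite (@Rintegral_itv_cat f 0 x y)// ?ltW//; ring.
Qed.

Lemma Rintegral_norm_sq_le f x y : x <= y -> sq_integrable f ->
  (\int[mu]_(t in `[x, y]) `|f t|) ^+ 2 <=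
  (y - x) * \int[mu]_(t in `[x, y]) (f t ^+ 2).
Proof.
rewrite le_eqVlt => /predU1P[->|xy] sf.
  by rewrite !Rintegral_itv_degenerate// expr0n subrr mul0r.
set A := \int[mu]_(t in _) `|_|; set B := \int[mu]_(t in _) _.
have i1 := sq_integrable_norm_itv x y sf.
have i2 := sq_integrable_sq_itv x y sf.
have ic c := sq_integrable_cst_itv x y c.
(* The mean of [|f|], at which expanding the integral of [(|f| - l)^2 >= 0] gives the sharpest
   bound. *)
pose l := A / (y - x).
have h : 0 <= \int[mu]_(t in `[x, y]) (f t ^+ 2 + (- (2 * l) * `|f t| + l ^+ 2)).
  apply: Rintegral_ge0 => t _.
  have -> : f t ^+ 2 + (- (2 * l) * `|f t| + l ^+ 2) = (`|f t| - l) ^+ 2.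
    by rewrite -(real_normK (num_real (f t))); ring.
  exact: sqr_ge0.
have i3 : mu.-integrable `[x, y] (EFin \o (fun t => - (2 * l) * `|f t|)).
  by have := integrableZl (measurable_itvR _) (- (2 * l)) i1; exact: eq_integrable.
have i4 : mu.-integrable `[x, y]
    (EFin \o (fun t => - (2 * l) * `|f t| + l ^+ 2)).
  by have := integrableD (measurable_itvR _) i3 (ic (l ^+ 2)); exact: eq_integrable.
move: h; rewrite RintegralD// RintegralD// RintegralZl// Rintegral_cst//.
rewrite -/A -/B [X in fine X](lebesgue_measure_itv `[x, y])/= lte_fin xy -EFinD/=.
have yx : 0 < y - x by rewrite subr_gt0.
have -> : B + (- (2 * l) * A + l ^+ 2 * (y - x)) = B - A ^+ 2 / (y - x).
  by rewrite /l; field; rewrite gt_eqF.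
by rewrite subr_ge0 ler_pdivrMr// mulrC.
Qed.

Lemma primitive_of_norm_le f F x y : primitive_of f F -> sq_integrable f ->
  x <= y -> `|F y - F x| <= \int[mu]_(t in `[x, y]) `|f t|.
Proof.
move=> fF sf xy; rewrite fF//.
by apply: le_normr_Rintegral => //; exact: sq_integrable_itv.
Qed.

Lemma Rintegral_itv_le f x y s t : (forall r, 0 <= f r) ->
  (forall a b, mu.-integrable `[a, b] (EFin \o f)) ->
  x <= s -> s <= t -> t <= y ->
  \int[mu]_(r in `[s, t]) f r <= \int[mu]_(r in `[x, y]) f r.
Proof.
move=> f0 itf xs st ty.
rewrite (@Rintegral_itv_cat f x s y)//; last exact: le_trans ty.
rewrite (@Rintegral_itv_cat f s t y)//.
have := @Rintegral_ge0 _ _ _ mu `[x, s] f (fun r _ => f0 r).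
have := @Rintegral_ge0 _ _ _ mu `[t, y] f (fun r _ => f0 r).
by move=> h1 h2; rewrite addrCA lerDl addr_ge0.
Qed.

Lemma primitive_of_hoelder f F x y : primitive_of f F -> sq_integrable f ->
  x <= y -> (F y - F x) ^+ 2 <= (y - x) * \int[mu]_t (f t ^+ 2).
Proof.
move=> fF sf xy; have h := primitive_of_norm_le fF sf xy.
rewrite -(real_normK (num_real _)).
have h2 : `|F y - F x| ^+ 2 <= (\int[mu]_(t in `[x, y]) `|f t|) ^+ 2.
  by rewrite lerXn2r ?nnegrE//; exact: le_trans h.
apply: le_trans h2 _; apply: le_trans (Rintegral_norm_sq_le xy sf) _.
rewrite ler_wpM2l ?subr_ge0// Rintegral_mkcond.
case: sf => mf sf; apply: le_Rintegral => //.
  have -> : EFin \o (fun t => f t ^+ 2) \_ `[x, y] =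
     (EFin \o (fun t => f t ^+ 2)) \_ `[x, y] by rewrite restrict_EFin.
  by apply/(integrable_mkcond _ _).1 => //; exact: integrableS sf.
by move=> t _; rewrite patchE; case: ifP => // _; exact: sqr_ge0.
Qed.

Lemma primitive_of_continuous f F : primitive_of f F -> sq_integrable f ->
  continuous F.
Proof.
move=> fF sf x; apply/cvgrPdist_le => e e0.
set S := \int[mu]_t (f t ^+ 2).
have S0 : 0 <= S by apply: Rintegral_ge0 => t _; exact: sqr_ge0.
have S1 : 0 < S + 1 by rewrite ltr_wpDl.
near=> y.
have h : (F x - F y) ^+ 2 <= `|x - y| * S.
  have [xy|yx] := leP x y.
    rewrite distrC ger0_norm ?subr_ge0// -sqrrN opprB.
    exact: primitive_of_hoelder.
  rewrite ger0_norm ?subr_ge0 ?(ltW yx)//.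
  by apply: primitive_of_hoelder => //; exact: ltW.
rewrite -(@ler_pXn2r _ 2) ?nnegrE//; last exact: ltW.
rewrite real_normK ?num_real//; apply: le_trans h _.
have d : `|x - y| <= e ^+ 2 / (S + 1).
  near: y; apply: cvgr_dist_le; first exact: cvg_id.
  by rewrite divr_gt0// exprn_gt0.
rewrite ler_pdivlMr// in d; apply: le_trans d.
by rewrite ler_wpM2l// lerDl.
Unshelve. all: by end_near. Qed.

(** Bisection halves the length factor on each part while the values of [S] add up to [S s t]. After
    [n] rounds [|H s t|] is at most [2^-n (t - s) S s t], for every [n]. *)
Lemma additive_eq0 (H S : R -> R -> R) x y : x <= y ->
  (forall r s t, r <= s -> s <= t -> H r t = H r s + H s t) ->
  (forall r s t, r <= s -> s <= t -> S r t = S r s + S s t) ->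
  (forall s t, s <= t -> `|H s t| <= (t - s) * S s t) -> H x y = 0.
Proof.
move=> xy Hadd Sadd HS.
have bis n s t : s <= t -> `|H s t| <= (t - s) / 2 ^+ n * S s t.
  elim: n s t => [|n IH] s t st; first by rewrite expr0 divr1; exact: HS.
  have sm : s <= (s + t) / 2 by lra.
  have mt : (s + t) / 2 <= t by lra.
  rewrite (Hadd _ _ _ sm mt) (Sadd _ _ _ sm mt) mulrDr.
  apply: le_trans (ler_normD _ _) _; apply: lerD.
    apply: le_trans (IH _ _ sm) _; rewrite le_eqVlt; apply/orP; left; apply/eqP.
    congr (_ * _); rewrite exprS invfM mulrA; congr (_ / _); lra.
  apply: le_trans (IH _ _ mt) _; rewrite le_eqVlt; apply/orP; left; apply/eqP.
  congr (_ * _); rewrite exprS invfM mulrA; congr (_ / _); lra.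
apply/eqP; rewrite -normr_eq0; apply/negPn/negP => H0.
have {}H0 : 0 < `|H x y| by rewrite lt_neqAle eq_sym H0 normr_ge0.
pose c := (y - x) * S x y / `|H x y|.
have hn n : 2 ^+ n <= c.
  have := bis n x y xy; rewrite mulrAC ler_pdivlMr ?exprn_gt0//.
  by rewrite mulrC -ler_pdivlMr.
have c0 : 0 <= c by apply: le_trans (hn 0%N); rewrite exprn_ge0.
have := archi_boundP c0; rewrite ltNge => /negP; apply.
apply: le_trans (hn (Num.bound c)); rewrite -natrX ler_nat; exact/ltnW/ltn_expl.
Qed.

(* On a short interval the error is at most [(\int |f|)^2], which is
   dominated by the length times [\int f^2]; such errors add up to zero. *)
Lemma primitive_of_sqr f F x y : primitive_of f F -> sq_integrable f ->
  x <= y -> F y ^+ 2 - F x ^+ 2 = 2 * \int[mu]_(t in `[x, y]) (F t * f t).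
Proof.
move=> fF sf xy.
have i1 a b := sq_integrable_norm_itv a b sf.
have if0 a b := sq_integrable_itv a b sf.
have i2 a b := sq_integrable_sq_itv a b sf.
have mF : measurable_fun setT F.
  by apply: continuous_measurable_fun; exact: primitive_of_continuous fF sf.
have FA s t r : s <= r -> r <= t ->
    `|F t + F s - 2 * F r| <= \int[mu]_(t in `[s, t]) `|f t|.
  move=> sr rt; rewrite (Rintegral_itv_cat sr rt (i1 s t)) [leRHS]addrC.
  have -> : F t + F s - 2 * F r = (F t - F r) - (F r - F s) by ring.
  apply: le_trans (ler_normB _ _) _.
  by apply: lerD; exact: primitive_of_norm_le.
have iFf a b : mu.-integrable `[a, b] (EFin \o (fun t => F t * f t)).
  have [ab|ba] := leP a b; last first.
    by rewrite set_itv_ge ?bnd_simp -?ltNge//; exact: integrable_set0.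
  pose C := `|F a| + \int[mu]_(t in `[a, b]) `|f t|.
  have := integrableZl (measurable_itvR _) C (i1 a b).
  move=> ig; apply: (@integrable_le _ _ (fun t => C * `|f t|)) => //.
    by apply: measurable_funTS; apply: measurable_funM => //; case: sf.
  move=> t /=; rewrite in_itv/= => /andP[at_ tb].
  rewrite normrM ler_wpM2r//.
  have -> : F t = F a + (F t - F a) by ring.
  apply: le_trans (ler_normD _ _) _; rewrite lerD2l.
  apply: le_trans (primitive_of_norm_le fF sf at_) _.
  by apply: Rintegral_itv_le.
pose H s t := F t ^+ 2 - F s ^+ 2 - 2 * \int[mu]_(t in `[s, t]) (F t * f t).
pose S s t := \int[mu]_(t in `[s, t]) (f t ^+ 2).
apply/eqP; rewrite -subr_eq0; apply/eqP; rewrite -/(H x y).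
apply: (@additive_eq0 H S) => // [r s t rs st|r s t rs st|s t st].
- by rewrite /H (Rintegral_itv_cat rs st (iFf r t)); ring.
- exact: Rintegral_itv_cat.
apply: le_trans (Rintegral_norm_sq_le st sf).
set A := \int[mu]_(t in _) `|_|.
(* [F t ^ 2 - F s ^ 2] is [F t + F s] times the integral of [f], so the error becomes a single
   integral, whose factor in front of [f] is controlled by [FA]. *)
have -> : H s t = \int[mu]_(r in `[s, t]) ((F t + F s - 2 * F r) * f r).
  have -> : (fun r => (F t + F s - 2 * F r) * f r) =
      (fun r => (F t + F s) * f r + (- 2) * (F r * f r)).
    by apply/funext => r; ring.
  rewrite RintegralD//; last 2 first.
  - by have := integrableZl (measurable_itvR _) (F t + F s) (if0 s t);
      exact: eq_integrable.
  - by have := integrableZl (measurable_itvR _) (- 2) (iFf s t);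
      exact: eq_integrable.
  rewrite RintegralZl// RintegralZl// -(fF s t st) /H.
  by move: (\int[mu]_(_ in _) _) => I; ring.
have iG : mu.-integrable `[s, t] (EFin \o (fun r => (F t + F s - 2 * F r) * f r)).
  have h1 := integrableZl (measurable_itvR _) (F t + F s) (if0 s t).
  have h2 := integrableZl (measurable_itvR _) (- 2) (iFf s t).
  have := integrableD (measurable_itvR _) h1 h2.
  by apply: eq_integrable => // r _ /=; rewrite -!EFinM -EFinD; congr EFin; ring.
apply: le_trans (le_normr_Rintegral _ iG) _ => //.
rewrite expr2 -RintegralZl//; apply: le_Rintegral => //.
- exact: integrable_norm.
- by have := integrableZl (measurable_itvR _) A (i1 s t); exact: eq_integrable.
- move=> r /=; rewrite in_itv/= => /andP[sr rt]; rewrite normrM ler_wpM2r//.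
  exact: FA.
Qed.

End SquareIntegrable.

(** * Weak derivatives and primitives *)

Section WeakPrimitive.
Context {R : realType}.
Local Notation mu := (@lebesgue_measure R).
Implicit Types (f g h phi : R -> R) (x a b e : R).

Lemma smooth_FTC phi a b : smooth phi -> a <= b ->
  \int[mu]_(x in `[a, b]) derive1 phi x = phi b - phi a.
Proof.
move=> sphi; rewrite le_eqVlt => /predU1P[->|ab].
  by rewrite Rintegral_itv_degenerate// subrr.
have cphi := smooth_continuous sphi.
rewrite /Rintegral (@continuous_FTC2 _ (derive1 phi) phi)//.
- by apply: continuous_subspaceT; apply: smooth_continuous; exact: smooth_derive.
- split=> [x _||]; first exact: (sphi 0).
  + by apply: cvg_at_right_filter; exact: cphi.
  + by apply: cvg_at_left_filter; exact: cphi.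
Qed.

Lemma Rintegral_supp f a b : (forall x, x \notin `[a, b] -> f x = 0) ->
  \int[mu]_x f x = \int[mu]_(x in `[a, b]) f x.
Proof.
move=> f0; rewrite [RHS]Rintegral_mkcond; apply: eq_Rintegral => x _.
rewrite patchE; case: ifPn => // xab; apply: f0; apply/negP => xab'.
by move/negP: xab; apply; rewrite inE.
Qed.

Lemma integrable_mul_bounded f h (C a b : R) : sq_integrable f ->
  measurable_fun setT h -> (forall x, `|h x| <= C) ->
  mu.-integrable `[a, b] (EFin \o (fun x => f x * h x)).
Proof.
move=> sf mh hC; have iC := integrableZl (measurable_itvR _) C
  (sq_integrable_norm_itv a b sf).
apply: (@integrable_le _ _ _ (fun t => C * `|f t|)) => //.
  by apply: measurable_funTS; apply: measurable_funM => //; case: sf.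
by move=> x _; rewrite normrM mulrC ler_wpM2r.
Qed.

Lemma sq_integrable_locally_integrable f : sq_integrable f ->
  locally_integrable setT f.
Proof.
move=> sf; split; [by case: sf|exact: openT|move=> K _ cK].
have [M0 [M0r bM]] := compact_bounded cK.
pose M := M0 + 1.
have KM : K `<=` `[- M, M].
  by move=> x /(bM M (ltr_pwDr ltr01 (lexx _)))/=; rewrite in_itv/= ler_norml.
have /integrableP[_] := sq_integrable_itv (- M) M sf.
apply: le_lt_trans; apply: ge0_subset_integral => //=.
- exact: compact_measurable.
- apply/measurable_EFinP; apply: measurableT_comp => //.
  by apply: measurable_funTS; case: sf.
Qed.

(** The derivative of the ramp has integral 1 and is at most [C / e], so the error is at most
    [C / e] times the integral of [|f - f a|] over [[a, a + e]], a multiple of the mean deviation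
    that vanishes at a Lebesgue point. *)
Lemma lebesgue_pt_ramp f a : sq_integrable f -> lebesgue_pt f a ->
  (\int[mu]_x (f x * derive1 (ramp a e) x)) @[e --> 0^'+] --> f a.
Proof.
move=> sf lf; have [C C0 hC] := @derive_ramp_bounded R.
apply/cvgrPdist_le => d d0.
(* The 2 is the ratio of the length [2 e] of the ball in [davg] to [e]; the 1 keeps the denominator
   positive when [C = 0]. *)
have eta0 : 0 < d / (2 * (C + 1)) by rewrite divr_gt0// mulr_gt0// ltr_wpDl.
have davgd : \forall e \near 0^'+, (davg f a e < (d / (2 * (C + 1)))%:E)%E.
  have := lf; move/(_ [set y | (y < (d / (2 * (C + 1)))%:E)%E]); apply.
  by apply: open_nbhs_nbhs; split; [exact: open_ereal_lt_ereal|rewrite /= lte_fin].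
near=> e.
have e0 : 0 < e by near: e; exact: nbhs_right_gt.
have sr := @smooth_ramp R a e.
have mr : measurable_fun setT (derive1 (ramp a e)).
  by apply: smooth_measurable; exact: smooth_derive.
have rC x : `|derive1 (ramp a e) x| <= C / e by exact: hC.
have ir : mu.-integrable `[a, a + e] (EFin \o (derive1 (ramp a e))).
  apply: (@integrable_le _ _ _ (fun=> C / e)) => //; last exact: sq_integrable_cst_itv.
  exact: measurable_funTS.
have ifr := integrable_mul_bounded a (a + e) sf mr rC.
have ifar : mu.-integrable `[a, a + e] (EFin \o (fun x => f a * derive1 (ramp a e) x)).
  by have := integrableZl (measurable_itvR _) (f a) ir; exact: eq_integrable.
rewrite (@Rintegral_supp _ a (a + e)); last first.
  by move=> x xae; rewrite derive_ramp_out ?mulr0.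
have -> : f a = \int[mu]_(x in `[a, a + e]) (f a * derive1 (ramp a e) x).
  rewrite RintegralZl// smooth_FTC ?lerDl ?ltW//.
  by rewrite ramp_ge// ramp_le// subr0 mulr1.
rewrite -RintegralB//.
have idiff : mu.-integrable `[a, a + e]
    (EFin \o (fun x => f a * derive1 (ramp a e) x - f x * derive1 (ramp a e) x)).
  by have := integrableB (measurable_itvR _) ifar ifr; exact: eq_integrable.
apply: le_trans (le_normr_Rintegral _ idiff) _ => //.
have if1 : mu.-integrable `[a, a + e] (EFin \o (fun x => `|f x - f a|)).
  have := integrableB (measurable_itvR _) (sq_integrable_itv a (a + e) sf)
    (sq_integrable_cst_itv a (a + e) (f a)).
  by move=> /integrable_abse; exact: eq_integrable.
have if2 : mu.-integrable `[a, a + e] (EFin \o (fun x => C / e * `|f x - f a|)).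
  by have := integrableZl (measurable_itvR _) (C / e) if1; exact: eq_integrable.
have h1 : \int[mu]_(x in `[a, a + e])
    `|f a * derive1 (ramp a e) x - f x * derive1 (ramp a e) x| <=
    C / e * \int[mu]_(x in `[a, a + e]) `|f x - f a|.
  rewrite -RintegralZl//; apply: le_Rintegral => //; first exact: integrable_norm.
  by move=> x _; rewrite -mulrBl normrM mulrC distrC ler_wpM2r.
apply: le_trans h1 _.
have if1' : mu.-integrable `[a, a + e[ (EFin \o (fun x => `|f x - f a|)).
  by apply: integrableS if1 => //; exact: subset_itv_co_cc.
rewrite -Rintegral_itv_bndo_bndc//.
have hd : (davg f a e < (d / (2 * (C + 1)))%:E)%E by near: e.
have h2 : \int[mu]_(x in `[a, a + e[) `|f x - f a| <= d / (2 * (C + 1)) * (e *+ 2).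
  rewrite -lee_fin /Rintegral fineK; last exact: (integrable_fin_num _ if1').
  apply: (@le_trans _ _ (\int[mu]_(x in ball a e) `|(f x - f a)%:E|)%E).
    apply: ge0_subset_integral => //=.
    - exact: measurable_ball.
    - apply/measurable_EFinP; apply: measurableT_comp => //.
      apply: measurable_funTS; apply: measurable_funB => //; by case: sf.
    - move=> x /=; rewrite in_itv/= => /andP[ax xae].
      by rewrite -ball_normE/= ler0_norm ?subr_le0// opprB ltrBlDl.
  move: hd; rewrite /davg /iavg (lebesgue_measure_ball _ (ltW e0)).
  rewrite inver mulrn_eq0/= gt_eqF//=.
  rewrite -(@lte_pmul2l _ (e *+ 2)%:E) ?lte_fin ?mulrn_wgt0//.
  by rewrite muleA -EFinM divff ?mulrn_eq0 ?gt_eqF// mul1e => /ltW; rewrite -EFinM mulrC.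
apply: le_trans (ler_wpM2l _ h2) _; first by rewrite divr_ge0// ltW.
have -> : C / e * (d / (2 * (C + 1)) * (e *+ 2)) = d * (C / (C + 1)).
  by rewrite -mulr_natr; field; rewrite !gt_eqF// ltr_wpDl.
by rewrite ler_piMr ?(ltW d0)// ler_pdivrMr ?mul1r ?lerDl// ltr_wpDl.
Unshelve. all: by end_near. Qed.

Lemma Rintegral_norm_small f a : sq_integrable f ->
  (\int[mu]_(x in `[a, a + e]) `|f x|) @[e --> 0^'+] --> (0 : R).
Proof.
move=> sf; apply/cvgrPdist_le => d d0.
set S := \int[mu]_(x in `[a, a + 1]) (f x ^+ 2).
have S0 : 0 <= S by apply: Rintegral_ge0 => t _; exact: sqr_ge0.
have S1 : 0 < S + 1 by rewrite ltr_wpDl.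
near=> e.
have e0 : 0 < e by near: e; exact: nbhs_right_gt.
have e1 : e <= 1 by near: e; exact: nbhs_right_le.
have ed : e <= d ^+ 2 / (S + 1).
  by near: e; apply: nbhs_right_le; rewrite divr_gt0// exprn_gt0.
rewrite sub0r normrN ger0_norm; last by apply: Rintegral_ge0.
rewrite -(@ler_pXn2r _ 2) ?nnegrE//; last 2 first.
- exact: Rintegral_ge0.
- exact: ltW.
apply: le_trans (Rintegral_norm_sq_le _ sf) _; first by rewrite lerDl ltW.
rewrite addrAC subrr add0r; rewrite ler_pdivlMr// in ed; apply: le_trans ed.
apply: ler_wpM2l; first exact: ltW.
apply: (@le_trans _ _ S); last by rewrite lerDl.
apply: Rintegral_itv_le => //; rewrite ?lerDl ?lerD2l ?(ltW e0)//.
- by move=> r; exact: sqr_ge0.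
- by move=> *; exact: sq_integrable_sq_itv.
Unshelve. all: by end_near. Qed.

(** The plateau is 1 on [[a + e, b]]; the error comes from the two flanks, over which the integral
    of [|g|] becomes small. *)
Lemma Rintegral_plateau g a b : sq_integrable g -> a < b ->
  (\int[mu]_x (g x * plateau a b e x)) @[e --> 0^'+] -->
  \int[mu]_(x in `[a, b]) g x.
Proof.
move=> sg ab; apply/cvgrPdist_le => d d0.
have d2 : 0 < d / 2 by rewrite divr_gt0.
near=> e.
have e0 : 0 < e by near: e; exact: nbhs_right_gt.
have aeb : a + e <= b.
  by rewrite -lerBrDl; near: e; apply: nbhs_right_le; rewrite subr_gt0.
have aae : a <= a + e by rewrite lerDl ltW.
have bbe : b <= b + e by rewrite lerDl ltW.
have mp : measurable_fun setT (plateau a b e).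
  by apply: smooth_measurable; exact: smooth_plateau.
have gp x y := integrable_mul_bounded x y sg mp (plateau_norm_le1 a b e).
have ig x y := sq_integrable_itv x y sg.
have ign x y := sq_integrable_norm_itv x y sg.
rewrite (@Rintegral_supp _ a (b + e)); last first.
  by move=> x xab; rewrite plateau_out ?mulr0// ltW.
rewrite (@Rintegral_itv_cat _ g a (a + e) b)//.
rewrite (@Rintegral_itv_cat _ _ a b (b + e))//; last exact: ltW.
rewrite (@Rintegral_itv_cat _ _ a (a + e) b)//.
have -> : \int[mu]_(r in `[(a + e), b]) (g r * plateau a b e r) =
          \int[mu]_(r in `[(a + e), b]) g r.
  apply: eq_Rintegral => x; rewrite inE/= in_itv/= => /andP[h1 h2].
  by rewrite plateau_eq1// mulr1.
have -> (A B A' B' : R) : A + B - (A' + B + B') = (A - A') - B' by ring.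
rewrite -RintegralB//.
have h1 : `|\int[mu]_(x in `[a, (a + e)]) (g x - g x * plateau a b e x)| <= d / 2.
  have i1 : mu.-integrable `[a, a + e] (EFin \o (fun x => g x - g x * plateau a b e x)).
    by have := integrableB (measurable_itvR _) (ig a (a + e)) (gp a (a + e));
      exact: eq_integrable.
  apply: le_trans (le_normr_Rintegral _ i1) _ => //.
  apply: (@le_trans _ _ (\int[mu]_(x in `[a, a + e]) `|g x|)).
    apply: le_Rintegral => //; first exact: integrable_norm.
    move=> x; rewrite /= in_itv/= => /andP[_ xae].
    rewrite -{1}(mulr1 (g x)) -mulrBr normrM ler_piMr//.
    rewrite /plateau (@ramp_le _ b) ?subr0//; last exact: le_trans aeb.
    have := ramp_ge0 a e x; have := ramp_le1 a e x.
    by move=> ? ?; rewrite ger0_norm ?subr_ge0// gerBl.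
  rewrite -[leLHS]ger0_norm; last exact: Rintegral_ge0.
  rewrite -normrN -sub0r; near: e.
  by move/cvgrPdist_le: (Rintegral_norm_small a sg); apply.
have h2 : `|\int[mu]_(x in `[b, (b + e)]) (g x * plateau a b e x)| <= d / 2.
  apply: le_trans (le_normr_Rintegral _ (gp _ _)) _ => //.
  apply: (@le_trans _ _ (\int[mu]_(x in `[b, b + e]) `|g x|)).
    apply: le_Rintegral => //; first exact: integrable_norm.
    by move=> x _; rewrite normrM ler_piMr// plateau_norm_le1.
  rewrite -[leLHS]ger0_norm; last exact: Rintegral_ge0.
  rewrite -normrN -sub0r; near: e.
  by move/cvgrPdist_le: (Rintegral_norm_small b sg); apply.
by apply: le_trans (ler_normB _ _) _; rewrite (splitr d); exact: lerD.
Unshelve. all: by end_near. Qed.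

Variables (i : interval R).
Hypothesis oi : open [set` i].

Definition weak_derivative f g := forall phi, test_fun i phi ->
  \int[mu]_x (f x * derive1 phi x) = - \int[mu]_x (g x * phi x).

(* Test with a plateau over [[a, b]] whose two flanks become infinitely steep. *)
Lemma weak_derivative_lebesgue_pt f g a b : sq_integrable f -> sq_integrable g ->
  weak_derivative f g -> a \in i -> b \in i -> a < b ->
  lebesgue_pt f a -> lebesgue_pt f b ->
  f b - f a = \int[mu]_(x in `[a, b]) g x.
Proof.
move=> sf sg fg ai bi ab la lb.
have lhs : (\int[mu]_x (f x * derive1 (ramp b e) x) -
    \int[mu]_x (f x * derive1 (ramp a e) x)) @[e --> 0^'+] --> f b - f a.
  by apply: cvgB; exact: lebesgue_pt_ramp.
have eqn : \forall e \near 0^'+, \int[mu]_x (g x * plateau a b e x) =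
    \int[mu]_x (f x * derive1 (ramp b e) x) -
    \int[mu]_x (f x * derive1 (ramp a e) x).
  (* The falling flank extends to [b + e]; openness of [i] keeps it inside for small [e]. *)
  have nb : \forall y \near b, y \in i by exact: open_nbhs_nbhs.
  have nb0 : \forall e \near 0^'+, b + e \in i.
    have : (b + e) @[e --> 0^'+] --> b.
      rewrite -[X in _ --> X](addr0 b); apply: cvgD; first exact: cvg_cst.
      exact: cvg_at_right_filter.
    by move/(_ _ nb).
  near=> e.
  have e0 : 0 < e by near: e; exact: nbhs_right_gt.
  have bei : b + e \in i by near: e.
  have sqr c : sq_integrable (derive1 (ramp c e)).
    have [C C0 hC] := @derive_ramp_bounded R.
    apply: (@sq_integrable_bounded _ _ (C / e) c (c + e)).
    - by apply: smooth_measurable; apply: smooth_derive; exact: smooth_ramp.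
    - by move=> x; exact: hC.
    - by move=> x xc; exact: derive_ramp_out.
  rewrite -[LHS]opprK -fg; last first.
    apply: (@smooth_test_fun _ _ _ a (b + e)); first exact: smooth_plateau.
    - by move=> x xab; apply: plateau_out => //; exact: ltW.
    - move=> x; rewrite in_itv/= => xab.
      exact: (@interval_is_interval _ i _ _ ai bei _ xab).
  rewrite -[RHS]opprB; congr (- _); rewrite -RintegralB//; last 2 first.
  - exact: (sq_integrableM sf (sqr a)).
  - exact: (sq_integrableM sf (sqr b)).
  by apply: eq_Rintegral => x _; rewrite derive_plateau mulrBr.
have rhs := cvg_trans (near_eq_cvg eqn) (Rintegral_plateau sg ab).
exact: (cvg_unique (@Rhausdorff R) lhs (rhs _)).
Unshelve. all: by end_near. Qed.

(** The interval []a0, b0[] has positive measure, so it contains a Lebesgue point [c]. A primitive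
    normalised to agree with [f] at [c] agrees with it at every Lebesgue point of [i]. *)
Lemma weak_derivative_primitive f g a0 b0 :
  sq_integrable f -> sq_integrable g -> weak_derivative f g ->
  a0 < b0 -> [set` `]a0, b0[] `<=` [set` i] ->
  exists2 F, primitive_of g F & {ae mu, forall x, x \in i -> f x = F x}.
Proof.
move=> sf sg fg ab abi.
have ael := lebesgue_differentiation (sq_integrable_locally_integrable sf).
have [c [ci lc]] : exists c, c \in i /\ lebesgue_pt f c.
  apply: contrapT => nex; have /negligibleP : mu.-negligible `]a0, b0[.
    have [A [mA A0 sA]] := ael; exists A; split => // x xab.
    by apply: sA => /= lx; apply: nex; exists x; split => //; exact: abi.
  move=> /(_ (measurable_itv _)); rewrite [LHS](lebesgue_measure_itv `]a0, b0[)/=.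
  by rewrite lte_fin ab -EFinD => -[] /eqP; rewrite subr_eq0 gt_eqF.
have pg := primitive_ofP sg.
exists (fun x => f c + primitive g x - primitive g c).
  by move=> x y xy; rewrite -(pg x y xy); ring.
apply: negligibleS ael => x /= nfx lx; apply: nfx => xi.
have [xc|cx|<-] := ltgtP x c; last by ring.
- have := weak_derivative_lebesgue_pt sf sg fg xi ci xc lx lc.
  by rewrite -(pg _ _ (ltW xc)) => h; rewrite -addrA -opprB -h; ring.
- have := weak_derivative_lebesgue_pt sf sg fg ci xi cx lc lx.
  by rewrite -(pg _ _ (ltW cx)) => h; rewrite -addrA -h; ring.
Qed.

End WeakPrimitive.

(** * Green's formula *)

Section Green.
Context {R : realType}.
Local Notation mu := (@lebesgue_measure R).
Implicit Types (f g h F : R -> R) (x a b : R) (i : interval R).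

Lemma Rintegral_expand h : mu.-integrable setT (EFin \o h) ->
  (\int[mu]_(x in `[- n%:R, n%:R]) h x) @[n --> \oo] --> \int[mu]_x h x.
Proof.
move=> ih; apply: fine_cvg; rewrite fineK; last exact: integrable_fin_num.
under eq_fun do rewrite integral_mkcond.
apply: (@dominated_cvg _ _ _ mu setT measurableT _ _ (fun x => `|(h x)%:E|)%E) => //.
- move=> n; apply/(measurable_restrictT _ _).1 => //.
  by apply: measurable_funTS; exact: (measurable_int mu).
- move=> x _; apply: cvg_near_cst; near=> n; rewrite patchE ifT//.
  rewrite inE/= in_itv/= -ler_norml; near: n; exact: nbhs_infty_ger.
- exact: integrable_abse.
- by move=> n x _; rewrite patchE; case: ifP => //; rewrite abse0.
Unshelve. all: by end_near. Qed.

(** The endpoints may be boundary points outside [i], so the integral is moved to the open interval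
    before equality on [i] is applied. *)
Lemma Rintegral_ae_itv f g i a b : measurable_fun setT f -> measurable_fun setT g ->
  {ae mu, forall x, x \in i -> f x = g x} -> [set` `]a, b[] `<=` [set` i] ->
  \int[mu]_(x in `[a, b]) f x = \int[mu]_(x in `[a, b]) g x.
Proof.
move=> mf mg fg abi.
have mEf (D : set (measurableTypeR R)) : measurable_fun D (EFin \o f).
  by apply: measurable_funTS; exact/measurable_EFinP.
have mEg (D : set (measurableTypeR R)) : measurable_fun D (EFin \o g).
  by apply: measurable_funTS; exact/measurable_EFinP.
have oo (p : R -> R) :
    (forall D : set (measurableTypeR R), measurable_fun D (EFin \o p)) ->
    (\int[mu]_(x in `[a, b]) (p x)%:E = \int[mu]_(x in `]a, b[) (p x)%:E)%E.
  move=> mp; transitivity (\int[mu]_(x in `[a, b[) (p x)%:E)%E; apply/esym.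
    exact: (@integral_itv_bndo_bndc _ (BLeft a) b _ (mp _)).
  exact: (@integral_itv_obnd_cbnd _ a (BLeft b) _ (mp _)).
rewrite /Rintegral !oo//.
congr fine; apply: ae_eq_integral => //.
apply: negligibleS fg => x /= nfg xi; apply: nfg => xab.
by rewrite xi//; exact: abi.
Qed.

Lemma primitive_of_measurable f F : primitive_of f F -> sq_integrable f ->
  measurable_fun setT F.
Proof.
by move=> fF sf; apply: continuous_measurable_fun; exact: primitive_of_continuous sf.
Qed.

Section OneInterval.
Variables (i : interval R) (f g F : R -> R).
Hypotheses (sf : sq_integrable f) (sg : sq_integrable g).
Hypotheses (gF : primitive_of g F)
  (fF : {ae mu, forall x, x \in i -> f x = F x}).

Lemma green_itv a b : a <= b -> [set` `]a, b[] `<=` [set` i] ->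
  F b ^+ 2 - F a ^+ 2 = 2 * \int[mu]_(x in `[a, b]) (f x * g x).
Proof.
move=> ab abi; rewrite (primitive_of_sqr gF sg ab); congr (_ * _).
have mF := primitive_of_measurable gF sg.
have [[mf _] [mg _]] := (sf, sg).
apply: (@Rintegral_ae_itv _ _ i) => //; [exact: measurable_funM..|].
by apply: negligibleS fF => x /= nfg fgx; apply: nfg => xi; rewrite fgx.
Qed.

(** A Sobolev inequality on a unit interval. Cauchy-Schwarz gives [(F x - F t)^2 <= S], hence
    [F x ^ 2 / 2 - S <= F t ^ 2], which is integrated over [t]. *)
Lemma primitive_of_sqr_le a b x : a <= x <= b -> b - a = 1 ->
    [set` `]a, b[] `<=` [set` i] ->
  F x ^+ 2 <= 2 * \int[mu]_(t in `[a, b]) (f t ^+ 2 + g t ^+ 2).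
Proof.
move=> /andP[ax xb] ba abi.
have le1 (u v s : R) : (u - v) ^+ 2 <= s -> v ^+ 2 <= 2 * u ^+ 2 + 2 * s.
  by have := sqr_ge0 (u + u - v); rewrite !expr2; nra.
have le2 (u v s : R) : (u - v) ^+ 2 <= s -> u ^+ 2 / 2 - s <= v ^+ 2.
  by have := sqr_ge0 (u - v - v); rewrite !expr2; nra.
have ab := le_trans ax xb.
have mF := primitive_of_measurable gF sg.
have [[mf _] [mg _]] := (sf, sg).
have if2 := sq_integrable_sq_itv a b sf.
have ig2 := sq_integrable_sq_itv a b sg.
set S := \int[mu]_(t in `[a, b]) (g t ^+ 2).
have osc t : a <= t <= b -> (F x - F t) ^+ 2 <= S.
  move=> /andP[at_ tb].
  have key s r : a <= s -> s <= r -> r <= b -> (F r - F s) ^+ 2 <= S.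
    move=> as_ sr rb; have h := primitive_of_norm_le gF sg sr.
    rewrite -(real_normK (num_real _)).
    have h2 : `|F r - F s| ^+ 2 <= (\int[mu]_(t in `[s, r]) `|g t|) ^+ 2.
      by rewrite lerXn2r ?nnegrE//; exact: le_trans h.
    apply: le_trans h2 _; apply: le_trans (Rintegral_norm_sq_le sr sg) _.
    have rs1 : r - s <= 1 by rewrite -ba lerB.
    apply: (@le_trans _ _ (\int[mu]_(t in `[s, r]) g t ^+ 2)).
      by rewrite ler_piMl//; apply: Rintegral_ge0 => ? _; exact: sqr_ge0.
    by apply: Rintegral_itv_le => // [r'|*]; [exact: sqr_ge0|exact: sq_integrable_sq_itv].
  have [xt|tx] := leP x t; first by rewrite -sqrrN opprB; exact: key.
  by apply: key => //; exact: ltW.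
rewrite RintegralD// -/S.
have -> : \int[mu]_(t in `[a, b]) f t ^+ 2 = \int[mu]_(t in `[a, b]) F t ^+ 2.
  apply: (@Rintegral_ae_itv _ _ i) => //; [exact: measurable_funX..|].
  by apply: negligibleS fF => t /= nfg fgt; apply: nfg => ti; rewrite fgt.
have iF2 : mu.-integrable `[a, b] (EFin \o (fun t => F t ^+ 2)).
  apply: (@integrable_le _ _ _ (fun=> 2 * F x ^+ 2 + 2 * S)) => //.
  - by apply: measurable_funTS; exact: measurable_funX.
  - exact: sq_integrable_cst_itv.
  - move=> t /= /osc h; rewrite ger0_norm ?sqr_ge0//; exact: le1.
have ic c := sq_integrable_cst_itv a b c.
have mab : fine (mu `[a, b]) = 1.
  have ab' : a < b by rewrite -subr_gt0 ba.
  by rewrite [X in fine X](lebesgue_measure_itv `[a, b])/= lte_fin ab' -EFinD.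
have h : \int[mu]_(t in `[a, b]) (F x ^+ 2 / 2 - S) <=
         \int[mu]_(t in `[a, b]) F t ^+ 2.
  by apply: le_Rintegral => // t /= /osc h; exact: le2.
rewrite Rintegral_cst//= mab mulr1 in h.
move: h; move: (\int[mu]_(_ in _) _) => u h; clear -h; move: S h => s h; lra.
Qed.

(* [F x ^ 2] is at most twice the H^1-energy of [F] on an interval of length 1
   around [x], which tends to 0 as the interval moves to infinity. *)
Lemma primitive_of_cvg0 (c d : nat -> R) :
  (forall n, [set` `]c n, d n[] `<=` [set` i]) -> (forall n, d n - c n = 1) ->
  (\forall n \near \oo, [set` `[c n, d n]] `<=` [set` `[- n.+1%:R, n.+1%:R]] /\
     (d n <= - n%:R \/ n%:R <= c n)) ->
  forall x : nat -> R, (forall n, c n <= x n <= d n) ->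
  (F (x n)) ^+ 2 @[n --> \oo] --> (0 : R).
Proof.
move=> cdi dc cdn x cxd.
pose h t := f t ^+ 2 + g t ^+ 2.
have h0 t : 0 <= h t by rewrite addr_ge0// sqr_ge0.
have ih : mu.-integrable setT (EFin \o h).
  case: sf => _ if2; case: sg => _ ig2.
  by have := integrableD measurableT if2 ig2; exact: eq_integrable.
have ihI a b : mu.-integrable `[a, b] (EFin \o h) by exact: integrableS ih.
(* Eventually [[c n, d n]] lies in the shell between [[- n, n]] and [[- (n + 1), n + 1]], so its
   energy is at most [q (n + 1) - q n], a difference of consecutive terms of a convergent
   sequence. *)
pose q n := \int[mu]_(t in `[- n%:R, n%:R]) h t.
have qcvg : q @ \oo --> \int[mu]_t h t by exact: Rintegral_expand.
have qS : (2 * (q n.+1 - q n)) @[n --> \oo] --> (0 : R).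
  rewrite -[X in _ --> X](mulr0 2); apply: cvgM; first exact: cvg_cst.
  rewrite -(subrr (\int[mu]_t h t)); apply: cvgB => //.
  by move: qcvg; rewrite -(cvg_shiftS q).
apply: (squeeze_cvgr _ (cvg_cst 0) qS).
near=> n; rewrite sqr_ge0/=.
have [sub out] : [set` `[c n, d n]] `<=` [set` `[- n.+1%:R, n.+1%:R]] /\
     (d n <= - n%:R \/ n%:R <= c n) by near: n.
have key : (F (x n)) ^+ 2 <= 2 * \int[mu]_(t in `[c n, d n]) h t.
  exact: (primitive_of_sqr_le (cxd n) (dc n) (cdi n)).
apply: le_trans key _.
rewrite ler_wpM2l//.
have cd : c n <= d n by rewrite -subr_ge0 dc.
have [cn dn] : - n.+1%:R <= c n /\ d n <= n.+1%:R.
  by split; [have := sub (c n)|have := sub (d n)];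
    rewrite /= !in_itv/= lexx cd/= => /(_ isT)/andP[].
have n0 : (0 : R) <= n%:R by [].
have nS : (n%:R : R) <= n.+1%:R by rewrite ler_nat.
rewrite lerBrDr /q.
case: out => [dl|cr].
- apply: (@le_trans _ _ (\int[mu]_(t in `[c n, n%:R]) h t)).
    rewrite (@Rintegral_itv_cat _ h (c n) (d n) n%:R)//; last by lra.
    by rewrite lerD2l; apply: Rintegral_itv_le => //; lra.
  by apply: Rintegral_itv_le => //; lra.
- apply: (@le_trans _ _ (\int[mu]_(t in `[- n%:R, d n]) h t)).
    rewrite addrC (@Rintegral_itv_cat _ h (- n%:R) (c n) (d n))//; last by lra.
    by rewrite lerD2r; apply: Rintegral_itv_le => //; lra.
  by apply: Rintegral_itv_le => //; lra.
Unshelve. all: by end_near. Qed.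

End OneInterval.

Lemma green_bounded a b f g F : a < b -> sq_integrable f -> sq_integrable g ->
  primitive_of g F -> {ae mu, forall x, x \in `]a, b[ -> f x = F x} ->
  (forall x, x \notin `]a, b[ -> g x = 0) ->
  2 * \int[mu]_x (f x * g x) = F b ^+ 2 - F a ^+ 2.
Proof.
move=> ab sf sg gF fF g0.
rewrite (green_itv sf sg gF fF (ltW ab))//; congr (_ * _).
apply: Rintegral_supp => x xab; rewrite g0 ?mulr0//.
by apply: contra xab; exact: subset_itv_oo_cc.
Qed.

Lemma green_right a f g F : sq_integrable f -> sq_integrable g ->
  primitive_of g F -> {ae mu, forall x, x \in `]a, +oo[ -> f x = F x} ->
  (forall x, x \notin `]a, +oo[ -> g x = 0) ->
  2 * \int[mu]_x (f x * g x) = - F a ^+ 2.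
Proof.
move=> sf sg gF fF g0.
have ifg := sq_integrableM sf sg.
(* Green's formula is applied on [[a, n]], and its boundary term at [n] vanishes in the limit. The
   maximum matters for small [n] only, where it keeps the unit interval after [c n] inside the
   half-line. *)
pose c (n : nat) : R := Num.max a n%:R.
have Fc0 : (F (c n)) ^+ 2 @[n --> \oo] --> (0 : R).
  apply: (primitive_of_cvg0 sf sg gF fF (c := c) (d := fun n => c n + 1)).
  - move=> n x /=; rewrite !in_itv/= andbT => /andP[+ _].
    by apply: le_lt_trans; rewrite le_max lexx.
  - by move=> n; rewrite addrAC subrr add0r.
  - near=> n.
    have cn : c n = n%:R.
      by apply/max_idPr; near: n; exact: nbhs_infty_ger.
    rewrite cn natr1; split; last by right.
    move=> x /=; rewrite !in_itv/= => /andP[nx ->]; rewrite andbT.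
    by apply: le_trans nx; rewrite lerNl (@le_trans _ _ 0)// oppr_le0.
  - by move=> n; rewrite lexx lerDl ler01.
have key : (F a ^+ 2 + 2 * \int[mu]_(x in `[- n%:R, n%:R]) (f x * g x))
    @[n --> \oo] --> F a ^+ 2 + 2 * \int[mu]_x (f x * g x).
  apply: cvgD; first exact: cvg_cst.
  by apply: cvgM; [exact: cvg_cst|exact: Rintegral_expand].
have eqn : \forall n \near \oo, (F (c n)) ^+ 2 =
    F a ^+ 2 + 2 * \int[mu]_(x in `[- n%:R, n%:R]) (f x * g x).
  near=> n.
  have an : `|a| <= n%:R by near: n; exact: nbhs_infty_ger.
  have [na an'] : - n%:R <= a /\ a <= n%:R.
    by move: an; rewrite ler_norml => /andP[].
  have -> : c n = n%:R by apply/max_idPr.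
  rewrite (@Rintegral_itv_cat _ _ (- n%:R) a n%:R)//; last exact: integrableS ifg.
  have -> : \int[mu]_(x in `[- n%:R, a]) (f x * g x) = 0.
    have := @Rintegral_cst _ _ _ mu _ (measurable_itvR `[- n%:R, a]) 0.
    rewrite mul0r => <-; apply: eq_Rintegral => x.
    rewrite inE/= in_itv/= => /andP[_ xa]; rewrite g0 ?mulr0//.
    by rewrite in_itv/= andbT -leNgt.
  rewrite add0r -(green_itv sf sg gF fF an'); first by ring.
  by apply: subset_itv; rewrite bnd_simp.
have := cvg_unique (@Rhausdorff R) key (cvg_trans (near_eq_cvg eqn) Fc0).
by move=> /(_ _ _)/eqP; rewrite addrC addr_eq0 => /eqP.
Unshelve. all: by end_near. Qed.

Lemma green_left b f g F : sq_integrable f -> sq_integrable g ->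
  primitive_of g F -> {ae mu, forall x, x \in `]-oo, b[ -> f x = F x} ->
  (forall x, x \notin `]-oo, b[ -> g x = 0) ->
  2 * \int[mu]_x (f x * g x) = F b ^+ 2.
Proof.
move=> sf sg gF fF g0.
have ifg := sq_integrableM sf sg.
pose d (n : nat) : R := Num.min b (- n%:R).
have Fd0 : (F (d n)) ^+ 2 @[n --> \oo] --> (0 : R).
  apply: (primitive_of_cvg0 sf sg gF fF (c := fun n => d n - 1) (d := d)).
  - move=> n x /=; rewrite !in_itv/= => /andP[_] /lt_le_trans; apply.
    by rewrite ge_min lexx.
  - by move=> n; rewrite opprB addrCA subrr addr0.
  - near=> n.
    have dn : d n = - n%:R.
      by apply/min_idPr; rewrite lerNl; near: n; exact: nbhs_infty_ger.
    rewrite dn -opprD natr1; split; last by left.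
    move=> x /=; rewrite !in_itv/= => /andP[-> xn].
    by apply: le_trans xn _; rewrite lerNl (@le_trans _ _ 0)// oppr_le0.
  - by move=> n; rewrite lexx gerBl ler01.
have key : (F b ^+ 2 - 2 * \int[mu]_(x in `[- n%:R, n%:R]) (f x * g x))
    @[n --> \oo] --> F b ^+ 2 - 2 * \int[mu]_x (f x * g x).
  apply: cvgB; first exact: cvg_cst.
  by apply: cvgM; [exact: cvg_cst|exact: Rintegral_expand].
have eqn : \forall n \near \oo, (F (d n)) ^+ 2 =
    F b ^+ 2 - 2 * \int[mu]_(x in `[- n%:R, n%:R]) (f x * g x).
  near=> n.
  have bn : `|b| <= n%:R by near: n; exact: nbhs_infty_ger.
  have [nb bn'] : - n%:R <= b /\ b <= n%:R.
    by move: bn; rewrite ler_norml => /andP[].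
  have -> : d n = - n%:R by apply/min_idPr.
  rewrite (@Rintegral_itv_cat _ _ (- n%:R) b n%:R)//; last exact: integrableS ifg.
  have -> : \int[mu]_(x in `[b, n%:R]) (f x * g x) = 0.
    have := @Rintegral_cst _ _ _ mu _ (measurable_itvR `[b, n%:R]) 0.
    rewrite mul0r => <-; apply: eq_Rintegral => x.
    rewrite inE/= in_itv/= => /andP[bx _]; rewrite g0 ?mulr0//.
    by rewrite in_itv/= -leNgt.
  rewrite addr0 -(green_itv sf sg gF fF nb); first by ring.
  by apply: subset_itv; rewrite bnd_simp.
have := cvg_unique (@Rhausdorff R) key (cvg_trans (near_eq_cvg eqn) Fd0).
by move=> /(_ _ _)/eqP; rewrite subr_eq0 => /eqP ->.
Unshelve. all: by end_near. Qed.

End Green.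

(** * Square integrable functions and elements of L^2 *)

Section L2Functions.
Context {R : realType}.
Local Notation mu := (@lebesgue_measure R).
Implicit Types (i : interval R) (f g h : R -> R).

Lemma ae_lebesgue_on i (P : R -> Prop) :
  {ae lebesgue_on i, forall x, P x} <-> {ae mu, forall x, x \in i -> P x}.
Proof.
split=> -[A [mA A0 sA]].
- exists (A `&` [set` i]); split => //; first exact: measurableI.
  move=> x /= nP; have [xi px] : x \in i /\ ~ P x.
    by apply/not_implyP => h; apply: nP.
  by split => //; apply: sA.
- exists (A `|` ~` [set` i]); split.
  + by apply: measurableU => //; exact: measurableC.
  + rewrite /lebesgue_on/= /mrestr setIUl setICl setU0.
    by apply: (subset_measure0 _ mA _ A0) => //; exact: measurableI.
  + move=> x /= nP; have [xi|/negP xi] := boolP (x \in i); last by right.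
    by left; apply: sA => /= h; apply: nP; exact: h.
Qed.

Lemma integral_lebesgue_on i (f : R -> \bar R) : measurable_fun setT f ->
  (\int[lebesgue_on i]_x f x = \int[mu]_x (f \_ [set` i]) x)%E.
Proof.
move=> mf; transitivity (\int[lebesgue_on i]_x (f \_ [set` i]) x)%E.
  apply: ae_eq_integral => //.
    by apply/(measurable_restrictT _ _).1 => //; exact: measurable_funTS.
  apply/ae_lebesgue_on; apply: negligibleS (negligible_set0 mu) => x /= nfx.
  by apply: nfx => xi _; rewrite patchE ifT// inE.
rewrite -!integral_mkcond; apply: eq_measure_integral => A mA Ai /=.
by rewrite /mrestr setIidl.
Qed.

Lemma Rintegral_lebesgue_on i f : measurable_fun setT f ->
  \int[lebesgue_on i]_x f x = \int[mu]_x (f \_ [set` i]) x.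
Proof.
move=> mf; rewrite /Rintegral integral_lebesgue_on; last exact/measurable_EFinP.
by congr fine; apply: eq_integral => x _; rewrite !patchE; case: ifP.
Qed.

Lemma integrable_lebesgue_on i f : (lebesgue_on i).-integrable setT (EFin \o f) ->
  mu.-integrable setT (EFin \o (f \_ [set` i])).
Proof.
move=> /integrableP[mf ff]; rewrite -restrict_EFin; apply/integrableP; split.
  by apply/(measurable_restrictT _ _).1 => //; exact: measurable_funTS.
move: ff; rewrite integral_lebesgue_on; last exact: measurableT_comp.
apply: le_lt_trans; rewrite le_eqVlt; apply/orP; left; apply/eqP.
apply: eq_integral => x _; rewrite !patchE; case: ifP => // _.
by rewrite abse0.
Qed.

(** A class in [L2 i] carries arbitrary values off [i]; extension by zero turns it into a square
    integrable function on the line that is determined up to null sets. *)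
Definition ext i (u : L2 i) : R -> R := u \_ [set` i].

Lemma L2_measurable i (u : L2 i) : measurable_fun setT (u : R -> R).
Proof.
have := LfunP (repr u); rewrite inE => /andP[+ _].
by rewrite inE.
Qed.

Lemma ext_in i (u : L2 i) x : x \in i -> ext u x = u x.
Proof. by move=> xi; rewrite /ext patchE ifT// inE. Qed.

Lemma ext_out i (u : L2 i) x : x \notin i -> ext u x = 0.
Proof.
by move=> xi; rewrite /ext patchE ifF//; apply/negbTE; rewrite notin_setE/=; exact/negP.
Qed.

Lemma sq_integrable_ext i (u : L2 i) : sq_integrable (ext u).
Proof.
split.
  apply/(measurable_restrictT _ _).1 => //; apply: measurable_funTS.
  exact: L2_measurable.
have /integrable_lebesgue_on := Lfun2_integrable_sqr (LfunP (repr u)).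
apply: eq_integrable => // x _ /=; rewrite /ext !patchE; case: ifP => // _.
by rewrite expr0n.
Qed.

Lemma dotL2E i (u v : L2 i) : dotL2 u v = \int[mu]_x (ext u x * ext v x).
Proof.
rewrite /dotL2 Rintegral_lebesgue_on; last first.
  by apply: measurable_funM; exact: L2_measurable.
apply: eq_Rintegral => x _; rewrite /ext !patchE; case: ifP => // _.
by rewrite mul0r.
Qed.

Lemma L2_eqP i (u v : L2 i) :
  u = v <-> {ae mu, forall x, x \in i -> u x = v x}.
Proof.
split=> [->|/ae_lebesgue_on uv].
  by apply: negligibleS (negligible_set0 mu) => x /=; apply.
rewrite -(Lquot_ofK u) -(Lquot_ofK v); apply/Lquot_ofP.
by apply: negligibleS uv => x /= nuv h; apply: nuv.
Qed.

Lemma ext_eqP i (u v : L2 i) :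
  u = v <-> {ae mu, forall x, ext u x = ext v x}.
Proof.
split=> [->|uv].
  by apply: negligibleS (negligible_set0 mu) => x /=; apply.
apply/L2_eqP; apply: negligibleS uv => x /= nuv h; apply: nuv => xi.
by rewrite -!ext_in.
Qed.

Lemma ext_linear i (a : R) (u v : L2 i) :
  {ae mu, forall x, ext (a *: u + v) x = a * ext u x + ext v x}.
Proof.
have h : {ae lebesgue_on i, forall x,
    L2_fun (a *: u + v) x = a * u x + v x}.
  have := Lquot_funE (a *: repr u + repr v).
  have -> : Lquot_of (a *: repr u + repr v) = a *: u + v.
    rewrite -Lquot_addE -Lquot_scaleE !Lquot_ofK.
    by [].
  by apply: filterS => x /(_ I).
move/ae_lebesgue_on: h; apply: negligibleS => x /= nh h; apply: nh.
have [xi|xi] := boolP (x \in i); first by rewrite !ext_in// h.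
by rewrite !ext_out//; ring.
Qed.

Lemma L2_ofP i f : sq_integrable f ->
  exists u : L2 i, {ae mu, forall x, x \in i -> u x = f x}.
Proof.
move=> [mf sf].
have fL : f \in Lfun (lebesgue_on i) 2%:E.
  rewrite inE; apply/andP; split; rewrite inE//=.
  rewrite /finite_norm unlock; apply: poweR_lty.
  rewrite integral_lebesgue_on; last first.
    apply/measurable_EFinP; apply: (measurableT_comp (measurable_powR _)) => //.
    exact: measurableT_comp.
  case/integrableP: sf => msf; apply: le_lt_trans.
  apply: ge0_le_integral => //.
  - by move=> x _; rewrite patchE; case: ifP => //; rewrite lee_fin powR_ge0.
  - apply/(measurable_restrictT _ _).1 => //; apply: measurable_funTS.
    apply/measurable_EFinP; apply: (measurableT_comp (measurable_powR _)) => //.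
    exact: measurableT_comp.
  - exact: measurableT_comp.
  - move=> x _ /=; rewrite patchE; case: ifP => _.
      by rewrite lee_fin powR_mulrn// normrX.
    by change (0%E <= (`|f x ^+ 2|)%:E)%E; rewrite lee_fin.
exists (Lquot_of (Lfun_Sub (lee1n 2) fL)); apply/ae_lebesgue_on.
have := Lquot_funE (Lfun_Sub (lee1n 2) fL).
by apply: filterS => x /(_ I).
Qed.

Definition L2_of i f (sf : sq_integrable f) : L2 i := projT1 (cid (L2_ofP i sf)).

Lemma L2_ofE i f (sf : sq_integrable f) :
  {ae mu, forall x, x \in i -> L2_of i sf x = f x}.
Proof. exact: (projT2 (cid (L2_ofP i sf))). Qed.

Lemma Rintegral_ae_eq f g : measurable_fun setT f -> measurable_fun setT g ->
  {ae mu, forall x, f x = g x} -> \int[mu]_x f x = \int[mu]_x g x.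
Proof.
move=> mf mg fg; congr fine; apply: ae_eq_integral => //; try exact/measurable_EFinP.
by apply: negligibleS fg => x /= nfg h; apply: nfg => _; rewrite h.
Qed.

Lemma dotL2C i (u v : L2 i) : dotL2 u v = dotL2 v u.
Proof. by rewrite !dotL2E; apply: eq_Rintegral => x _; rewrite mulrC. Qed.

Lemma dotL2_linear i (a : R) (u v w : L2 i) :
  dotL2 (a *: u + v) w = a * dotL2 u w + dotL2 v w.
Proof.
have [su [sv sw]] := (sq_integrable_ext u, (sq_integrable_ext v, sq_integrable_ext w)).
have iuw := sq_integrableM su sw.
rewrite !dotL2E.
transitivity (\int[mu]_x (a * (ext u x * ext w x) + ext v x * ext w x)).
  apply: Rintegral_ae_eq.
  - by apply: measurable_funM; case: (sq_integrable_ext (a *: u + v)); case: sw.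
  - case: su => mu' _; case: sv => mv _; case: sw => mw _.
    by apply: measurable_funD; do ?apply: measurable_funM.
  - by apply: negligibleS (ext_linear a u v) => x /= nh h; apply: nh; rewrite h; ring.
rewrite RintegralD//; last exact: (sq_integrableM sv sw).
  by rewrite RintegralZl.
by have := integrableZl measurableT a iuw; exact: eq_integrable.
Qed.

Lemma dotL2_ge0 i (u : L2 i) : 0 <= dotL2 u u.
Proof. by rewrite dotL2E; apply: Rintegral_ge0 => x _; rewrite -expr2 sqr_ge0. Qed.

Lemma dotL2_eq0 i (u : L2 i) : dotL2 u u = 0 -> u = 0.
Proof.
have su := sq_integrable_ext u.
rewrite dotL2E => /eqP u0.
have : (\int[mu]_x `|((ext u x) ^+ 2)%:E| = 0)%E.
  apply/eqP; rewrite -fine_eq0; last first.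
    by case: su => _ /integrable_abse/integrable_fin_num; exact.
  rewrite -(eqP u0); apply/eqP; congr fine; apply: eq_integral => x _ /=.
  by rewrite -expr2 ger0_norm// sqr_ge0.
move/ae_eq_integral_abs => h.
have u0' : {ae mu, forall x, ext u x = 0}.
  have := h measurableT _; rewrite /ae_eq => h'.
  have m2 : measurable_fun setT (fun x => ((ext u x) ^+ 2)%:E).
    by apply/measurable_EFinP; apply: measurable_funX; case: su.
  apply: negligibleS (h' m2) => x /= nu hx; apply: nu.
  by have /eqP := hx I; rewrite eqe sqrf_eq0 => /eqP.
have e0 : {ae mu, forall x, ext (0 : L2 i) x = 0}.
  have := ext_linear (-1) u u; rewrite scaleN1r addNr; apply: negligibleS.
  by move=> x /= nh hx; apply: nh; rewrite hx; ring.
apply/ext_eqP.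
apply: negligibleS (negligibleU u0' e0) => x /= nh.
apply: contrapT => /not_orP[/contrapT h1 /contrapT h2].
by apply: nh; rewrite h1 h2.
Qed.

Lemma weak_derivP i (u v : L2 i) :
  weak_deriv u v <-> weak_derivative i (ext u) (ext v).
Proof.
suff H phi : test_fun i phi ->
    (\int[lebesgue_on i]_x (u x * derive1 phi x) =
     \int[mu]_x (ext u x * derive1 phi x)) /\
    (\int[lebesgue_on i]_x (v x * phi x) = \int[mu]_x (ext v x * phi x)).
  by split=> uv phi tphi; have [H1 H2] := H phi tphi; have := uv phi tphi;
    rewrite H1 H2.
move=> tphi; have sphi := test_fun_smooth tphi.
have mphi := smooth_measurable sphi.
have mdphi := smooth_measurable (smooth_derive sphi).
split; rewrite Rintegral_lebesgue_on; try by apply: measurable_funM => //; exact: L2_measurable.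
- apply: eq_Rintegral => x _; rewrite /ext !patchE; case: ifP => // _.
  by rewrite mul0r.
- apply: eq_Rintegral => x _; rewrite /ext !patchE; case: ifP => // _.
  by rewrite mul0r.
Qed.

End L2Functions.

(** * Continuous representatives and their boundary values *)

Section Representatives.
Context {R : realType}.
Local Notation mu := (@lebesgue_measure R).
Implicit Types (f g h F G : R -> R) (x a b : R).

Lemma negligible_itv_lt (a b : R) (A : set R) : a < b ->
  mu.-negligible A -> exists2 x, x \in `]a, b[ & ~ A x.
Proof.
move=> ab nA; apply: contrapT => nex.
have /negligibleP : mu.-negligible `]a, b[.
  apply: negligibleS nA => x xab.
  by apply: contrapT => nAx; apply: nex; exists x.
move=> /(_ (measurable_itv _)); rewrite [LHS](lebesgue_measure_itv `]a, b[)/=.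
by rewrite lte_fin ab -EFinD => -[] /eqP; rewrite subr_eq0 gt_eqF.
Qed.

Lemma sq_integrable_continuous_supp h (M : R) : 0 < M -> continuous h ->
  (forall x, x \notin `](- M), M[ -> h x = 0) -> sq_integrable h.
Proof.
move=> M0 ch h0.
have cn : {within `[- M, M], continuous (fun x => `|h x|)}.
  apply: continuous_subspaceT => x; apply: continuous_comp; first exact: ch.
  exact: norm_continuous.
have MM : - M <= M by rewrite lerNl (le_trans _ (ltW M0))// oppr_le0 ltW.
have [d _ dmax] := EVT_max MM cn.
apply: (@sq_integrable_bounded _ _ `|h d| (- M) M).
- exact: continuous_measurable_fun.
- move=> x; have [xM|xM] := boolP (x \in `](- M), M[).
    by apply: dmax; exact: subset_itv_oo_cc.
  by rewrite h0// normr0.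
- by move=> x xM; rewrite h0//; apply: contra xM; exact: subset_itv_oo_cc.
Qed.

Lemma sq_integrable_test_fun (i : interval R) (phi : R -> R) : test_fun i phi ->
  sq_integrable phi /\ sq_integrable (derive1 phi).
Proof.
move=> tphi; have sphi := test_fun_smooth tphi.
have [M M0 supp] := test_fun_bounded tphi; split.
  apply: (sq_integrable_continuous_supp M0); first exact: smooth_continuous.
  by move=> x /supp[].
apply: (sq_integrable_continuous_supp M0); last by move=> x /supp[].
by apply: smooth_continuous; exact: smooth_derive.
Qed.

Section OpenInterval.
Variables (i : interval R) (a0 b0 : R).
Hypotheses (oi : open [set` i]) (ab0 : a0 < b0)
  (sub0 : [set` `]a0, b0[] `<=` [set` i]).

(** A difference that is nonzero at [x] stays nonzero near [x], hence on a subset of [i] of positive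
    measure. *)
Lemma continuous_ae_eq f g :
  {within [set` i], continuous f} -> {within [set` i], continuous g} ->
  {ae mu, forall x, x \in i -> f x = g x} -> forall x, x \in i -> f x = g x.
Proof.
move=> cf cg fg x xi.
have cfx : {for x, continuous f}.
  by move: cf; rewrite (continuous_open_subspace f oi); apply; rewrite inE.
have cgx : {for x, continuous g}.
  by move: cg; rewrite (continuous_open_subspace g oi); apply; rewrite inE.
apply/eqP; rewrite -subr_eq0; apply/negPn/negP => fgx.
have cfgx : (f y - g y) @[y --> x] --> f x - g x by exact: cvgB.
have nfg : \forall y \near x, f y - g y != 0.
  exact: cvgr_neq0 cfgx fgx.
have nxi : \forall y \near x, y \in i by exact: open_nbhs_nbhs.
have /nbhs_ballP[e /= e0 he] : \forall y \near x, (f y - g y != 0) /\ y \in i.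
  exact: filterI nfg nxi.
have xxe : x < x + e by rewrite ltrDl.
have [y yx ny] := negligible_itv_lt xxe fg.
have [] : (f y - g y != 0) /\ y \in i.
  apply: he; rewrite -ball_normE/= ler0_norm ?subr_le0.
    by move: yx; rewrite in_itv/= => /andP[_]; rewrite opprB ltrBlDl.
  by move: yx; rewrite in_itv/= => /andP[/ltW].
move=> /eqP fgy yi; apply: ny => /= /(_ yi) fgy'; apply: fgy.
by rewrite fgy' subrr.
Qed.

(** [F] is continuous on the whole line, also at the boundary points of [i], whereas [cont_repr] is
    controlled on [i] only. One-sided limits at the boundary thus become values of [F]. *)
Definition represents F (u : L2 i) :=
  continuous F /\ {ae mu, forall x, x \in i -> u x = F x}.

Lemma cont_reprE F (u : L2 i) : represents F u ->
  forall x, x \in i -> cont_repr u x = F x.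
Proof.
move=> [cF uF]; rewrite /cont_repr; set P := [set f | _].
have PF : P F.
  split; first exact: continuous_subspaceT.
  apply/ae_lebesgue_on; apply: negligibleS uF => x /= nF uFx; apply: nF => xi.
  by rewrite uFx.
have [cg gu] := getPex (ex_intro _ F PF); set g := get P in cg gu *.
apply: continuous_ae_eq => //; first exact: continuous_subspaceT.
move/ae_lebesgue_on: gu => gu.
apply: negligibleS (negligibleU gu uF) => x /= nh.
apply: contrapT => /not_orP[/contrapT h1 /contrapT h2].
by apply: nh => xi; rewrite h1// h2.
Qed.

Lemma eval_leftE F (u : L2 i) b : represents F u ->
  (\forall x \near b^'-, x \in i) -> eval_left u b = F b.
Proof.
move=> uF bi; apply/cvg_lim => //.
apply: (@cvg_trans _ (F x @[x --> b^'-])).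
  by apply: near_eq_cvg; apply: filterS bi => x xi; rewrite (cont_reprE uF).
by apply: cvg_at_left_filter; case: uF => cF _; exact: cF.
Qed.

Lemma eval_rightE F (u : L2 i) a : represents F u ->
  (\forall x \near a^'+, x \in i) -> eval_right u a = F a.
Proof.
move=> uF ai; apply/cvg_lim => //.
apply: (@cvg_trans _ (F x @[x --> a^'+])).
  by apply: near_eq_cvg; apply: filterS ai => x xi; rewrite (cont_reprE uF).
by apply: cvg_at_right_filter; case: uF => cF _; exact: cF.
Qed.

Lemma represents_linear F G (u v : L2 i) (c : R) :
  represents F u -> represents G v ->
  represents (fun x => c * F x + G x) (c *: u + v).
Proof.
move=> [cF uF] [cG vG]; split.
  move=> x; apply: cvgD; last exact: cG.
  by apply: cvgM; [exact: cvg_cst|exact: cF].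
apply: negligibleS (negligibleU (negligibleU uF vG) (ext_linear c u v)) => x /= nh.
apply: contrapT => /not_orP[/not_orP[/contrapT h1 /contrapT h2] /contrapT h3].
by apply: nh => xi; move: h3; rewrite !ext_in// => ->; rewrite h1// h2.
Qed.

Lemma weak_deriv_representative (u v : L2 i) : weak_deriv u v ->
  exists F, represents F u /\ primitive_of (ext v) F.
Proof.
move/weak_derivP => uv.
have [F vF uF] := weak_derivative_primitive oi (sq_integrable_ext u)
  (sq_integrable_ext v) uv ab0 sub0.
exists F; split => //; split.
  exact: primitive_of_continuous vF (sq_integrable_ext v).
by apply: negligibleS uF => x /= nF uFx; apply: nF => xi; rewrite -uFx// ext_in.
Qed.

Lemma weak_derivative_ext (u : L2 i) f (phi : R -> R) :
  {ae mu, forall x, x \in i -> u x = f x} ->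
  measurable_fun setT f -> measurable_fun setT phi ->
  (forall x, x \notin i -> phi x = 0) ->
  \int[mu]_x (ext u x * phi x) = \int[mu]_x (f x * phi x).
Proof.
move=> uf mf mphi phi0; apply: Rintegral_ae_eq.
- by apply: measurable_funM => //; case: (sq_integrable_ext u).
- exact: measurable_funM.
- apply: negligibleS uf => x /= nu ufx; apply: nu.
  have [xi|xi] := boolP (x \in i); first by rewrite ext_in// ufx.
  by rewrite phi0// !mulr0.
Qed.

(** Integration by parts: the derivative of [phi * psi] integrates to 0, since the test function
    [psi] vanishes at both ends of a large interval. Here [phi] may be nonzero at the boundary of
    [i], as for functions with prescribed traces. *)
Lemma smooth_compact_weak_deriv phi (U V : L2 i) : smooth phi ->
  {ae mu, forall x, x \in i -> U x = phi x} ->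
  {ae mu, forall x, x \in i -> V x = derive1 phi x} -> weak_deriv U V.
Proof.
move=> sphi Uphi Vphi; apply/weak_derivP => psi tpsi.
have spsi := test_fun_smooth tpsi.
have mphi := smooth_measurable sphi; have mpsi := smooth_measurable spsi.
have mdphi := smooth_measurable (smooth_derive sphi).
have mdpsi := smooth_measurable (smooth_derive spsi).
rewrite (weak_derivative_ext Uphi) //; last by move=> x /(test_fun_out tpsi)[].
rewrite (weak_derivative_ext Vphi) //; last by move=> x /(test_fun_out tpsi)[].
have [M M0 supp] := test_fun_bounded tpsi.
have out x : x \notin `[- M, M] -> psi x = 0 /\ derive1 psi x = 0.
  move=> xM; apply: supp; apply: contra xM; exact: subset_itv_oo_cc.
rewrite (@Rintegral_supp _ _ (- M) M); last by move=> x /out[_ ->]; rewrite mulr0.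
rewrite (@Rintegral_supp _ _ (- M) M); last by move=> x /out[-> _]; rewrite mulr0.
have sM : smooth (phi \* psi) by exact: smoothM.
have dM x : derive1 (phi \* psi) x = phi x * derive1 psi x + derive1 phi x * psi x.
  have [_ h] := is_deriveM (smooth_is_derive x sphi) (smooth_is_derive x spsi).
  by rewrite derive1E h /GRing.scale/= [psi x * _]mulrC.
have ci h : continuous h -> mu.-integrable `[- M, M] (EFin \o h).
  move=> ch; apply: continuous_compact_integrable; first exact: segment_compact.
  exact: continuous_subspaceT.
have cphi := smooth_continuous sphi; have cpsi := smooth_continuous spsi.
have cdphi := smooth_continuous (smooth_derive sphi).
have cdpsi := smooth_continuous (smooth_derive spsi).
apply/eqP; rewrite -addr_eq0 -RintegralD//; last 2 first.
- by apply: ci => x; exact: cvgM (cphi x) (cdpsi x).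
- by apply: ci => x; exact: cvgM (cdphi x) (cpsi x).
have -> : \int[mu]_(x in `[- M, M])
    (phi x * derive1 psi x + derive1 phi x * psi x) =
    \int[mu]_(x in `[- M, M]) derive1 (phi \* psi) x.
  by apply: eq_Rintegral => x _; rewrite dM.
rewrite smooth_FTC//; last by rewrite lerNl (le_trans _ (ltW M0))// oppr_le0 ltW.
have endpoint x : x \notin `](- M), M[ -> (phi \* psi) x = 0.
  by move=> /supp[h _]; rewrite /= h mulr0.
by rewrite !endpoint ?subrr// in_itv/= ltxx ?andbF.
Qed.

Lemma weak_deriv_linear (c : R) (u u' v v' : L2 i) :
  weak_deriv u u' -> weak_deriv v v' -> weak_deriv (c *: u + v) (c *: u' + v').
Proof.
move=> /weak_derivP uu /weak_derivP vv; apply/weak_derivP => phi tphi.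
have sphi := test_fun_smooth tphi.
have mphi := smooth_measurable sphi.
have mdphi := smooth_measurable (smooth_derive sphi).
have [sq1 sq2] := sq_integrable_test_fun tphi.
have lin (w z : L2 i) psi : sq_integrable psi ->
    \int[mu]_x (ext (c *: w + z) x * psi x) =
    c * \int[mu]_x (ext w x * psi x) + \int[mu]_x (ext z x * psi x).
  move=> spsi; have iw := sq_integrableM (sq_integrable_ext w) spsi.
  have iz := sq_integrableM (sq_integrable_ext z) spsi.
  transitivity (\int[mu]_x (c * (ext w x * psi x) + ext z x * psi x)).
    have [mw _] := sq_integrable_ext w; have [mz _] := sq_integrable_ext z.
    have [mwz _] := sq_integrable_ext (c *: w + z); have [mpsi _] := spsi.
    apply: Rintegral_ae_eq; first exact: measurable_funM.
      by apply: measurable_funD; do ?apply: measurable_funM.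
    apply: negligibleS (ext_linear c w z) => x /= nh hx; apply: nh.
    by rewrite hx; ring.
  rewrite RintegralD//; first by rewrite RintegralZl.
  by have := integrableZl measurableT c iw; exact: eq_integrable.
by rewrite !lin// uu// vv//; ring.
Qed.

End OpenInterval.
End Representatives.

(** * Projection onto the closure of a subspace *)

Section HilbertProjection.
Context {R : realType} {V : lmodType R}.
Variable B : V -> V -> R.
Hypothesis BC : forall x y, B x y = B y x.
Hypothesis Bl : forall a x y z, B (a *: x + y) z = a * B x z + B y z.
Hypothesis B_ge0 : forall x, 0 <= B x x.
Implicit Types (x y z k p : V).

Lemma form0l z : B 0 z = 0.
Proof. by have := Bl (-1) 0 0 z; rewrite scaler0 addr0 mulN1r addNr. Qed.

Lemma formDl x y z : B (x + y) z = B x z + B y z.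
Proof. by rewrite -[x in LHS]scale1r Bl mul1r. Qed.

Lemma formZl a x z : B (a *: x) z = a * B x z.
Proof. by rewrite -[a *: x]addr0 Bl form0l addr0. Qed.

Lemma formNl x z : B (- x) z = - B x z.
Proof. by rewrite -scaleN1r formZl mulN1r. Qed.

Lemma formBl x y z : B (x - y) z = B x z - B y z.
Proof. by rewrite formDl formNl. Qed.

Lemma formBr x y z : B z (x - y) = B z x - B z y.
Proof. by rewrite BC formBl !(BC _ z). Qed.

Lemma formDr x y z : B z (x + y) = B z x + B z y.
Proof. by rewrite BC formDl !(BC _ z). Qed.

Lemma formZr a x z : B z (a *: x) = a * B z x.
Proof. by rewrite BC formZl (BC _ z). Qed.

Lemma formNr x z : B z (- x) = - B z x.
Proof. by rewrite BC formNl (BC _ z). Qed.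

Lemma form_sqrB x y : B (x - y) (x - y) = B x x - 2 * B x y + B y y.
Proof. by rewrite formBl !formBr (BC y x); ring. Qed.

Lemma form_cauchy_schwarz x y : (B x y) ^+ 2 <= B x x * B y y.
Proof.
have h t : 0 <= B x x - 2 * t * B x y + t ^+ 2 * B y y.
  by have := B_ge0 (x - t *: y); rewrite form_sqrB !formZr formZl => h;
    apply: le_trans h _; rewrite le_eqVlt; apply/orP; left; apply/eqP; ring.
(* The form may be degenerate. If [B y y = 0], the quadratic in [t] is affine, and it stays
   nonnegative only with slope 0. *)
have [y0|y0] := eqVneq (B y y) 0.
  rewrite y0 mulr0; have [->|xy0] := eqVneq (B x y) 0; first by rewrite expr0n.
  have := h ((B x x + 1) / (2 * B x y)); rewrite y0 mulr0 addr0.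
  have -> : 2 * ((B x x + 1) / (2 * B x y)) * B x y = B x x + 1 by field.
  by rewrite opprD addrA subrr add0r ler0N1.
have yp : 0 < B y y by rewrite lt_neqAle eq_sym y0 B_ge0.
have := h (B x y / B y y).
have -> : B x x - 2 * (B x y / B y y) * B x y + (B x y / B y y) ^+ 2 * B y y =
    B x x - B x y ^+ 2 / B y y by field.
by rewrite subr_ge0 ler_pdivrMr.
Qed.

Variable K : set V.
Hypothesis K0 : K 0.
Hypothesis KZD : forall a x y, K x -> K y -> K (a *: x + y).

Definition form_closure : set V :=
  [set p | forall e : R, 0 < e -> exists2 k, K k & B (p - k) (p - k) < e].

Lemma form_closure_orthogonal p z : form_closure p ->
  (forall k, K k -> B z k = 0) -> B z p = 0.
Proof.
move=> Kp zK; apply/eqP; rewrite -sqrf_eq0; apply/negPn/negP => zp0.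
have {}zp0 : 0 < B z p ^+ 2 by rewrite lt_neqAle eq_sym zp0 sqr_ge0.
have z1 : 0 < B z z + 1 by rewrite ltr_wpDl.
have [k kK kp] := Kp (B z p ^+ 2 / (B z z + 1)) (divr_gt0 zp0 z1).
have := form_cauchy_schwarz z (p - k); rewrite formBr (zK k kK) subr0 leNgt => /negP; apply.
rewrite ltr_pdivlMr// mulrC in kp; apply: le_lt_trans kp.
by rewrite ler_wpM2r// lerDl.
Qed.

(* The rate [16 ^- n] is the one for which [sq_integrable_complete] is stated. *)
Hypothesis complete : forall s : nat -> V,
  (forall n m, (n <= m)%N -> B (s m - s n) (s m - s n) <= 16 ^- n) ->
  exists p, forall e : R, 0 < e ->
    exists N, forall n, (N <= n)%N -> B (p - s n) (p - s n) < e.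

(** A minimising sequence in [K] is Cauchy by the parallelogram law, and its remainders are nearly
    orthogonal to each [k] in [K], a property that passes to the limit. *)
Lemma form_projection x : exists2 p, form_closure p &
  forall k, K k -> B (x - p) k = 0.
Proof.
have arith1 (a b c u w d : R) : a < d + u -> b < d + w -> w <= u ->
    d <= 2^-1 * a + 2^-1 * b - 4^-1 * c -> c <= 4 * u by lra.
have arith2 (a b c u d : R) : b <= c -> a < d + u -> d <= a - 2 * c + b -> c <= u.
  by lra.
pose D := [set r : R | exists2 k, K k & r = B (x - k) (x - k)].
have D0 : D !=set0 by exists (B (x - 0) (x - 0)); exists 0.
have lbD : lbound D 0 by move=> _ [k _ ->].
have infD : has_inf D by split => //; exists 0.
pose d := inf D.
have dK k : K k -> d <= B (x - k) (x - k).
  by move=> kK; apply: ge_inf; [exists 0|exists k].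
(* The parallelogram law turns an excess [dl n] over the infimum into a squared distance of at most
   [4 * dl n], which is the rate required by [complete]. *)
pose dl n : R := 16 ^- n / 4.
have dl0 n : 0 < dl n by rewrite divr_gt0// invr_gt0 exprn_gt0.
have dlS n m : (n <= m)%N -> dl m <= dl n.
  move=> nm; rewrite ler_pM2r// lef_pV2 ?posrE ?exprn_gt0//.
  by apply: ler_weXn2l => //; rewrite ler1n.
have /choice[s sP] : forall n, exists k, K k /\ B (x - k) (x - k) < d + dl n.
  move=> n; have [_ [k kK ->] kd] := inf_adherent (dl0 n) infD.
  by exists k.
have [p pP] : exists p, forall e : R, 0 < e ->
    exists N, forall n, (N <= n)%N -> B (p - s n) (p - s n) < e.
  apply: complete => n m nm.
  have [[Kn dn] [Km dm]] := (sP n, sP m).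
  have Kmid : K (2^-1 *: (s n + s m)).
    have h : K (2^-1 *: s n + (2^-1 *: s m + 0)) by do ?apply: KZD.
    by rewrite scalerDr -[2^-1 *: s m]addr0.
  have := dK _ Kmid.
  have -> : B (x - 2^-1 *: (s n + s m)) (x - 2^-1 *: (s n + s m)) =
    2^-1 * B (x - s n) (x - s n) + 2^-1 * B (x - s m) (x - s m)
      - 4^-1 * B (s m - s n) (s m - s n).
    rewrite !form_sqrB !formZr !formZl !formDr !formDl (BC (s m) (s n)).
    by field.
  have hS := dlS _ _ nm.
  have -> : 16 ^- n = 4 * dl n by rewrite /dl; field; rewrite expf_neq0.
  exact: arith1 dn dm hS.
exists p.
  by move=> e e0; have [N hN] := pP e e0; exists (s N); [case: (sP N)|exact: hN].
move=> k kK; apply/eqP; rewrite -sqrf_eq0; apply/negPn/negP => b0.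
have {}b0 : 0 < B (x - p) k ^+ 2 by rewrite lt_neqAle eq_sym b0 sqr_ge0.
pose Q := B k k + 1.
have Q1 : 1 <= Q by rewrite lerDr.
have Q0 : 0 < Q by exact: lt_le_trans Q1.
have e0 : 0 < B (x - p) k ^+ 2 / (4 * Q) by rewrite divr_gt0// mulr_gt0.
have near_orth n : B (x - s n) k ^+ 2 <= dl n * Q.
  have [Kn dn] := sP n.
  (* Moving [s n] along [k] by the optimal step, with [Q] in place of the possibly zero [B k k],
     lowers the squared distance by at least [B (x - s n) k ^ 2 / Q], while a near-minimiser leaves
     room for [dl n] only. *)
  have Kt : K ((B (x - s n) k / Q) *: k + s n) by exact: KZD.
  have := dK _ Kt; rewrite opprD addrCA addrC form_sqrB !formZr !formZl => h.
  have : B (x - s n) k ^+ 2 / Q <= dl n.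
    have h2 : B (x - s n) k ^+ 2 * (B k k / Q ^+ 2) <= B (x - s n) k ^+ 2 / Q.
      rewrite ler_wpM2l ?sqr_ge0// ler_pdivrMr ?exprn_gt0// expr2 mulKf ?gt_eqF//.
      by rewrite /Q lerDl.
    move: h; rewrite (_ : _ / Q * (_ / Q * _) = B (x - s n) k ^+ 2 * (B k k / Q ^+ 2));
      last by field; rewrite gt_eqF.
    rewrite (_ : 2 * _ = 2 * (B (x - s n) k ^+ 2 / Q)); last by rewrite expr2; ring.
    exact: arith2 h2 dn.
  by rewrite ler_pdivrMr.
have [N hN] := pP _ e0.
have [N' hN'] : exists N', forall n, (N' <= n)%N -> dl n < B (x - p) k ^+ 2 / (4 * Q).
  pose c := (B (x - p) k ^+ 2 / (4 * Q))^-1.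
  have c0 : 0 <= c by rewrite invr_ge0 ltW.
  exists (Num.bound c) => n nc; apply: le_lt_trans (dlS _ _ nc) _.
  rewrite /dl -[ltRHS]invrK -/c; apply: (@lt_le_trans _ _ (16 ^- Num.bound c)).
    by rewrite gtr_pMr ?invr_gt0 ?exprn_gt0// invf_lt1 ?ltr1n.
  rewrite lef_pV2 ?posrE ?exprn_gt0 ?invr_gt0//.
  apply: le_trans (ltW (archi_boundP c0)) _; rewrite -natrX ler_nat.
  by apply/ltnW/ltn_expl.
pose n := maxn N N'.
have h1 := hN n (leq_maxl _ _); have h2 := hN' n (leq_maxr _ _).
have h3 := near_orth n.
have h4 := form_cauchy_schwarz (p - s n) k.
have hB : B (x - p) k = B (x - s n) k - B (p - s n) k.
  by rewrite !formBl; ring.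
have h5 : B (x - s n) k ^+ 2 < B (x - p) k ^+ 2 / 4.
  apply: le_lt_trans h3 _; rewrite -ltr_pdivlMr//.
  by move: h2; rewrite invfM mulrA.
have h6 : B (p - s n) k ^+ 2 < B (x - p) k ^+ 2 / 4.
  apply: le_lt_trans h4 _; apply: (@le_lt_trans _ _ (B (p - s n) (p - s n) * Q)).
    by rewrite ler_wpM2l// lerDl.
  by rewrite -ltr_pdivlMr//; move: h1; rewrite invfM mulrA.
(* Both [u ^ 2] and [v ^ 2] lie below a quarter of [(u - v) ^ 2], against
   [(u - v) ^ 2 <= 2 u ^ 2 + 2 v ^ 2]. *)
rewrite hB in h5 h6; move: (B (x - s n) k) (B (p - s n) k) h5 h6 => u v h5 h6.
have := sqr_ge0 (u + v); rewrite !expr2 in h5 h6 *; nra.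
Qed.

End HilbertProjection.

(** * Completeness of L^2 *)

Section RieszFischer.
Context {R : realType}.
Local Notation mu := (@lebesgue_measure R).

Lemma limn_einf_le (u : nat -> \bar R) (c : \bar R) :
  (forall n, u n <= c)%E -> (limn_einf u <= c)%E.
Proof.
move=> uc; rewrite limn_einf_lim; apply: lime_le; first exact: is_cvg_einfs.
apply: nearW => n; apply: le_trans (uc n).
by apply: ereal_inf_lbound; exists n => /=.
Qed.

Lemma cvg_geometric_bound (a : nat -> R) (C : R) :
  (forall n, `|a n| <= C * 2^-1 ^+ n) -> cvgn (series a).
Proof.
move=> aC; apply: normed_cvg; apply: (@series_le_cvg _ _ (geometric C 2^-1)) => //.
- by move=> n /=.
- by move=> n /=; apply: le_trans (aC n).
- by apply: is_cvg_geometric_series; rewrite ger0_norm// invf_lt1// ltr1n.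
Qed.

Lemma sum_geometric_le (N : nat) : \sum_(0 <= n < N) (4 ^- n : R) <= 2.
Proof.
suff : \sum_(0 <= n < N) (4 ^- n : R) <= 2 - 2 * 4 ^- N.
  by move/le_trans; apply; rewrite gerBl mulr_ge0// invr_ge0 exprn_ge0.
elim: N => [|N IH]; first by rewrite big_geq// expr0 invr1; lra.
rewrite big_nat_recr//= exprS invfM.
have p0 : 0 <= (4 ^- N : R) by rewrite invr_ge0 exprn_ge0.
by move: (4 ^- N : R) (\sum_(_ <= _ < _) _) p0 IH => p s p0 IH; lra.
Qed.

(* [\sum_n 4^n |f_(n+1) - f_n|^2] is integrable, hence finite almost
   everywhere, and where it is finite the increments decay like [2^-n]. *)
Lemma sq_integrable_complete (f : nat -> R -> R) :
  (forall n, sq_integrable (f n)) ->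
  (forall n m, (n <= m)%N -> \int[mu]_x (f m x - f n x) ^+ 2 <= 16 ^- n) ->
  exists2 g, sq_integrable g &
    forall n, \int[mu]_x (g x - f n x) ^+ 2 <= 16 ^- n.
Proof.
move=> sf fC; have mf n : measurable_fun setT (f n) by case: (sf n).
have sB n m : sq_integrable (fun x => f m x - f n x).
  have := sq_integrableD (sf m) (sq_integrableZ (-1) (sf n)).
  by congr sq_integrable; apply/funext => x; rewrite mulN1r.
have intE n m : (\int[mu]_x ((f m x - f n x) ^+ 2)%:E =
    (\int[mu]_x (f m x - f n x) ^+ 2)%:E)%E.
  by rewrite /Rintegral fineK//; case: (sB n m) => _ /integrable_fin_num; apply.
pose a n x : R := f n.+1 x - f n x.
pose t n x : \bar R := (4 ^+ n * a n x ^+ 2)%:E.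
have mt n : measurable_fun setT (t n).
  apply/measurable_EFinP; apply: measurable_funM => //.
  by apply: measurable_funX; case: (sB n n.+1).
have t0 n x : (0 <= t n x)%E.
  by rewrite lee_fin; apply: mulr_ge0; [exact: exprn_ge0|exact: sqr_ge0].
pose G x : \bar R := (\sum_(n <oo) t n x)%E.
have mG : measurable_fun setT G.
  by apply: ge0_emeasurable_sum => // n x _ _; exact: t0.
have G0 x : (0 <= G x)%E by apply: nneseries_ge0 => n _ _; exact: t0.
have intt n : (\int[mu]_x t n x <= (4 ^- n)%:E)%E.
  have -> : (\int[mu]_x t n x =
      (4 ^+ n)%:E * \int[mu]_x ((f n.+1 x - f n x) ^+ 2)%:E)%E.
    rewrite -ge0_integralZl//.
    - by apply/measurable_EFinP; apply: measurable_funX; case: (sB n n.+1).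
    - by move=> x _; rewrite lee_fin sqr_ge0.
  rewrite intE -EFinM lee_fin.
  (* The rate 16 leaves room for the weight [4 ^ n]: the weighted integrals are still summable. *)
  have -> : 4 ^- n = 4 ^+ n * 16 ^- n :> R.
    have -> : 16 ^+ n = 4 ^+ n * 4 ^+ n :> R.
      by rewrite -exprMn; congr (_ ^+ _); rewrite -natrM.
    by field; rewrite expf_neq0.
  by rewrite ler_wpM2l ?exprn_ge0//; exact: fC.
have intG : mu.-integrable setT G.
  apply/integrableP; split => //.
  under eq_integral do rewrite gee0_abs//.
  rewrite integral_nneseries//; apply: (@le_lt_trans _ _ 2%:E); last exact: ltry.
  apply: lime_le.
    by apply: is_cvg_nneseries => n _ _; apply: integral_ge0 => x _; exact: t0.
  apply: nearW => N; apply: (@le_trans _ _ (\sum_(0 <= n < N) (4 ^- n)%:E)%E).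
    by apply: lee_sum => n _; exact: intt.
  by rewrite sumEFin lee_fin sum_geometric_le.
have [A [mA A0 sA]] := integrable_ae measurableT intG.
(* Cutting off the null set [A], outside of which [G] is finite, makes the sequence converge at
   every point. *)
pose g0 n x : R := f n x * \1_(~` A) x.
have g0E n x : ~ A x -> g0 n x = f n x.
  by move=> Ax; rewrite /g0 indicE mem_set// mulr1.
have g00 n x : A x -> g0 n x = 0.
  by move=> Ax; rewrite /g0 indicE memNset ?mulr0//; apply.
have mg0 n : measurable_fun setT (g0 n).
  by apply: measurable_funM => //; apply: measurable_indic; exact: measurableC.
have cg0 x : cvgn (g0 ^~ x).
  have [Ax|Ax] := pselect (A x).
    have -> : g0 ^~ x = cst 0 by apply/funext => n; exact: g00.
    exact: is_cvg_cst.
  have Gfin : G x \is a fin_num.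
    apply: contrapT => nG; apply: Ax; apply: sA => /= h; apply: nG; exact: h.
  have -> : g0 ^~ x = (fun n => f 0%N x + series (a ^~ x) n).
    apply/funext => n; rewrite g0E// (eq_sum_telescope (f ^~ x) n).
    by [].
  apply: is_cvgD; first exact: is_cvg_cst.
  (* The bound [4 ^ n * a n x ^ 2 <= G x] gives a decay of [sqrt (G x) / 2 ^ n]; the constant
     [G x + 1] dominates the square root. *)
  apply: (@cvg_geometric_bound _ (fine (G x) + 1)) => n.
  have Gx0 : 0 <= fine (G x) by rewrite fine_ge0.
  have h : 4 ^+ n * a n x ^+ 2 <= fine (G x).
    rewrite -lee_fin fineK//.
    apply: le_trans (@nneseries_lim_ge _ (t ^~ x) xpredT 0%N n.+1 _).
      by rewrite big_nat_recr//= leeDr// sume_ge0.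
    by move=> k _ _; exact: t0.
  rewrite -(@ler_pXn2r _ 2) ?nnegrE//; last first.
    by rewrite mulr_ge0 ?exprn_ge0// addr_ge0.
  rewrite real_normK ?num_real// exprMn -exprM mulnC exprM.
  have -> : (2^-1 ^+ 2) ^+ n = 4 ^- n :> R.
    by rewrite -exprVn; congr (_ ^+ _); field.
  rewrite -(@ler_pM2l _ (4 ^+ n)) ?exprn_gt0//; apply: le_trans h _.
  rewrite mulrCA divff ?expf_neq0// mulr1 expr2.
  by have := Gx0; move: (fine (G x)) => s s0; nra.
pose g x : R := limn (g0 ^~ x).
have g0g x : g0 n x @[n --> \oo] --> g x by exact: cg0.
have mg : measurable_fun setT g.
  by apply: (@measurable_fun_cvg _ _ _ _ g0) => // x _; exact: g0g.
(* Fatou's lemma along the tail [f (n + m)] carries the Cauchy bound over to the limit. *)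
have key n : (\int[mu]_x ((g x - f n x) ^+ 2)%:E <= (16 ^- n)%:E)%E.
  pose F m x : \bar R := ((g0 (n + m)%N x - f n x) ^+ 2)%:E.
  have mF m : measurable_fun setT (F m).
    by apply/measurable_EFinP; apply: measurable_funX; apply: measurable_funB.
  have F0 m x : (0 <= F m x)%E by rewrite lee_fin sqr_ge0.
  have -> : (\int[mu]_x ((g x - f n x) ^+ 2)%:E =
             \int[mu]_x limn_einf (F ^~ x))%E.
    apply: eq_integral => x _; apply/esym.
    have cF : F m x @[m --> \oo] --> ((g x - f n x) ^+ 2)%:E.
      apply: cvg_EFin; first by apply: nearW.
      have -> : fine \o F^~ x = (fun m => (g0 (n + m)%N x - f n x) *
          (g0 (n + m)%N x - f n x)) by apply/funext => m; rewrite /= expr2.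
      rewrite expr2.
      have h : (g0 (n + m)%N x - f n x) @[m --> \oo] --> g x - f n x.
        apply: cvgB; last exact: cvg_cst.
        have := g0g x; rewrite -(cvg_shiftn n) => h.
        by under eq_fun do rewrite addnC.
      exact: cvgM.
    by have [] := cvg_limn_einf_sup cF.
  apply: le_trans (fatou mu measurableT mF (fun m x _ => F0 m x)) _.
  apply: limn_einf_le => m.
  have -> : (\int[mu]_x F m x = \int[mu]_x ((f (n + m)%N x - f n x) ^+ 2)%:E)%E.
    apply: ae_eq_integral => //; first exact: mF.
      by apply/measurable_EFinP; apply: measurable_funX; case: (sB n (n + m)%N).
    exists A; split => // x nx; apply: contrapT => Ax; apply: nx => _.
    by rewrite /F g0E.
  by rewrite intE lee_fin; apply: fC; rewrite leq_addr.
have sgf : sq_integrable (fun x => g x - f 0%N x).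
  have mgf : measurable_fun setT (fun x => g x - f 0%N x) by exact: measurable_funB.
  split => //; apply/integrableP; split.
    by apply/measurable_EFinP; exact: measurable_funX.
  under eq_integral do rewrite gee0_abs ?lee_fin ?sqr_ge0//.
  exact: le_lt_trans (key 0%N) (ltry _).
exists g.
  have := sq_integrableD sgf (sf 0%N).
  by congr sq_integrable; apply/funext => x; rewrite subrK.
move=> n; rewrite -lee_fin /Rintegral fineK//.
rewrite ge0_fin_numE; last by apply: integral_ge0 => x _; rewrite lee_fin sqr_ge0.
exact: le_lt_trans (key n) (ltry _).
Qed.

Lemma dotL2_sqrB (i : interval R) (u v : L2 i) :
  dotL2 (u - v) (u - v) = \int[mu]_x (ext u x - ext v x) ^+ 2.
Proof.
have suv := sq_integrable_ext (u - v).
have [mu' _] := sq_integrable_ext u; have [mv _] := sq_integrable_ext v.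
rewrite dotL2E; apply: Rintegral_ae_eq.
- by apply: measurable_funM; case: suv.
- by apply: measurable_funX; exact: measurable_funB.
- have := ext_linear (-1) v u; rewrite scaleN1r addrC.
  by apply: negligibleS => x /= nh h; apply: nh; rewrite h; ring.
Qed.

Lemma L2_complete (i : interval R) (s : nat -> L2 i) :
  (forall n m, (n <= m)%N -> dotL2 (s m - s n) (s m - s n) <= 16 ^- n) ->
  exists p, forall n, dotL2 (p - s n) (p - s n) <= 16 ^- n.
Proof.
move=> sC.
have [g sg gP] := @sq_integrable_complete (fun n => ext (s n))
  (fun n => sq_integrable_ext (s n))
  (fun n m nm => le_trans (eq_ind_r (fun r => r <= _) (lexx _) (esym (dotL2_sqrB _ _)))
     (sC n m nm)).
exists (L2_of i sg) => n; rewrite dotL2_sqrB; apply: le_trans (gP n).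
have [mg _] := sg; have [ms _] := sq_integrable_ext (s n).
have [mL _] := sq_integrable_ext (L2_of i sg).
have sgs : sq_integrable (fun x => g x - ext (s n) x).
  have := sq_integrableD sg (sq_integrableZ (-1) (sq_integrable_ext (s n))).
  by congr sq_integrable; apply/funext => x; rewrite mulN1r.
(* The limit [g] may be nonzero off [i]; restricting it to [i] only decreases its distance to
   functions supported in [i]. *)
pose h x := (g x - ext (s n) x) * \1_[set` i] x.
have mh : measurable_fun setT h.
  by apply: measurable_funM; [exact: measurable_funB|exact: measurable_indic].
have -> : \int[mu]_x (ext (L2_of i sg) x - ext (s n) x) ^+ 2 =
          \int[mu]_x (h x) ^+ 2.
  apply: Rintegral_ae_eq; try by apply: measurable_funX => //; exact: measurable_funB.
  apply: negligibleS (L2_ofE i sg) => x /= nh hx; apply: nh; rewrite /h indicE.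
  have [xi|xi] := boolP (x \in i).
    by rewrite mem_set// mulr1 [ext (L2_of i sg) x]ext_in// hx.
  rewrite !(ext_out _ xi) memNset ?mulr0 ?subr0//=; exact/negP.
have hle x : h x ^+ 2 <= (g x - ext (s n) x) ^+ 2.
  rewrite /h indicE; case: (x \in _); first by rewrite mulr1.
  by rewrite mulr0 expr0n sqr_ge0.
case: sgs => _ is2; apply: le_Rintegral => //.
apply: integrable_le is2 _ => //; first exact: measurable_funX.
by move=> x _; rewrite ger0_norm ?sqr_ge0.
Qed.

End RieszFischer.

(** * The closure of the test functions in H^1 *)

Section Pairs.
Context {R : realType}.
Local Notation mu := (@lebesgue_measure R).
Variables (i : interval R) (a0 b0 : R).
Hypotheses (oi : open [set` i]) (ab0 : a0 < b0)
  (sub0 : [set` `]a0, b0[] `<=` [set` i]).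
Local Notation V := (L2 i * L2 i)%type.
Implicit Types (phi psi : R -> R) (u v w : L2 i) (x y z : V).

Lemma test_fun_linear (a : R) phi psi : test_fun i phi -> test_fun i psi ->
  test_fun i (fun t => a * phi t + psi t).
Proof.
move=> tphi tpsi; have [sphi cphi iphi] := tphi; have [spsi cpsi ipsi] := tpsi.
have sub : closure [set t | a * phi t + psi t != 0] `<=`
    closure [set t | phi t != 0] `|` closure [set t | psi t != 0].
  rewrite -closureU; apply: closure_subset => t /=; apply: contraNP.
  by move=> /not_orP[/negP/negPn/eqP -> /negP/negPn/eqP ->]; rewrite mulr0 addr0.
split.
- exact: (smoothD (smoothM (@smooth_cst _ a) sphi) spsi).
- apply: (subclosed_compact _ (compactU cphi cpsi) sub).
  exact: closed_closure.
- by move=> t /sub[/iphi|/ipsi].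
Qed.

Lemma test_fun0 : test_fun i (cst 0).
Proof.
have e0 : [set t : R | (cst 0 t : R) != 0] = set0.
  by apply/seteqP; split => t //=; rewrite eqxx.
split; first exact: smooth_cst.
- by rewrite e0 closure0; exact: compact0.
- by rewrite e0 closure0.
Qed.

(** The H^1 inner product on pairs [(u, u')]. Taken on all pairs, it inherits completeness directly
    from L^2. *)
Definition pair_dot x y := dotL2 x.1 y.1 + dotL2 x.2 y.2.

Lemma pair_dotC x y : pair_dot x y = pair_dot y x.
Proof. by rewrite /pair_dot dotL2C (dotL2C x.2). Qed.

Lemma pair_dot_linear (a : R) x y z :
  pair_dot (a *: x + y) z = a * pair_dot x z + pair_dot y z.
Proof. by rewrite /pair_dot !dotL2_linear; ring. Qed.

Lemma pair_dot_ge0 x : 0 <= pair_dot x x.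
Proof. by rewrite addr_ge0// dotL2_ge0. Qed.

Lemma pair_dot_eq0 x : pair_dot x x = 0 -> x = 0.
Proof.
move=> /eqP; rewrite paddr_eq0 ?dotL2_ge0// => /andP[/eqP h1 /eqP h2].
by case: x h1 h2 => u v /= /dotL2_eq0 -> /dotL2_eq0 ->.
Qed.

Lemma pair_dot_complete (s : nat -> V) :
  (forall n m, (n <= m)%N -> pair_dot (s m - s n) (s m - s n) <= 16 ^- n) ->
  exists p, forall e : R, 0 < e ->
    exists N, forall n, (N <= n)%N -> pair_dot (p - s n) (p - s n) < e.
Proof.
move=> sC.
have [p1 p1P] : exists p, forall n, dotL2 (p - (s n).1) (p - (s n).1) <= 16 ^- n.
  apply: L2_complete => n m nm; apply: le_trans (sC n m nm).
  by rewrite /pair_dot /= lerDl dotL2_ge0.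
have [p2 p2P] : exists p, forall n, dotL2 (p - (s n).2) (p - (s n).2) <= 16 ^- n.
  apply: L2_complete => n m nm; apply: le_trans (sC n m nm).
  by rewrite /pair_dot /= lerDr dotL2_ge0.
exists (p1, p2) => e e0.
pose c := (e / 2)^-1.
have c0 : 0 <= c by rewrite invr_ge0 divr_ge0// ltW.
exists (Num.bound c) => n cn; rewrite /pair_dot /=.
suff h : (16 ^- n : R) < e / 2.
  rewrite (splitr e); apply: ltrD; [apply: le_lt_trans (p1P n) h|].
  exact: le_lt_trans (p2P n) h.
rewrite -[ltRHS]invrK -/c ltf_pV2 ?posrE ?exprn_gt0 ?invr_gt0 ?divr_gt0//.
apply: lt_le_trans (archi_boundP c0) _; rewrite -natrX ler_nat.
apply: leq_trans cn _; exact/ltnW/ltn_expl.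
Qed.

Definition test_pairs : set V := [set x : V | exists2 phi, test_fun i phi &
  {ae mu, forall t, t \in i -> L2_fun x.1 t = phi t} /\
  {ae mu, forall t, t \in i -> L2_fun x.2 t = derive1 phi t}].

Lemma test_pairs_of phi : test_fun i phi -> exists2 x, test_pairs x &
  {ae mu, forall t, t \in i -> x.1 t = phi t} /\
  {ae mu, forall t, t \in i -> x.2 t = derive1 phi t}.
Proof.
move=> tphi; have [s1 s2] := sq_integrable_test_fun tphi.
exists (L2_of i s1, L2_of i s2); last by split; exact: L2_ofE.
by exists phi => //; split; exact: L2_ofE.
Qed.

Lemma L2_linear_ae (a : R) u v f g :
  {ae mu, forall t, t \in i -> u t = f t} ->
  {ae mu, forall t, t \in i -> v t = g t} ->
  {ae mu, forall t, t \in i -> L2_fun (a *: u + v) t = a * f t + g t}.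
Proof.
move=> uf vg.
apply: negligibleS (negligibleU (negligibleU uf vg) (ext_linear a u v)) => t /= nh.
apply: contrapT => /not_orP[/not_orP[/contrapT h1 /contrapT h2] /contrapT h3].
by apply: nh => ti; move: h3; rewrite !ext_in// => ->; rewrite h1// h2.
Qed.

Lemma test_pairs_linear (a : R) x y :
  test_pairs x -> test_pairs y -> test_pairs (a *: x + y).
Proof.
move=> [phi tphi [p1 p2]] [psi tpsi [q1 q2]].
exists (fun t => a * phi t + psi t); first exact: test_fun_linear.
split; first exact: L2_linear_ae.
have -> : derive1 (fun t => a * phi t + psi t) =
    (fun t => a * derive1 phi t + derive1 psi t).
  apply/funext => t.
  have dphi := smooth_is_derive t (test_fun_smooth tphi).
  have dpsi := smooth_is_derive t (test_fun_smooth tpsi).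
  by rewrite derive1E; exact: (@derive_val _ _ _ _ _ _ _ (is_deriveD (is_deriveZ a dphi) dpsi)).
exact: L2_linear_ae.
Qed.

Lemma L2_0_ae : {ae mu, forall t, t \in i -> L2_fun (0 : L2 i) t = 0}.
Proof.
have := ext_linear (-1) (0 : L2 i) 0; rewrite scaler0 addr0.
apply: negligibleS => t /= nh h; apply: nh => ti; rewrite -ext_in// h.
by rewrite mulN1r addNr.
Qed.

Lemma test_pairs0 : test_pairs 0.
Proof.
exists (cst 0); first exact: test_fun0.
split; first exact: L2_0_ae.
have -> : derive1 (cst 0 : R -> R) = cst 0 by apply/funext => t; rewrite derive1_cst.
exact: L2_0_ae.
Qed.

Lemma pair_dot_distance u v x phi : test_fun i phi ->
  {ae mu, forall t, t \in i -> x.1 t = phi t} ->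
  {ae mu, forall t, t \in i -> x.2 t = derive1 phi t} ->
  (\int[lebesgue_on i]_t ((u t - phi t) ^+ 2 + (v t - derive1 phi t) ^+ 2)%:E =
   (pair_dot ((u, v) - x) ((u, v) - x))%:E)%E.
Proof.
move=> tphi x1 x2; rewrite /pair_dot/= !dotL2_sqrB.
have sphi := test_fun_smooth tphi.
have mphi := smooth_measurable sphi; have mdphi := smooth_measurable (smooth_derive sphi).
have sqB w w' : sq_integrable (fun t => ext w t - ext w' t).
  have := sq_integrableD (sq_integrable_ext w)
    (sq_integrableZ (-1) (sq_integrable_ext w')).
  by congr sq_integrable; apply/funext => t; rewrite mulN1r.
have [m1 i1] := sqB u x.1; have [m2 i2] := sqB v x.2.
have i12 : mu.-integrable setT (EFin \o (fun t =>
    (ext u t - ext x.1 t) ^+ 2 + (ext v t - ext x.2 t) ^+ 2)).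
  by have := integrableD measurableT i1 i2; exact: eq_integrable.
rewrite -RintegralD// /Rintegral fineK; last exact: (integrable_fin_num _ i12).
have mI : measurable_fun setT
    (fun t => ((u t - phi t) ^+ 2 + (v t - derive1 phi t) ^+ 2)%:E).
  apply/measurable_EFinP; apply: measurable_funD; apply: measurable_funX;
    apply: measurable_funB => //; exact: L2_measurable.
rewrite integral_lebesgue_on//; apply: ae_eq_integral => //.
- by apply/(measurable_restrictT _ _).1 => //; exact: measurable_funTS.
- exact: (measurable_int mu i12).
- apply: negligibleS (negligibleU x1 x2) => t /= nh.
  apply: contrapT => /not_orP[/contrapT h1 /contrapT h2]; apply: nh => _.
  rewrite patchE; have [ti|ti] := boolP (t \in i).
    by rewrite mem_set// !ext_in// h1// h2.
  rewrite memNset; last exact/negP.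
  by rewrite !(ext_out _ ti) subrr expr0n addr0.
Qed.

Lemma H10_closure u : H10 u <->
  exists2 v, weak_deriv u v & form_closure pair_dot test_pairs (u, v).
Proof.
split=> -[v uv h]; exists v => // e e0.
- have [phi tphi hphi] := h e e0.
  have [x Kx [x1 x2]] := test_pairs_of tphi; exists x => //.
  by rewrite -lte_fin -(pair_dot_distance u v tphi x1 x2).
- have [x [phi tphi [x1 x2]] hx] := h e e0; exists phi => //.
  by rewrite (pair_dot_distance u v tphi x1 x2) lte_fin.
Qed.

Lemma dotL2_ae u v f : {ae mu, forall t, t \in i -> v t = f t} ->
  measurable_fun setT f -> (forall t, t \notin i -> f t = 0) ->
  dotL2 u v = \int[mu]_t (ext u t * f t).
Proof.
move=> vf mf f0; have [mu' _] := sq_integrable_ext u.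
have [mv _] := sq_integrable_ext v.
rewrite dotL2E; apply: Rintegral_ae_eq; try exact: measurable_funM.
apply: negligibleS vf => t /= nh h; apply: nh.
have [ti|ti] := boolP (t \in i); first by rewrite [ext v t]ext_in// h.
by rewrite [ext v t]ext_out// f0.
Qed.

(** Orthogonality of [(v, u)] to [(phi, phi')] is the defining identity of the weak derivative. The
    swap of the components means that a pair orthogonal to all test pairs has a second component
    with the first as weak derivative. *)
Lemma test_pairs_orthogonal u v : weak_deriv u v <->
  forall k, test_pairs k -> pair_dot (v, u) k = 0.
Proof.
rewrite weak_derivP; split=> [uv k [phi tphi [k1 k2]]|uv phi tphi].
- have sphi := test_fun_smooth tphi.
  have mphi := smooth_measurable sphi; have mdphi := smooth_measurable (smooth_derive sphi).
  rewrite /pair_dot/= (dotL2_ae _ k1)//; last by move=> t /(test_fun_out tphi)[].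
  rewrite (dotL2_ae _ k2)//; last by move=> t /(test_fun_out tphi)[].
  by rewrite uv// subrr.
- have sphi := test_fun_smooth tphi.
  have mphi := smooth_measurable sphi; have mdphi := smooth_measurable (smooth_derive sphi).
  have [k Kk [k1 k2]] := test_pairs_of tphi.
  have := uv k Kk; rewrite /pair_dot/= (dotL2_ae _ k1)//; last by move=> t /(test_fun_out tphi)[].
  rewrite (dotL2_ae _ k2)//; last by move=> t /(test_fun_out tphi)[].
  by move=> /eqP; rewrite addr_eq0 => /eqP ->; rewrite opprK.
Qed.

(* Derivatives of test functions are test functions, so [v] also has weak
   derivative 0; hence it is a constant whose integral against every test
   function vanishes. *)
Lemma weak_deriv0_eq0 v : weak_deriv 0 v -> v = 0.
Proof.
move=> h0v.
have hv0 : weak_deriv v 0.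
  apply/weak_derivP => phi tphi; have tdphi : test_fun i (derive1 phi).
    have [s c sub] := tphi.
    have csub : closure [set t | derive1 phi t != 0] `<=`
        closure [set t | phi t != 0].
      rewrite [X in _ `<=` X]closureE => t ct B [cB subB]; move: ct.
      rewrite closureE; apply; split => // z /= dz; apply: contrapT => nBz.
      have nz : \near z, phi z = 0.
        have : open_nbhs z (~` B) by split => //; exact: closed_openC.
        move=> /open_nbhs_nbhs; apply: filterS => y nBy.
        apply/eqP; apply/negPn/negP => py; apply: nBy; exact: subB.
      by move: dz; rewrite (derive1_near_cst nz) eqxx.
    split; first exact: smooth_derive.
    - apply: (subclosed_compact _ c csub); exact: closed_closure.
    - exact: subset_trans sub.
  have /weak_derivP h := h0v.
  have e0 f : measurable_fun setT f -> \int[mu]_t (ext (0 : L2 i) t * f t) = 0.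
    move=> mf; transitivity (\int[mu]_t (0 : R)).
      apply: Rintegral_ae_eq => //.
        by apply: measurable_funM => //; case: (sq_integrable_ext (0 : L2 i)).
      apply: negligibleS L2_0_ae => t /= nh hh; apply: nh.
      have [ti|ti] := boolP (t \in i); first by rewrite ext_in// hh// mul0r.
      by rewrite ext_out// mul0r.
    by rewrite Rintegral_cst// mul0r.
  have sphi := test_fun_smooth tphi.
  rewrite e0 ?oppr0; last exact: smooth_measurable.
  have := h _ tdphi; rewrite e0; first by move/eqP; rewrite eq_sym oppr_eq0 => /eqP.
  by apply: smooth_measurable; do 2 apply: smooth_derive.
have [F [[cF vF] F0]] := weak_deriv_representative oi ab0 sub0 hv0.
have FC (x y : R) : x <= y -> F y = F x.
  move=> xy; apply/eqP; rewrite -subr_eq0 F0//; apply/eqP.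
  rewrite Rintegral_mkcond; transitivity (\int[mu]_t (0 : R)).
    apply: Rintegral_ae_eq => //.
      apply/(measurable_restrictT _ _).1 => //.
      by apply: measurable_funTS; case: (sq_integrable_ext (0 : L2 i)).
    apply: negligibleS L2_0_ae => t /= nh hh; apply: nh.
    rewrite patchE; case: ifP => // _.
    by have [ti|ti] := boolP (t \in i); [rewrite ext_in// hh|rewrite ext_out].
  by rewrite Rintegral_cst// mul0r.
have {}FC (x : R) : F x = F 0.
  by have [|/ltW] := leP 0 x => /FC.
(* The plateau below is supported in [[a0 + e/2, b0 - e/2]] and equals 1 on [[a0 + e, b0 - e]], an
   interval of length [e], so its integral is positive. *)
have ab := ab0; pose e := (b0 - a0) / 3.
have e0 : 0 < e by rewrite divr_gt0// subr_gt0.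
have ae1 : a0 + e < b0 - e by rewrite /e; lra.
have ae2 : a0 + e + e <= b0 - e by rewrite /e; lra.
have tp : test_fun i (plateau (a0 + e / 2) (b0 - e) (e / 2)).
  apply: (@smooth_test_fun _ _ _ (a0 + e / 2) (b0 - e + e / 2)).
  - exact: smooth_plateau.
  - by move=> x; apply: plateau_out; lra.
  - by move=> x; rewrite in_itv/= => xab; apply: sub0; rewrite /= in_itv/=; lra.
have /weak_derivP/(_ _ tp) := h0v.
set phi := plateau _ _ _ in tp *.
have mphi := smooth_measurable (test_fun_smooth tp).
have mdphi := smooth_measurable (smooth_derive (test_fun_smooth tp)).
rewrite (@weak_derivative_ext _ _ _ (fun=> 0) _ L2_0_ae)//; last first.
  by move=> x /(test_fun_out tp)[].
rewrite (@weak_derivative_ext _ _ _ (fun=> F 0))//; last 2 first.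
- by apply: negligibleS vF => t /= nh hh; apply: nh => ti; rewrite hh// FC.
- by move=> x /(test_fun_out tp)[].
rewrite (_ : \int[mu]_x (0 * derive1 phi x) = 0); last first.
  transitivity (\int[mu]_t (0 : R)); last by rewrite Rintegral_cst// mul0r.
  by apply: eq_Rintegral => t _; rewrite mul0r.
have iphi : mu.-integrable `[a0 + e / 2, b0 - e + e / 2] (EFin \o phi).
  by apply: sq_integrable_itv; have [] := sq_integrable_test_fun tp.
rewrite (@Rintegral_supp _ _ (a0 + e / 2) (b0 - e + e / 2)); last first.
  by move=> x xab; rewrite /phi plateau_out ?mulr0//; lra.
rewrite RintegralZl// => /eqP; rewrite eq_sym oppr_eq0 mulf_eq0 => /orP[/eqP F00|/eqP I0].
  apply/L2_eqP; apply: negligibleS (negligibleU vF L2_0_ae) => t /= nh.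
  apply: contrapT => /not_orP[/contrapT h1 /contrapT h2].
  by apply: nh => ti; rewrite h1// h2// FC F00.
have phi_ge0 t : 0 <= phi t.
  rewrite /phi /plateau; have [tb|tb] := leP t (b0 - e).
    by rewrite (@ramp_le _ (b0 - e))// ?subr0 ?ramp_ge0//; lra.
  by rewrite (@ramp_ge _ (a0 + e / 2))// ?subr_ge0 ?ramp_le1//; lra.
have : \int[mu]_(t in `[a0 + e, b0 - e]) (1 : R) <= 0.
  rewrite -I0; apply: (@le_trans _ _ (\int[mu]_(t in `[a0 + e, b0 - e]) phi t)).
    apply: le_Rintegral => //.
    - exact: sq_integrable_cst_itv.
    - by apply: sq_integrable_itv; have [] := sq_integrable_test_fun tp.
    - move=> t /=; rewrite in_itv/= => /andP[ta tb].
      by rewrite /phi plateau_eq1//; lra.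
  apply: Rintegral_itv_le => //; try by lra.
  by move=> x y; apply: sq_integrable_itv; have [] := sq_integrable_test_fun tp.
rewrite Rintegral_cst// [X in fine X](lebesgue_measure_itv `[a0 + e, b0 - e])/=.
by rewrite lte_fin ae1 -EFinD/= mul1r subr_le0 leNgt ae1.
Qed.

Lemma weak_deriv_unique u v w : weak_deriv u v -> weak_deriv u w -> v = w.
Proof.
move=> uv uw; have := weak_deriv_linear (-1) uw uv.
rewrite !scaleN1r addNr => /weak_deriv0_eq0/eqP.
by rewrite addrC subr_eq0 => /eqP.
Qed.

(* If [(z1, z2)] is the remainder of the H^1-projection of [(u, v)] onto the test
   functions, then [z2] has weak derivative [z1], so that Green's condition on
   [u], applied to [(z2, z1)], makes [(u, v)] orthogonal to [(z1, z2)]. *)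
Lemma H10P u v : weak_deriv u v ->
  (H10 u <-> forall w w', weak_deriv w w' -> dotL2 v w + dotL2 u w' = 0).
Proof.
move=> uv; rewrite H10_closure; split=> [[v' uv' cl] w w' ww'|green].
  rewrite (weak_deriv_unique uv uv').
  have := form_closure_orthogonal pair_dotC pair_dot_linear pair_dot_ge0 cl.
  move=> /(_ (w', w)) h.
  have := h (iffLR (test_pairs_orthogonal w w') ww').
  by rewrite pair_dotC /pair_dot/= addrC.
exists v => //.
have [[p1 p2] pcl orth] := form_projection pair_dotC pair_dot_linear pair_dot_ge0
  test_pairs0 test_pairs_linear pair_dot_complete (u, v).
set z := (u, v) - (p1, p2) in orth.
have zw : weak_deriv z.2 z.1.
  by apply/test_pairs_orthogonal => k; exact: orth.
have zp : pair_dot z (p1, p2) = 0.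
  have h := form_closure_orthogonal pair_dotC pair_dot_linear pair_dot_ge0 pcl.
  by apply: (h z) => k; exact: orth.
have zuv : pair_dot z (u, v) = 0.
  by rewrite pair_dotC /pair_dot/= addrC; exact: green.
have z0 : z = 0.
  apply: pair_dot_eq0.
  rewrite {2}/z (formBr pair_dotC pair_dot_linear).
  by rewrite zuv zp subr0.
by move/eqP: z0; rewrite subr_eq0 => /eqP ->.
Qed.

End Pairs.

(** * Contractions and boundary spaces *)

Section Contractions.
Context {R : realType}.

Definition vdot m (x y : 'cV[R]_m) : R := (x^T *m y) 0 0.

Lemma vdotE m (x y : 'cV[R]_m) : vdot x y = \sum_j x j 0 * y j 0.
Proof. by rewrite /vdot mxE; apply: eq_bigr => j _; rewrite mxE. Qed.

Lemma vdotC m (x y : 'cV[R]_m) : vdot x y = vdot y x.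
Proof. by rewrite !vdotE; apply: eq_bigr => j _; rewrite mulrC. Qed.

Lemma vdot_linear m (a : R) (x y z : 'cV[R]_m) :
  vdot (a *: x + y) z = a * vdot x z + vdot y z.
Proof.
rewrite !vdotE mulr_sumr -big_split/=; apply: eq_bigr => j _.
by rewrite !mxE; ring.
Qed.

Lemma vdot0l m (x : 'cV[R]_m) : vdot 0 x = 0.
Proof. exact: form0l (@vdot_linear m) _. Qed.

Lemma vdotDl m (x y z : 'cV[R]_m) : vdot (x + y) z = vdot x z + vdot y z.
Proof. exact: formDl (@vdot_linear m) _ _ _. Qed.

Lemma vdotDr m (x y z : 'cV[R]_m) : vdot x (y + z) = vdot x y + vdot x z.
Proof. exact: formDr (@vdotC m) (@vdot_linear m) _ _ _. Qed.

Lemma vdotNl m (x y : 'cV[R]_m) : vdot (- x) y = - vdot x y.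
Proof. exact: formNl (@vdot_linear m) _ _. Qed.

Lemma vdotNr m (x y : 'cV[R]_m) : vdot x (- y) = - vdot x y.
Proof. exact: formNr (@vdotC m) (@vdot_linear m) _ _. Qed.

Lemma vdot_ge0 m (x : 'cV[R]_m) : 0 <= vdot x x.
Proof. by rewrite vdotE; apply: sumr_ge0 => j _; rewrite -expr2 sqr_ge0. Qed.

Lemma vdot_eq0 m (x : 'cV[R]_m) : vdot x x = 0 -> x = 0.
Proof.
rewrite vdotE => /eqP; rewrite psumr_eq0; last first.
  by move=> j _; rewrite -expr2 sqr_ge0.
move=> /allP h; apply/matrixP => j k; rewrite ord1 !mxE.
have := h j (mem_index_enum _); rewrite /= -expr2 sqrf_eq0.
by move/eqP.
Qed.

Lemma vdot_mulmx m k (A : 'M[R]_(m, k)) x y : vdot (A *m x) y = vdot x (A^T *m y).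
Proof. by rewrite /vdot trmx_mul -mulmxA. Qed.

Lemma psd_gramP m k (M : 'M[R]_(m, k)) :
  psd (1%:M - M^T *m M) <-> forall x, vdot (M *m x) (M *m x) <= vdot x x.
Proof.
have E x : (x^T *m (1%:M - M^T *m M) *m x) 0 0 = vdot x x - vdot (M *m x) (M *m x).
  rewrite -mulmxA -/(vdot x _) mulmxBl mul1mx.
  by rewrite (formBr (@vdotC k) (@vdot_linear k)) vdot_mulmx mulmxA.
by split=> h x; have := h x; rewrite E subr_ge0.
Qed.

(** Expanding [|y - M M^T y|^2 >= 0] and bounding [|M M^T y|] by [|M^T y|] leaves
    [|y|^2 - |M^T y|^2 >= 0]. *)
Lemma contraction_tr m k (M : 'M[R]_(m, k)) :
  (forall x, vdot (M *m x) (M *m x) <= vdot x x) ->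
  forall y, vdot (M^T *m y) (M^T *m y) <= vdot y y.
Proof.
move=> cM y; have h := cM (M^T *m y).
have := vdot_ge0 (y - M *m (M^T *m y)).
rewrite (form_sqrB (@vdotC m) (@vdot_linear m)).
rewrite [vdot y (M *m _)]vdotC vdot_mulmx.
by move: h; move: (vdot (M *m _) _) (vdot (M^T *m y) _) (vdot y y) => a b c; lra.
Qed.

(** Among the matrices with row space inside [G], one of maximal rank spans [G]: adjoining any [x]
    of [G] cannot raise the rank. *)
Lemma subspace_row_matrix N (G : set 'rV[R]_N) : G 0 ->
  (forall (a : R) x y, G x -> G y -> G (a *: x + y)) ->
  exists W : 'M[R]_N, forall x, G x <-> (x <= W)%MS.
Proof.
move=> G0 Glin.
pose S (W : 'M[R]_N) := forall y : 'rV_N, (y <= W)%MS -> G y.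
pose P r := `[< exists2 W, S W & \rank W = r >].
have exP : exists r, P r.
  by exists 0%N; apply/asboolP; exists 0; [move=> y /submx0null->|rewrite mxrank0].
have ubP r : P r -> (r <= N)%N by move=> /asboolP[W _ <-]; exact: rank_leq_row.
have [r /asboolP[W SW rW] rmax] := ex_maxnP exP ubP.
exists W => x; split; last exact: SW.
move=> Gx; have SWx : S (W + x)%MS.
  move=> y /sub_addsmxP[[u v] /= ->]; rewrite addrC (mx11_scalar v) mul_scalar_mx.
  by apply: Glin => //; apply: SW; exact: submxMl.
have rWx : (\rank (W + x)%MS <= \rank W)%N.
  by rewrite rW; apply: rmax; apply/asboolP; exists (W + x)%MS.
have : (W + x <= W)%MS.
  by rewrite -(mxrank_leqif_sup (addsmxSl W x)).2 eqn_leq rWx mxrankS ?addsmxSl.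
by apply: submx_trans; exact: addsmxSr.
Qed.

(** The inequality forces [x.2 = 0] whenever [x.1 = 0], so [G] is the graph of a contraction on the
    space of first components. Extending it by zero on the orthogonal complement preserves the norm
    bound. *)
Lemma contraction_of_subspace p q (G : set ('cV[R]_p * 'cV[R]_q)) :
  G 0 -> (forall (a : R) x y, G x -> G y -> G (a *: x + y)) ->
  (forall x, G x -> vdot x.2 x.2 <= vdot x.1 x.1) ->
  exists2 M : 'M[R]_(q, p), psd (1%:M - M^T *m M) &
    forall x, G x -> M *m x.1 + x.2 = 0.
Proof.
move=> G0 Glin Gle.
pose H : set 'rV[R]_(p + q) := [set x | G ((lsubmx x)^T, (rsubmx x)^T)].
have [W0 W0P] : exists W : 'M[R]_(p + q), forall x, H x <-> (x <= W)%MS.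
  apply: subspace_row_matrix; first by rewrite /H/= !linear0.
  by move=> a x y Hx Hy; rewrite /H/= !linearP; exact: (Glin a _ _ Hx Hy).
(* Free rows make the coefficients [c] unique, which with the injectivity of [A] makes the Gram
   matrix of [A] invertible. *)
pose W := row_base W0.
have WP x : H x <-> exists c, x = c *m W.
  rewrite W0P -(eq_row_base W0); split => [/submxP[c ->]|[c ->]]; first by exists c.
  exact: submxMl.
have Wfree : row_free W by exact: row_base_free.
pose A := lsubmx W; pose B := rsubmx W.
have lE c : lsubmx (c *m W) = c *m A by rewrite /A -mulmx_lsub.
have rE c : rsubmx (c *m W) = c *m B by rewrite /B -mulmx_rsub.
have AB (c : 'rV_(\rank W0)) :
    vdot (c *m B)^T (c *m B)^T <= vdot (c *m A)^T (c *m A)^T.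
  by have /Gle/= : H (c *m W) by [apply/WP; exists c]; rewrite lE rE.
have Ainj (c : 'rV_(\rank W0)) : c *m A = 0 -> c = 0.
  move=> cA; have := AB c; rewrite cA trmx0 {2}/vdot mulmx0 mxE => cB.
  have {}cB : c *m B = 0.
    apply: trmx_inj; rewrite trmx0; apply: vdot_eq0; apply: le_anti.
    by rewrite cB vdot_ge0.
  apply: (row_free_inj Wfree); rewrite mul0mx -[LHS]hsubmxK lE rE cA cB.
  by rewrite row_mx0.
have AA : A *m A^T \in unitmx.
  rewrite -row_free_unit -kermx_eq0; apply/eqP/row_matrixP => j.
  rewrite row0; apply: Ainj; apply: trmx_inj; rewrite trmx0; apply: vdot_eq0.
  rewrite /vdot trmxK trmx_mul mulmxA -(mulmxA _ A) -row_mul.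
  by rewrite mulmx_ker row0 mul0mx mxE.
pose I := invmx (A *m A^T).
have IT : I^T = I by rewrite /I trmx_inv trmx_mul trmxK.
(* The Moore-Penrose inverse of [A] followed by [B]: it sends [c *m A] to [c *m B] and kills the
   orthogonal complement of the row space of [A]. *)
pose N := A^T *m I *m B.
have AN : A *m N = B by rewrite /N !mulmxA mulmxV// mul1mx.
(* [z *m A] is the orthogonal projection of [y] onto the row space of [A]. *)
have Ncontr (y : 'rV_p) : vdot (y *m N)^T (y *m N)^T <= vdot y^T y^T.
  pose z := y *m A^T *m I.
  have -> : y *m N = z *m B by rewrite /z /N !mulmxA.
  apply: le_trans (AB z) _.
  have := vdot_ge0 (y - z *m A)^T; rewrite linearB/= (form_sqrB (@vdotC p) (@vdot_linear p)).
  suff -> : vdot y^T (z *m A)^T = vdot (z *m A)^T (z *m A)^T.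
    by move: (vdot (z *m A)^T _) (vdot y^T _) => a b; lra.
  rewrite /vdot !trmxK !trmx_mul trmxK IT.
  have zI : z *m A *m A^T *m I = z by rewrite -(mulmxA z) -mulmxA mulmxV// mulmx1.
  by rewrite !mulmxA zI.
exists (- N^T).
  apply/psd_gramP => x; have := Ncontr x^T.
  rewrite trmxK trmx_mul trmxK mulNmx.
  by rewrite vdotNl vdotNr opprK.
move=> x Gx; have /WP[c xc] : H (row_mx x.1^T x.2^T).
  by rewrite /H/= row_mxKl row_mxKr !trmxK; case: x Gx.
have x1 : x.1 = (c *m A)^T by rewrite -lE -xc row_mxKl trmxK.
have x2 : x.2 = (c *m B)^T by rewrite -rE -xc row_mxKr trmxK.
by rewrite x1 x2 mulNmx -trmx_mul -mulmxA AN addNr.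
Qed.

(** The transpose of a spanning matrix has a kernel consisting of vectors orthogonal to [A], so the
    matrix has full rank. *)
Lemma subspace_full p (A : set 'cV[R]_p) : A 0 ->
  (forall (a : R) x y, A x -> A y -> A (a *: x + y)) ->
  (forall x, (forall y, A y -> vdot y x = 0) -> x = 0) -> forall x, A x.
Proof.
move=> A0 Alin Aorth x.
have [W WP] : exists W : 'M[R]_p, forall x, A x^T <-> (x <= W)%MS.
  apply: (@subspace_row_matrix p (fun x => A x^T)); first by rewrite trmx0.
  by move=> a y z Ay Az; rewrite linearP; exact: Alin.
rewrite -[x]trmxK; apply/WP.
suff Wfull : row_full W by exact: submx_full.
rewrite row_full_unit -unitmx_tr -row_free_unit -kermx_eq0.
apply/eqP/row_matrixP => j; rewrite row0; apply: trmx_inj; rewrite trmx0.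
apply: Aorth => y Ay; have /submxP[c yc] : (y^T <= W)%MS by apply/WP; rewrite trmxK.
rewrite vdotC /vdot trmxK -[y]trmxK yc trmx_mul mulmxA -row_mul.
by rewrite mulmx_ker row0 mul0mx mxE.
Qed.

End Contractions.

(** * Abstract boundary triples *)

Section BoundaryTriple.
Context {R : realType} {V : lmodType R}.
Variables (dot : V -> V -> R) (p q : nat).
Variables (T T0 : set (V * V)) (tr : V -> 'cV[R]_p) (tl : V -> 'cV[R]_q).
Hypothesis dotC : forall x y, dot x y = dot y x.
Hypothesis dotl : forall a x y z, dot (a *: x + y) z = a * dot x z + dot y z.
Hypothesis Tlin : linear_relation T.
Hypothesis Tfun : forall u f g, T (u, f) -> T (u, g) -> f = g.
Hypothesis tr_lin : forall a u f v g, T (u, f) -> T (v, g) ->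
  tr (a *: u + v) = a *: tr u + tr v.
Hypothesis tl_lin : forall a u f v g, T (u, f) -> T (v, g) ->
  tl (a *: u + v) = a *: tl u + tl v.
Hypothesis green : forall u f, T (u, f) ->
  2 * dot f u = vdot (tr u) (tr u) - vdot (tl u) (tl u).
Hypothesis T0P : forall u f, T0 (u, f) <->
  T (u, f) /\ forall w w', T (w, w') -> dot f w + dot u w' = 0.
Hypothesis traces_surj : forall a b, exists u f, [/\ T (u, f), tr u = a & tl u = b].
Hypothesis weak : forall f g,
  (forall w w', T0 (w, w') -> dot w g + dot w' f = 0) -> T (f, g).

(** Green's formula for [u + v] minus those for [u] and [v]. *)
Lemma green_polarized u f v g : T (u, f) -> T (v, g) ->
  dot f v + dot u g = vdot (tr u) (tr v) - vdot (tl u) (tl v).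
Proof.
move=> uf vg; have [_ Tl] := Tlin.
have := green (Tl 1 _ _ uf vg); have := green uf; have := green vg.
rewrite /= (tr_lin 1 uf vg) (tl_lin 1 uf vg) !scale1r.
rewrite !vdotDl !vdotDr.
rewrite (formDl dotl) !(formDr dotC dotl) (vdotC (tr v)) (vdotC (tl v)) (dotC u).
move: (dot f u) (dot g v) (dot f v) (dot g u).
move: (vdot (tr u) (tr u)) (vdot (tr v) (tr v)) (vdot (tr u) (tr v)).
move: (vdot (tl u) (tl u)) (vdot (tl v) (tl v)) (vdot (tl u) (tl v)).
by move=> *; lra.
Qed.

Lemma T0_traces u f : T0 (u, f) <-> [/\ T (u, f), tr u = 0 & tl u = 0].
Proof.
rewrite T0P; split=> [[uf h]|[uf tr0 tl0]]; last first.
  split=> // w w' ww'; rewrite (green_polarized uf ww') tr0 tl0.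
  by rewrite !vdot0l subrr.
(* The sign in front of [tl u] turns the indefinite boundary form into a sum of two squared
   norms. *)
have [w [w' [ww' trw tlw]]] := traces_surj (tr u) (- tl u).
have := green_polarized uf ww'.
rewrite h// trw tlw vdotNr opprK.
move=> /esym/eqP; rewrite paddr_eq0 ?vdot_ge0// => /andP[/eqP/vdot_eq0 h1 /eqP/vdot_eq0 h2].
by [].
Qed.

Definition boundary_space (M : 'M[R]_(q, p)) : set V :=
  [set u | (exists f, T (u, f)) /\ M *m tr u + tl u = 0].

Variable D : set (V * V).
Hypothesis linD : linear_operator D.
Hypothesis subD : T0 `<=` D.
Hypothesis Dsub : D `<=` T.

Lemma T_sub a u f v g : T (u, f) -> T (v, g) -> T (u - a *: v, f - a *: g).
Proof.
move=> uf vg; have [_ Tl] := Tlin; have := Tl (- a) _ _ vg uf.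
by rewrite !scaleNr /= => h; rewrite addrC [f - _]addrC.
Qed.

Lemma T_same_traces u f v g : T (u, f) -> D (v, g) ->
  tr u = tr v -> tl u = tl v -> D (u, f).
Proof.
move=> uf vg e1 e2; have [[_ Dl] _] := linD.
have Tvg := Dsub vg.
have uv : T0 (u - v, f - g).
  apply/T0_traces; split.
  - by have := T_sub 1 uf Tvg; rewrite !scale1r.
  - have := tr_lin (-1) Tvg uf; rewrite !scaleN1r addrC => ->.
    by rewrite e1 addNr.
  - have := tl_lin (-1) Tvg uf; rewrite !scaleN1r addrC => ->.
    by rewrite e2 addNr.
by have := Dl 1 _ _ (subD uv) vg; rewrite scale1r /=
  -[X in D X]/(u - v + v, f - g + g) !subrK.
Qed.

Lemma dom_boundary_space M u f : dom D = boundary_space M -> T (u, f) ->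
  M *m tr u + tl u = 0 -> D (u, f).
Proof.
move=> DM uf h; have [g ug] : dom D u by rewrite DM; split => //; exists f.
by rewrite (Tfun uf (Dsub ug)).
Qed.

(** Stated for any [S] inside [T], as it serves both for [D] and for the restriction of [T] to a
    boundary space. *)
Lemma contraction_accretive M S : S `<=` T -> dom S `<=` boundary_space M ->
  psd (1%:M - M^T *m M) -> accretive dot S.
Proof.
move=> ST SM /psd_gramP cM u f uf; have [_ bc] := SM u (ex_intro _ f uf).
have := green (ST _ uf); have -> : tl u = - (M *m tr u).
  by apply/eqP; rewrite -addr_eq0 addrC bc.
rewrite vdotNl vdotNr opprK.
by have := cM (tr u); move: (vdot _ _) (vdot _ _) (dot f u) => a b c; lra.
Qed.

Lemma accretive_contraction : accretive dot D ->
  exists2 M, psd (1%:M - M^T *m M) & dom D `<=` boundary_space M.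
Proof.
move=> accD; have [[D0 Dl] _] := linD.
pose G : set ('cV[R]_p * 'cV[R]_q) :=
  [set x | exists u f, [/\ D (u, f), tr u = x.1 & tl u = x.2]].
have [|a x y|x|M cM MG] := @contraction_of_subspace R p q G.
- have /T0_traces[_ h1 h2] : T0 (0, 0).
    apply/T0P; split=> [|w w' _]; first by have [] := Tlin.
    by rewrite !(form0l dotl) addr0.
  by exists 0, 0.
- move=> [u [f [uf e1 e2]]] [v [g [vg h1 h2]]].
  exists (a *: u + v), (a *: f + g); split; first exact: (Dl a _ _ uf vg).
    by rewrite (tr_lin a (Dsub uf) (Dsub vg)) e1 h1.
  by rewrite (tl_lin a (Dsub uf) (Dsub vg)) e2 h2.
- move=> [u [f [uf <- <-]]]; have := green (Dsub uf); have := accD _ _ uf.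
  by move: (vdot _ _) (vdot _ _) (dot f u) => b c d; lra.
- exists M => // u [f uf]; split; first by exists f; exact: Dsub.
  by apply: (MG (tr u, tl u)); exists u, f.
Qed.

Lemma adjoint_boundary_space M : dom D = boundary_space M ->
  [/\ T0 `<=` opp_rel (adjoint dot D), opp_rel (adjoint dot D) `<=` T &
   dom (adjoint dot D) =
     [set v | (exists g, T (v, g)) /\ tr v + M^T *m tl v = 0]].
Proof.
move=> DM.
(* The pairing with [T0], which lies in [D], already places [(v, - g)] in [T]. *)
have adjT v g : adjoint dot D (v, g) -> T (v, - g).
  move=> vg; apply: weak => w w' ww'; have /= h := vg _ _ (subD ww').
  by rewrite h -[- g]scaleN1r (formZr dotC dotl); ring.
split.
- move=> [v g] vg; have /T0P[_ h] := vg; move=> u f uf /=.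
  have := h u f (Dsub uf); rewrite (dotC g) (dotC v) -[- g]scaleN1r (formZr dotC dotl).
  by move=> /eqP; rewrite addr_eq0 => /eqP ->; rewrite mulN1r opprK.
- by move=> [v g] /adjT; rewrite opprK.
- apply/seteqP; split => v.
  + move=> [g vg]; have Tv := adjT _ _ vg; split; first by exists (- g).
    apply: vdot_eq0.
    have key a : vdot a (tr v + M^T *m tl v) = 0.
      (* Every [a] is a right trace on [dom D], with left trace [- M a]; the boundary form against
         [v] is then [a] paired with [tr v + M^T tl v]. *)
      have [u [f [uf tra tla]]] := traces_surj a (- (M *m a)).
      have Du : D (u, f).
        by apply: dom_boundary_space DM uf _; rewrite tra tla addrN.
      have := green_polarized uf Tv; have /= -> := vg _ _ Du.
      rewrite -[- g]scaleN1r (formZr dotC dotl) mulN1r addrN tra tla.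
      rewrite vdotNl opprK vdot_mulmx.
      by rewrite vdotDr.
    exact: key.
  + move=> [[g vg] bc]; exists (- g) => u f uf /=.
    have [_ bcu] : boundary_space M u by rewrite -DM; exists f.
    have tlu : tl u = - (M *m tr u) by apply/eqP; rewrite -addr_eq0 addrC bcu.
    have := green_polarized (Dsub uf) vg; rewrite tlu vdotNl opprK.
    rewrite vdot_mulmx -vdotDr bc.
    rewrite vdotC vdot0l -[- g]scaleN1r (formZr dotC dotl) mulN1r.
    by move=> /eqP; rewrite addr_eq0 => /eqP.
Qed.

Lemma boundary_space_maximal M : psd (1%:M - M^T *m M) ->
  dom D = boundary_space M -> maximal_accretive dot D.
Proof.
move=> cM DM; split.
  by apply: (contraction_accretive Dsub _ cM); rewrite DM.
move=> S [S0 Sl] accS DS.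
have ST : S `<=` T.
  move=> [f g] fg; apply: weak => w w' ww'.
  have Tw : T (w, w') by have /T0P[] := ww'.
  have ww0 : dot w' w = 0.
    have /T0_traces[_ h1 h2] := ww'; have := green Tw.
    by rewrite h1 h2 !vdot0l subrr; lra.
  (* Adding multiples of [(w, w')] changes the form only linearly, as it vanishes
     on [T0]. *)
  have lin t : 0 <= dot g f + t * (dot w g + dot w' f).
    have := accS _ _ (Sl t _ _ (DS _ (subD ww')) fg) => /=.
    rewrite dotl !(formDr dotC dotl) !(formZr dotC dotl) ww0 (dotC w).
    by rewrite mulr0 add0r; move=> h; apply: le_trans h _;
      rewrite le_eqVlt; apply/orP; left; apply/eqP; ring.
  apply/eqP; apply/negPn/negP => c0; move: lin.
  move: (dot w g + dot w' f) c0 (dot g f) => c c0 d lin.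
  (* At this [t] the affine function takes the value -1. *)
  have := lin (- (d + 1) / c); rewrite divfK//; lra.
apply/seteqP; split => // -[f g] fg.
have Tfg := ST _ fg.
(* [u] has the right trace of [f] and satisfies the boundary condition. The difference lies in [S]
   with right trace 0, where Green's formula leaves minus the squared left trace, so accretivity
   makes that trace vanish too. *)
have [u [u' [uu' tru tlu]]] := traces_surj (tr f) (- (M *m tr f)).
have Du : D (u, u') by apply: dom_boundary_space DM uu' _; rewrite tru tlu addrN.
have Sd : S (f - u, g - u').
  have -> : (f - u, g - u') = -1 *: (u, u') + (f, g).
    rewrite -[RHS]/(-1 *: u + f, -1 *: u' + g) !scaleN1r.
    by rewrite [f - u]addrC [g - u']addrC.
  exact: Sl (DS _ Du) fg.
have trd : tr (f - u) = 0.
  by have := tr_lin (-1) uu' Tfg; rewrite !scaleN1r addrC tru addNr.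
have tl0 : tl (f - u) = 0.
  apply: vdot_eq0; have := green (ST _ Sd); have := accS _ _ Sd.
  rewrite trd vdot0l; have := vdot_ge0 (tl (f - u)).
  by move: (vdot _ _) (dot _ _) => a b; lra.
have tlf : tl f = tl u.
  have := tl_lin (-1) uu' Tfg; rewrite !scaleN1r addrC tl0 => /eqP.
  by rewrite eq_sym addrC subr_eq0 => /eqP.
exact: T_same_traces Tfg Du (esym tru) tlf.
Qed.

(** Since [- D^*] lies in [T], Green's formula for the adjoint has the opposite sign: left traces
    must dominate right traces, which is the contractivity of [M^T]. *)
Lemma boundary_triple_adjoint_accretive M : psd (1%:M - M^T *m M) ->
  dom D = boundary_space M -> accretive dot (adjoint dot D).
Proof.
move=> /psd_gramP cM DM v g vg.
have [_ oppT domE] := adjoint_boundary_space DM.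
have Tv : T (v, - g) by apply: oppT; rewrite /opp_rel/= opprK.
have [_ bc] : [set v | (exists g, T (v, g)) /\ tr v + M^T *m tl v = 0] v.
  by rewrite -domE; exists g.
have trv : tr v = - (M^T *m tl v) by apply/eqP; rewrite -addr_eq0 bc.
have := green Tv; rewrite trv vdotNl.
rewrite vdotNr opprK (formNl dotl).
have := contraction_tr cM (tl v).
by move: (vdot _ _) (vdot _ _) (dot g v) => a b c; lra.
Qed.

(** In the boundary space the left trace is a function of the right one, so equality of the domains
    reduces to every vector being a right trace on [dom D]. *)
Lemma adjoint_accretive_boundary_space : accretive dot D ->
  accretive dot (adjoint dot D) ->
  exists2 M, psd (1%:M - M^T *m M) & dom D = boundary_space M.
Proof.
move=> accD accD'; have [M cM DM] := accretive_contraction accD.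
have [[D0 Dl] _] := linD.
exists M => //; apply/seteqP; split => // u [[f uf] bc].
(* A vector [a] orthogonal to all right traces on [dom D] is the right trace of
   some [v] in the domain of the adjoint with vanishing left trace, whose form
   is [- vdot a a / 2]. *)
have full : forall a, (exists u f, D (u, f) /\ tr u = a).
  apply: (@subspace_full R p (fun a => exists u f, D (u, f) /\ tr u = a)).
  - have /T0_traces[_ h1 h2] : T0 (0, 0).
      apply/T0P; split=> [|w w' _]; first by have [] := Tlin.
      by rewrite !(form0l dotl) addr0.
    by exists 0, 0.
  - move=> a x y [u1 [f1 [uf1 <-]]] [v [g [vg <-]]].
    exists (a *: u1 + v), (a *: f1 + g); split; first exact: (Dl a _ _ uf1 vg).
    by rewrite (tr_lin a (Dsub uf1) (Dsub vg)).
  - move=> a orth.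
    have [v [g [vg trv tlv]]] := traces_surj a 0.
    have adj : adjoint dot D (v, - g).
      move=> u1 f1 uf1 /=; have := green_polarized (Dsub uf1) vg.
      rewrite trv tlv [vdot (tl u1) 0]vdotC vdot0l subr0.
      rewrite orth; last by exists u1, f1.
      rewrite -[- g]scaleN1r (formZr dotC dotl) mulN1r.
      by move=> /eqP; rewrite addr_eq0 => /eqP.
    apply: vdot_eq0; have := accD' _ _ adj; rewrite (formNl dotl).
    have := green vg; rewrite trv tlv vdot0l.
    by have := vdot_ge0 a; move: (vdot a a) (dot g v) => b c; lra.
have [w [w' [ww' trw]]] := full (tr u).
have [_ bcw] : boundary_space M w by apply: DM; exists w'.
exists f; apply: T_same_traces uf ww' (esym trw) _.
apply: (addrI (M *m tr u)); by rewrite bc -trw bcw.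
Qed.

Theorem boundary_triple_accretivity :
  [/\ accretive dot D <->
      (exists2 M, psd (1%:M - M^T *m M) & dom D `<=` boundary_space M),
      (maximal_accretive dot D <->
       (exists2 M, psd (1%:M - M^T *m M) & dom D = boundary_space M)) &
      (maximal_accretive dot D <->
       (accretive dot D /\ accretive dot (adjoint dot D)))].
Proof.
have max_bc : maximal_accretive dot D ->
    exists2 M, psd (1%:M - M^T *m M) & dom D = boundary_space M.
  move=> [accD maxD]; have [M cM DM] := accretive_contraction accD.
  exists M => //.
  (* The restriction of [T] to the boundary space is accretive and extends [D], so maximality
     identifies the two. *)
  pose S : set (V * V) := [set x | T x /\ boundary_space M x.1].
  have -> : D = S.
    apply/esym; apply: maxD.
    - have [T00 Tl] := Tlin; have [[D0 _] _] := linD; split.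
        by split => //; apply: DM; exists 0.
      move=> a [u f] [v g] [uf [_ bu]] [vg [_ bv]]; split; first exact: Tl.
      split; first by exists (a *: f + g); exact: Tl.
      rewrite /= (tr_lin a uf vg) (tl_lin a uf vg) mulmxDr -scalemxAr.
      by rewrite addrACA -scalerDr bu bv scaler0 addr0.
    - by apply: contraction_accretive cM => [x []|u [f []]].
    - by move=> [u f] uf; split; [exact: Dsub|apply: DM; exists f].
  apply/seteqP; split=> [u [f []]//|u [[f uf] bc]].
  by exists f; split => //; split => //; exists f.
split.
- split; first exact: accretive_contraction.
  by move=> [M cM DM]; exact: contraction_accretive Dsub DM cM.
- split; first exact: max_bc.
  by move=> [M cM DM]; exact: boundary_space_maximal cM DM.
- split=> [maxD|[accD accD']].
    have [M cM DM] := max_bc maxD; split; first by case: maxD.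
    exact: boundary_triple_adjoint_accretive cM DM.
  have [M cM DM] := adjoint_accretive_boundary_space accD accD'.
  exact: boundary_space_maximal cM DM.
Qed.

End BoundaryTriple.

(** * The derivative on the three types of intervals *)

Section Intervals.
Context {R : realType}.
Local Notation mu := (@lebesgue_measure R).
Local Notation half := (itv_half R).
Local Notation pos := (itv_pos R).
Local Notation neg := (itv_neg R).

Lemma half_lt : - 2^-1 < 2^-1 :> R. Proof. lra. Qed.

Lemma half_sub_half : [set` `](- 2^-1), (2^-1 : R)[] `<=` [set` half].
Proof. by []. Qed.

Lemma half_sub_pos : [set` `](- 2^-1), (2^-1 : R)[] `<=` [set` pos].
Proof. by move=> x /=; rewrite !in_itv/= => /andP[->]. Qed.

Lemma half_sub_neg : [set` `](- 2^-1), (2^-1 : R)[] `<=` [set` neg].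
Proof. by move=> x /=; rewrite !in_itv/= => /andP[_ ->]. Qed.

Lemma open_half : open [set` half]. Proof. exact: interval_open. Qed.
Lemma open_pos : open [set` pos]. Proof. exact: interval_open. Qed.
Lemma open_neg : open [set` neg]. Proof. exact: interval_open. Qed.

Lemma near_left_half : \forall x \near (2^-1 : R)^'-, x \in half.
Proof.
near=> x; rewrite in_itv/=; apply/andP; split; near: x; last exact: nbhs_left_lt.
by apply: nbhs_left_gt; exact: half_lt.
Unshelve. all: by end_near. Qed.

Lemma near_right_half : \forall x \near (- 2^-1 : R)^'+, x \in half.
Proof.
near=> x; rewrite in_itv/=; apply/andP; split; near: x; first exact: nbhs_right_gt.
by apply: nbhs_right_lt; exact: half_lt.
Unshelve. all: by end_near. Qed.

Lemma near_right_pos : \forall x \near (- 2^-1 : R)^'+, x \in pos.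
Proof. by near=> x; rewrite in_itv/= andbT; near: x; exact: nbhs_right_gt.
Unshelve. all: by end_near. Qed.

Lemma near_left_neg : \forall x \near (2^-1 : R)^'-, x \in neg.
Proof. by near=> x; rewrite in_itv/=; near: x; exact: nbhs_left_lt.
Unshelve. all: by end_near. Qed.

Lemma represents_ext_ae (i : interval R) F (u : L2 i) : represents F u ->
  {ae mu, forall x, x \in i -> ext u x = F x}.
Proof.
move=> [_ uF]; apply: negligibleS uF => x /= nF uFx; apply: nF => xi.
by rewrite ext_in// uFx.
Qed.

Lemma green_half (u v : L2 half) : weak_deriv u v ->
  2 * dotL2 v u = eval_left u 2^-1 ^+ 2 - eval_right u (- 2^-1) ^+ 2.
Proof.
move=> uv; have [F [uF vF]] := weak_deriv_representative open_half half_lt half_sub_half uv.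
rewrite (eval_leftE open_half uF near_left_half).
rewrite (eval_rightE open_half uF near_right_half).
rewrite dotL2C dotL2E (green_bounded half_lt (sq_integrable_ext u) (sq_integrable_ext v) vF)//.
- exact: represents_ext_ae.
- by move=> x; exact: ext_out.
Qed.

Lemma green_pos (u v : L2 pos) : weak_deriv u v ->
  2 * dotL2 v u = - eval_right u (- 2^-1) ^+ 2.
Proof.
move=> uv; have [F [uF vF]] := weak_deriv_representative open_pos half_lt half_sub_pos uv.
rewrite (eval_rightE open_pos uF near_right_pos).
rewrite dotL2C dotL2E (@green_right _ (- 2^-1) _ _ F (sq_integrable_ext u) (sq_integrable_ext v))//.
- exact: represents_ext_ae.
- by move=> x; exact: ext_out.
Qed.

Lemma green_neg (u v : L2 neg) : weak_deriv u v ->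
  2 * dotL2 v u = eval_left u 2^-1 ^+ 2.
Proof.
move=> uv; have [F [uF vF]] := weak_deriv_representative open_neg half_lt half_sub_neg uv.
rewrite (eval_leftE open_neg uF near_left_neg).
rewrite dotL2C dotL2E (@green_left _ 2^-1 _ _ F (sq_integrable_ext u) (sq_integrable_ext v))//.
- exact: represents_ext_ae.
- by move=> x; exact: ext_out.
Qed.

Section OneInterval.
Variable i : interval R.
Hypotheses (oi : open [set` i]) (subi : [set` `](- 2^-1), 2^-1[] `<=` [set` i]).

Lemma eval_left_linear a (u u' v v' : L2 i) b : weak_deriv u u' -> weak_deriv v v' ->
  (\forall x \near b^'-, x \in i) ->
  eval_left (a *: u + v) b = a * eval_left u b + eval_left v b.
Proof.
move=> uu vv bi.
have [F [uF _]] := weak_deriv_representative oi half_lt subi uu.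
have [G [vG _]] := weak_deriv_representative oi half_lt subi vv.
rewrite (eval_leftE oi (represents_linear a uF vG) bi).
by rewrite (eval_leftE oi uF bi) (eval_leftE oi vG bi).
Qed.

Lemma eval_right_linear a (u u' v v' : L2 i) b : weak_deriv u u' -> weak_deriv v v' ->
  (\forall x \near b^'+, x \in i) ->
  eval_right (a *: u + v) b = a * eval_right u b + eval_right v b.
Proof.
move=> uu vv bi.
have [F [uF _]] := weak_deriv_representative oi half_lt subi uu.
have [G [vG _]] := weak_deriv_representative oi half_lt subi vv.
rewrite (eval_rightE oi (represents_linear a uF vG) bi).
by rewrite (eval_rightE oi uF bi) (eval_rightE oi vG bi).
Qed.

Lemma smooth_with_traces (alpha beta : R) : exists2 x : L2 i * L2 i,
  weak_deriv x.1 x.2 &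
  exists F, [/\ represents F x.1, F 2^-1 = alpha & F (- 2^-1) = beta].
Proof.
(* [p1] is 1 on [[1/4, 1]] and vanishes off [[0, 5/4]]; [p2] is 1 on [[- 3/4, - 1/4]] and vanishes
   off [[- 1, 0]]. So each of the points [1/2] and [- 1/2] sees only one of them, whatever [i]
   is. *)
pose p1 : R -> R := plateau 0 1 4^-1.
pose p2 : R -> R := plateau (- 1) (- 4^-1) 4^-1.
pose phi x := alpha * p1 x + beta * p2 x.
have sphi : smooth phi.
  apply: (@smoothD _ (cst alpha \* p1) (cst beta \* p2)); apply: smoothM.
  - exact: smooth_cst.
  - exact: smooth_plateau.
  - exact: smooth_cst.
  - exact: smooth_plateau.
have p1E : p1 2^-1 = 1 by apply: plateau_eq1; lra.
have p2E : p2 (- 2^-1) = 1 by apply: plateau_eq1; lra.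
have p1_out x : (x < 0) || (2 < x) -> p1 x = 0.
  move=> x0; apply: plateau_out; [lra|lra|].
  by rewrite in_itv/=; apply/negP => /andP[h1 h2]; case/orP: x0 => h3; lra.
have p2_out x : (x < - 2) || (0 < x) -> p2 x = 0.
  move=> x0; apply: plateau_out; [lra|lra|].
  by rewrite in_itv/=; apply/negP => /andP[h1 h2]; case/orP: x0 => h3; lra.
(* The larger interval makes [phi] a test function although it need not vanish at the boundary of
   [i]; this yields its square integrability. *)
have tphi : test_fun `](- 3), 3[ phi.
  apply: (@smooth_test_fun _ _ _ (- 2) 2) => // x; rewrite in_itv/=.
  - rewrite negb_and -!ltNge => x2; rewrite /phi p1_out ?p2_out ?mulr0 ?addr0//.
    + by case/orP: x2 => h; apply/orP; [left|right; lra].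
    + by case/orP: x2 => h; apply/orP; [left; lra|right].
  - by move=> /andP[h1 h2]; rewrite in_itv/=; apply/andP; split; lra.
have [s1 s2] := sq_integrable_test_fun tphi.
have uphi := L2_ofE i s1; have vphi := L2_ofE i s2.
exists (L2_of i s1, L2_of i s2); first exact: smooth_compact_weak_deriv uphi vphi.
exists phi; split.
- by split => //; exact: smooth_continuous.
- rewrite /phi p1E p2_out ?mulr1 ?mulr0 ?addr0//.
  by apply/orP; right; lra.
- rewrite /phi p2E p1_out ?mulr1 ?mulr0 ?add0r//.
  by apply/orP; left; lra.
Qed.

Lemma weak_deriv0 : weak_deriv (0 : L2 i) 0.
Proof.
by apply/test_pairs_orthogonal => k _; exact: form0l (@pair_dot_linear _ i) k.
Qed.

Lemma test_pairs_H10 (k : L2 i * L2 i) : test_pairs k ->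
  weak_deriv k.1 k.2 /\ H10 k.1.
Proof.
move=> Kk; have [phi tphi [k1 k2]] := Kk.
have wk := smooth_compact_weak_deriv (test_fun_smooth tphi) k1 k2.
split => //; apply/H10_closure; exists k.2 => // e e0; exists k => //.
have -> : (k.1, k.2) - k = 0 by case: (k) => a b; exact: subrr.
by rewrite (form0l (@pair_dot_linear _ i)).
Qed.

End OneInterval.
End Intervals.

(** * The derivative on the direct sum *)

Section DirectSum.
Context (R : realType) (n mp mm : nat).
Local Notation half := (itv_half R).
Local Notation pos := (itv_pos R).
Local Notation neg := (itv_neg R).
Local Notation V := (L2sum R n mp mm).
Local Notation T := (deriv_op R n mp mm).
Implicit Types (u v f g : V).

Lemma dotL2sumC u v : dotL2sum u v = dotL2sum v u.
Proof.
by rewrite /dotL2sum; congr (_ + _ + _); apply: eq_bigr => j _; rewrite dotL2C.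
Qed.

Lemma dotL2sum_linear a u v w :
  dotL2sum (a *: u + v) w = a * dotL2sum u w + dotL2sum v w.
Proof.
rewrite /dotL2sum !mulrDr !mulr_sumr.
have E (X Y Z X' Y' Z' : R) : X + Y + Z + (X' + Y' + Z') =
  (X + X') + (Y + Y') + (Z + Z') by ring.
rewrite E -!big_split/=; congr (_ + _ + _); apply: eq_bigr => j _;
  by rewrite /u_half /u_pos /u_neg/= !ffunE dotL2_linear.
Qed.

Lemma deriv_op_linear : linear_relation T.
Proof.
split; first by split => j; rewrite /u_half /u_pos /u_neg/= !ffunE; exact: weak_deriv0.
move=> a x y [x1 x2 x3] [y1 y2 y3]; split => j;
  rewrite /u_half /u_pos /u_neg/= !ffunE.
- exact: weak_deriv_linear (x1 j) (y1 j).
- exact: weak_deriv_linear (x2 j) (y2 j).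
- exact: weak_deriv_linear (x3 j) (y3 j).
Qed.

Lemma deriv_op_functional u f g : T (u, f) -> T (u, g) -> f = g.
Proof.
move=> [f1 f2 f3] [g1 g2 g3].
case: f f1 f2 f3 => [[fh fp] fn] f1 f2 f3.
case: g g1 g2 g3 => [[gh gp] gn] g1 g2 g3.
congr (_, _, _); apply/ffunP => j.
- exact: (weak_deriv_unique (@open_half R) half_lt (@half_sub_half R) (f1 j) (g1 j)).
- exact: (weak_deriv_unique (@open_pos R) half_lt (@half_sub_pos R) (f2 j) (g2 j)).
- exact: (weak_deriv_unique (@open_neg R) half_lt (@half_sub_neg R) (f3 j) (g3 j)).
Qed.

Lemma ur_linear a u f v g : T (u, f) -> T (v, g) ->
  ur (a *: u + v) = a *: ur u + ur v.
Proof.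
move=> [u1 u2 u3] [v1 v2 v3].
rewrite /ur scale_col_mx add_col_mx; congr col_mx; apply/matrixP => j k;
  rewrite !mxE /u_half /u_neg/= !ffunE.
- exact: (eval_left_linear (@open_half R) (@half_sub_half R) a (u1 j) (v1 j) near_left_half).
- exact: (eval_left_linear (@open_neg R) (@half_sub_neg R) a (u3 j) (v3 j) near_left_neg).
Qed.

Lemma ul_linear a u f v g : T (u, f) -> T (v, g) ->
  ul (a *: u + v) = a *: ul u + ul v.
Proof.
move=> [u1 u2 u3] [v1 v2 v3].
rewrite /ul scale_col_mx add_col_mx; congr col_mx; apply/matrixP => j k;
  rewrite !mxE /u_half /u_pos/= !ffunE.
- exact: (eval_right_linear (@open_half R) (@half_sub_half R) a (u1 j) (v1 j) near_right_half).
- exact: (eval_right_linear (@open_pos R) (@half_sub_pos R) a (u2 j) (v2 j) near_right_pos).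
Qed.

Lemma vdot_col_mx p q (x : 'cV[R]_p) (y : 'cV[R]_q) :
  vdot (col_mx x y) (col_mx x y) = \sum_j x j 0 ^+ 2 + \sum_j y j 0 ^+ 2.
Proof.
rewrite vdotE big_split_ord/=; congr (_ + _); apply: eq_bigr => j _.
  by rewrite !col_mxEu expr2.
by rewrite !col_mxEd expr2.
Qed.

Lemma green_sum u f : T (u, f) ->
  2 * dotL2sum f u = vdot (ur u) (ur u) - vdot (ul u) (ul u).
Proof.
move=> [/= u1 u2 u3]; rewrite /ur /ul !vdot_col_mx /dotL2sum !mulrDr !mulr_sumr.
have -> : \sum_j 2 * dotL2 (u_half f j) (u_half u j) =
    \sum_j eval_left (u_half u j) 2^-1 ^+ 2 -
    \sum_j eval_right (u_half u j) (- 2^-1) ^+ 2.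
  by rewrite -sumrB; apply: eq_bigr => j _; exact: green_half (u1 j).
have -> : \sum_j 2 * dotL2 (u_pos f j) (u_pos u j) =
    - \sum_j eval_right (u_pos u j) (- 2^-1) ^+ 2.
  by rewrite -sumrN; apply: eq_bigr => j _; exact: green_pos (u2 j).
have -> : \sum_j 2 * dotL2 (u_neg f j) (u_neg u j) =
    \sum_j eval_left (u_neg u j) 2^-1 ^+ 2.
  by apply: eq_bigr => j _; exact: green_neg (u3 j).
have colE k (F : 'I_k -> R) : \sum_j ((\col_j F j) j 0) ^+ 2 = \sum_j F j ^+ 2.
  by apply: eq_bigr => j _; rewrite mxE.
by rewrite !colE; ring.
Qed.

(** Elements with one nonzero component, by which conditions on the direct sum are tested one
    component at a time. *)
Definition single_half (j : 'I_n) (w : L2 half) : V :=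
  ([ffun k => if k == j then w else 0], 0, 0).
Definition single_pos (j : 'I_mp) (w : L2 pos) : V :=
  (0, [ffun k => if k == j then w else 0], 0).
Definition single_neg (j : 'I_mm) (w : L2 neg) : V :=
  (0, 0, [ffun k => if k == j then w else 0]).

Lemma dotL2_0r (i : interval R) (w : L2 i) : dotL2 w 0 = 0.
Proof. by rewrite dotL2C; exact: form0l (@dotL2_linear R i) w. Qed.

Lemma dot_single_half f j w : dotL2sum f (single_half j w) = dotL2 (u_half f j) w.
Proof.
rewrite /dotL2sum /single_half {2}/u_half {2}/u_pos {2}/u_neg /=.
rewrite (bigD1 j)//= ffunE eqxx.
rewrite big1 ?addr0; last by move=> k /negbTE kj; rewrite ffunE kj dotL2_0r.
by rewrite !big1 ?addr0// => k _; rewrite ffunE dotL2_0r.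
Qed.

Lemma dot_single_pos f j w : dotL2sum f (single_pos j w) = dotL2 (u_pos f j) w.
Proof.
rewrite /dotL2sum /single_pos {2}/u_half {2}/u_pos {2}/u_neg /=.
rewrite big1 ?add0r; last by move=> k _; rewrite ffunE dotL2_0r.
rewrite (bigD1 j)//= ffunE eqxx.
rewrite big1 ?addr0; last by move=> k /negbTE kj; rewrite ffunE kj dotL2_0r.
by rewrite big1 ?addr0// => k _; rewrite ffunE dotL2_0r.
Qed.

Lemma dot_single_neg f j w : dotL2sum f (single_neg j w) = dotL2 (u_neg f j) w.
Proof.
rewrite /dotL2sum /single_neg {2}/u_half {2}/u_pos {2}/u_neg /=.
rewrite big1 ?add0r; last by move=> k _; rewrite ffunE dotL2_0r.
rewrite big1 ?add0r; last by move=> k _; rewrite ffunE dotL2_0r.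
rewrite (bigD1 j)//= ffunE eqxx.
by rewrite big1 ?addr0// => k /negbTE kj; rewrite ffunE kj dotL2_0r.
Qed.

Lemma deriv_single_half j w w' : weak_deriv w w' ->
  T (single_half j w, single_half j w').
Proof.
move=> ww'; split => k; rewrite /single_half /u_half /u_pos /u_neg/= !ffunE;
  try exact: weak_deriv0.
by case: ifP => _; [exact: ww'|exact: weak_deriv0].
Qed.

Lemma deriv_single_pos j w w' : weak_deriv w w' ->
  T (single_pos j w, single_pos j w').
Proof.
move=> ww'; split => k; rewrite /single_pos /u_half /u_pos /u_neg/= !ffunE;
  try exact: weak_deriv0.
by case: ifP => _; [exact: ww'|exact: weak_deriv0].
Qed.

Lemma deriv_single_neg j w w' : weak_deriv w w' ->
  T (single_neg j w, single_neg j w').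
Proof.
move=> ww'; split => k; rewrite /single_neg /u_half /u_pos /u_neg/= !ffunE;
  try exact: weak_deriv0.
by case: ifP => _; [exact: ww'|exact: weak_deriv0].
Qed.

Lemma deriv0_opP u f : deriv0_op R n mp mm (u, f) <->
  T (u, f) /\ forall w w', T (w, w') -> dotL2sum f w + dotL2sum u w' = 0.
Proof.
split=> [[uf [h1 h2 h3]]|[uf h]]; split => //.
  move=> w w' [w1 w2 w3]; have [u1 u2 u3] := uf; rewrite /dotL2sum.
  have E (X Y Z X' Y' Z' : R) : X + Y + Z + (X' + Y' + Z') =
    (X + X') + (Y + Y') + (Z + Z') by ring.
  rewrite E -!big_split/= !big1 ?addr0// => j _.
  - exact: (iffLR (H10P (@open_neg R) half_lt (@half_sub_neg R) (u3 j)) (h3 j) _ _ (w3 j)).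
  - exact: (iffLR (H10P (@open_pos R) half_lt (@half_sub_pos R) (u2 j)) (h2 j) _ _ (w2 j)).
  - exact: (iffLR (H10P (@open_half R) half_lt (@half_sub_half R) (u1 j)) (h1 j) _ _ (w1 j)).
have [u1 u2 u3] := uf; split => j.
- apply: (iffRL (H10P (@open_half R) half_lt (@half_sub_half R) (u1 j))) => w w' ww'.
  by have := h _ _ (deriv_single_half j ww'); rewrite !dot_single_half.
- apply: (iffRL (H10P (@open_pos R) half_lt (@half_sub_pos R) (u2 j))) => w w' ww'.
  by have := h _ _ (deriv_single_pos j ww'); rewrite !dot_single_pos.
- apply: (iffRL (H10P (@open_neg R) half_lt (@half_sub_neg R) (u3 j))) => w w' ww'.
  by have := h _ _ (deriv_single_neg j ww'); rewrite !dot_single_neg.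
Qed.

Lemma H10_0 (i : interval R) : H10 (0 : L2 i).
Proof. by have [_] := test_pairs_H10 (@test_pairs0 R i). Qed.

(** A test function placed in a single component lies in the domain of [deriv0_op], and such
    elements detect the weak derivative of that component. *)
Lemma deriv0_adjoint f g :
  (forall w w', deriv0_op R n mp mm (w, w') -> dotL2sum w g + dotL2sum w' f = 0) ->
  T (f, g).
Proof.
move=> h; split => j /=; apply/test_pairs_orthogonal => k Kk;
  have [wk Hk] := test_pairs_H10 Kk.
- have := h (single_half j k.1) (single_half j k.2).
  rewrite ![dotL2sum (single_half _ _) _]dotL2sumC !dot_single_half; apply; split; first exact: deriv_single_half.
  split => l; rewrite /single_half /u_half /u_pos /u_neg/= ffunE; try exact: H10_0.
  by case: ifP => _; [exact: Hk|exact: H10_0].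
- have := h (single_pos j k.1) (single_pos j k.2).
  rewrite ![dotL2sum (single_pos _ _) _]dotL2sumC !dot_single_pos; apply; split; first exact: deriv_single_pos.
  split => l; rewrite /single_pos /u_half /u_pos /u_neg/= ffunE; try exact: H10_0.
  by case: ifP => _; [exact: Hk|exact: H10_0].
- have := h (single_neg j k.1) (single_neg j k.2).
  rewrite ![dotL2sum (single_neg _ _) _]dotL2sumC !dot_single_neg; apply; split; first exact: deriv_single_neg.
  split => l; rewrite /single_neg /u_half /u_pos /u_neg/= ffunE; try exact: H10_0.
  by case: ifP => _; [exact: Hk|exact: H10_0].
Qed.

Lemma traces_surjective (a : 'cV[R]_(n + mm)) (b : 'cV[R]_(n + mp)) :
  exists u f, [/\ T (u, f), ur u = a & ul u = b].
Proof.
have /choice[xh xhP] : forall j : 'I_n, exists x : L2 half * L2 half,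
    [/\ weak_deriv x.1 x.2, eval_left x.1 2^-1 = a (lshift mm j) 0 &
        eval_right x.1 (- 2^-1) = b (lshift mp j) 0].
  move=> j; have [x wx [F [xF Fr Fl]]] :=
    smooth_with_traces half (a (lshift mm j) 0) (b (lshift mp j) 0).
  exists x; split => //; first by rewrite (eval_leftE (@open_half R) xF near_left_half).
  by rewrite (eval_rightE (@open_half R) xF near_right_half).
have /choice[xp xpP] : forall j : 'I_mp, exists x : L2 pos * L2 pos,
    weak_deriv x.1 x.2 /\ eval_right x.1 (- 2^-1) = b (rshift n j) 0.
  move=> j; have [x wx [F [xF _ Fl]]] := smooth_with_traces pos 0 (b (rshift n j) 0).
  by exists x; split => //; rewrite (eval_rightE (@open_pos R) xF near_right_pos).
have /choice[xn xnP] : forall j : 'I_mm, exists x : L2 neg * L2 neg,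
    weak_deriv x.1 x.2 /\ eval_left x.1 2^-1 = a (rshift n j) 0.
  move=> j; have [x wx [F [xF Fr _]]] := smooth_with_traces neg (a (rshift n j) 0) 0.
  by exists x; split => //; rewrite (eval_leftE (@open_neg R) xF near_left_neg).
exists ([ffun j => (xh j).1], [ffun j => (xp j).1], [ffun j => (xn j).1]).
exists ([ffun j => (xh j).2], [ffun j => (xp j).2], [ffun j => (xn j).2]).
split.
- split => j; rewrite /u_half /u_pos /u_neg/= !ffunE.
  + by case: (xhP j).
  + by case: (xpP j).
  + by case: (xnP j).
- rewrite -[RHS]vsubmxK /ur; congr col_mx; apply/matrixP => j k;
    rewrite !mxE /u_half /u_neg/= !ffunE ord1.
  + by case: (xhP j).
  + by case: (xnP j).
- rewrite -[RHS]vsubmxK /ul; congr col_mx; apply/matrixP => j k;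
    rewrite !mxE /u_half /u_pos/= !ffunE ord1.
  + by case: (xhP j).
  + by case: (xpP j).
Qed.

Lemma H1sumP u : H1sum u <-> exists f, T (u, f).
Proof.
split=> [[h1 h2 h3]|[f [f1 f2 f3]]]; last first.
  by split => j; [exists (u_half f j); exact: f1|exists (u_pos f j); exact: f2|
    exists (u_neg f j); exact: f3].
have [fh fhP] := choice h1; have [fp fpP] := choice h2; have [fn fnP] := choice h3.
exists ([ffun j => fh j], [ffun j => fp j], [ffun j => fn j]).
by split => j; rewrite /= /u_half /u_pos /u_neg /= ffunE;
  [exact: fhP|exact: fpP|exact: fnP].
Qed.

Lemma bc_spaceE (M : 'M[R]_(n + mp, n + mm)) :
  bc_space M = boundary_space T (@ur R n mp mm) (@ul R n mp mm) M.
Proof.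
by apply/seteqP; split => u [/H1sumP h1 h2]; split => //; exact/H1sumP.
Qed.

End DirectSum.

Theorem theorem2p8 (R : realType) (n mp mm : nat)
  (D : set (L2sum R n mp mm * L2sum R n mp mm))
  (linD : linear_operator D)
  (subD : deriv0_op R n mp mm `<=` D) (Dsub : D `<=` deriv_op R n mp mm) :
  [/\ (* (a) *)
      accretive dotL2sum D <->
      (exists2 M : 'M[R]_(n + mp, n + mm),
         gram_le1 M & dom D `<=` bc_space M),
      (* (b) *)
      (forall M : 'M[R]_(n + mp, n + mm), dom D = bc_space M ->
         let Dstar := adjoint dotL2sum D in
         [/\ deriv0_op R n mp mm `<=` opp_rel Dstar,
             opp_rel Dstar `<=` deriv_op R n mp mm &
             dom Dstar = [set v | H1sum v /\ ur v + M^T *m ul v = 0]]),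
      (* (c) *)
      (maximal_accretive dotL2sum D <->
       (exists2 M : 'M[R]_(n + mp, n + mm),
          gram_le1 M & dom D = bc_space M)) &
      (* the second description of maximal accretivity *)
      (maximal_accretive dotL2sum D <->
       (accretive dotL2sum D /\
        accretive dotL2sum (adjoint dotL2sum D)))].
Proof.
have dotC := @dotL2sumC R n mp mm.
have dotl := @dotL2sum_linear R n mp mm.
have Tlin := deriv_op_linear R n mp mm.
have Tfun := @deriv_op_functional R n mp mm.
have trl := @ur_linear R n mp mm.
have tll := @ul_linear R n mp mm.
have green := @green_sum R n mp mm.
have T0P := @deriv0_opP R n mp mm.
have surj := @traces_surjective R n mp mm.
have weak := @deriv0_adjoint R n mp mm.
have [accD maxD maxD'] := boundary_triple_accretivity dotC dotl Tlin Tfun trl tll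
  green T0P surj weak linD subD Dsub.
have bcE := @bc_spaceE R n mp mm.
split.
- rewrite accD /gram_le1; split=> -[M cM DM]; exists M => //;
    by move: DM; rewrite bcE.
- move=> M; rewrite bcE => DM /=.
  have [h1 h2 h3] := adjoint_boundary_space dotC dotl Tlin Tfun trl tll green T0P
    surj weak subD Dsub DM.
  split => //; rewrite h3; apply/seteqP; split => v [vH bv]; split => //.
    exact: (iffRL (H1sumP v)).
  exact: (iffLR (H1sumP v)).
- rewrite maxD /gram_le1; split=> -[M cM DM]; exists M => //;
    by move: DM; rewrite bcE.
- exact: maxD'.
Qed.
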